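(* Let $V$ be a real convex polynomial of even degree $2p$ growing at infinity. For each $n$ let $M_n$ be a random Hermitian $n\times n$ matrix distributed according to $$P_n(dM)=Z_n^{-1}\exp(-n\operatorname{Tr}V(M))\,dM,$$ and let $N_n$ be its normalized eigenvalue counting measure. Then as $n\to\infty$ the measures $N_n$ converge weakly in probability to the nonrandom measure whose density is concentrated on an interval $(a,b)$ and has the form $$\rho(\lambda)=p_{2p-2}(\lambda)\sqrt{(b-\lambda)(\lambda-a)},\qquad a\le\lambda\le b,$$ where $$p_{2p-2}(\lambda)=\frac{1}{2\pi^2}\int_a^b\frac{V'(\lambda)-V'(\mu)}{\lambda-\mu}\,\frac{d\mu}{\sqrt{(b-\mu)(\mu-a)}}$$ is a polynomial of degree $2p-2$ that is positive on $(a,b)$, and $a$ and $b$ are uniquely defined by the equations $$\int_a^b\frac{\mu^qV'(\mu)\,d\mu}{\sqrt{(b-\mu)(\mu-a)}}=2\pi\delta_{1q},\qquad q=0,1.$$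
   Context: For a Hermitian $n\times n$ matrix $M_n$ with eigenvalues $\lambda_1^{(n)},\dots,\lambda_n^{(n)}$ (counted with multiplicity), $N_n(\Delta)=\frac1n\#\{i:\lambda_i^{(n)}\in\Delta\}$ for Borel $\Delta\subset\mathbf{R}$. The measure $dM=\prod_{1\le j\le n}dM_{jj}\prod_{1\le j<k\le n}d\,\mathrm{Re}\,M_{jk}\,d\,\mathrm{Im}\,M_{jk}$ is Lebesgue measure on the space of Hermitian $n\times n$ matrices, and $Z_n$ is the normalization constant. $\delta_{1q}$ is the Kronecker symbol. Weak convergence in probability of random measures $N_n$ to a nonrandom measure $N$ means that $\int\varphi\,dN_n\to\int\varphi\,dN$ in probability for each bounded continuous $\varphi$. The matrices for different $n$ may be realized on any common probability space. *)

(* Defs.v *)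
From HB Require Import structures.
From mathcomp Require Import all_boot all_order all_algebra.
From mathcomp Require Import complex.
From mathcomp Require Import all_classical all_reals all_analysis.

Set Implicit Arguments.
Unset Strict Implicit.
Unset Printing Implicit Defensive.

Import Order.TTheory GRing.Theory Num.Theory.
Import numFieldNormedType.Exports.

Local Open Scope classical_set_scope.
Local Open Scope ring_scope.

Section LebesgueTuple.
Context {R : realType}.
Local Notation RM := (measurableTypeR R).

Notation cons_pair m := (fun x : RM * m.-tuple RM => [tuple of x.1 :: x.2]).

Section Step.
Variables (m : nat) (mu : {sigma_finite_measure set (m.-tuple RM) -> \bar R}).

Definition lebesgue_cons : set (m.+1.-tuple RM) -> \bar R :=
  pushforward (lebesgue_measure \x mu)%E (cons_pair m).

Let measurable_cons_pair : measurable_fun setT (cons_pair m).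
Proof. exact: measurable_cons. Qed.

Let lebesgue_cons0 : lebesgue_cons set0 = 0%E.
Proof. by rewrite /lebesgue_cons /pushforward preimage_set0 measure0. Qed.

Let lebesgue_cons_ge0 A : (0 <= lebesgue_cons A)%E.
Proof. exact: measure_ge0. Qed.

Let lebesgue_cons_sigma_additive : semi_sigma_additive lebesgue_cons.
Proof.
move=> F mF tF mUF; rewrite /lebesgue_cons /pushforward preimage_bigcup.
apply: measure_semi_sigma_additive.
- by move=> n; rewrite -[X in measurable X]setTI; exact: measurable_cons_pair.
- apply/trivIsetP => /= i j _ _ ij; rewrite -preimage_setI.
  by move/trivIsetP : tF => /(_ i j Logic.I Logic.I ij) ->; rewrite preimage_set0.
- rewrite -preimage_bigcup -[X in measurable X]setTI.
  exact: measurable_cons_pair.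
Qed.

HB.instance Definition _ := isMeasure.Build _ _ _ lebesgue_cons
  lebesgue_cons0 lebesgue_cons_ge0 lebesgue_cons_sigma_additive.

Let lebesgue_cons_sigma_finite : sigma_finite setT lebesgue_cons.
Proof.
have /sigma_finiteP[F [TF ndF Foo]] := sigma_finiteT (@lebesgue_measure R).
have /sigma_finiteP[G [TG ndG Goo]] := sigma_finiteT mu.
pose g (x : m.+1.-tuple RM) : RM * m.-tuple RM :=
  (thead x, [tuple of behead x]).
have mg : measurable_fun setT g.
  by apply/measurable_fun_pair; [exact: measurable_tnth|exact: measurable_behead].
exists (fun n => g @^-1` (F n `*` G n)).
  apply/esym; rewrite -subTset => x _.
  have [k _ Fk] : (\bigcup_n F n) (thead x) by rewrite -TF.
  have [l _ Gl] : (\bigcup_n G n) [tuple of behead x] by rewrite -TG.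
  exists (maxn k l) => //; split.
    by move: Fk; exact/subsetPset/ndF/leq_maxl.
  by move: Gl; exact/subsetPset/ndG/leq_maxr.
move=> k; have [? ?] := Foo k; have [? ?] := Goo k; split.
  by rewrite -[X in measurable X]setTI; apply: mg => //; exact: measurableX.
rewrite /lebesgue_cons /pushforward.
rewrite -comp_preimage (_ : g \o cons_pair m = id) ?preimage_id; last first.
  by apply/funext => -[x t]; rewrite /= /g theadE; congr (_, _); exact: val_inj.
by rewrite product_measure1E// lte_mul_pinfty// ge0_fin_numE.
Qed.

HB.instance Definition _ := Measure_isSigmaFinite.Build _ _ _ lebesgue_cons
  lebesgue_cons_sigma_finite.

End Step.

(* Lebesgue measure on R ^ m, as an iterated product measure. *)
Fixpoint lebesgue_tuple (m : nat) :
    {sigma_finite_measure set (m.-tuple RM) -> \bar R} :=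
  if m is m'.+1 then lebesgue_cons (lebesgue_tuple m')
  else dirac [tuple].

End LebesgueTuple.

Section HermitianCoordinates.
Context {R : realType}.
Local Notation RM := (measurableTypeR R).
Context {n : nat}.

(* A Hermitian matrix is recorded by n ^ 2 independent real coordinates: the
   real parts of its entries (i, j) with i <= j (on the diagonal, the entries
   themselves), and, at position (j, i), the imaginary part of its entry (i, j)
   with i < j. Positions are numbered by mxvec_index. *)
Definition hermitian_coords (A : 'M[R[i]]_n) : (n * n).-tuple RM :=
  let B := \matrix_(i, j) if (i <= j)%N then complex.Re (A i j)
                          else complex.Im (A j i) in
  [tuple mxvec B 0 k | k < n * n].

Definition hermitian_of_coords (x : (n * n).-tuple RM) : 'M[R[i]]_n :=
  let c i j : R := tnth x (mxvec_index i j) in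
  \matrix_(i, j) if i == j then Complex (c i i) 0
                 else if (i < j)%N then Complex (c i j) (c j i)
                 else Complex (c j i) (- c i j).

Lemma hermitian_of_coordsK : cancel hermitian_of_coords hermitian_coords.
Proof.
move=> x; apply: eq_from_tnth => k; rewrite tnth_mktuple.
case/mxvec_indexP: k => i j; rewrite mxvecE !mxE.
have [<-|ij] := eqVneq i j; first by rewrite leqnn.
by case: (ltngtP i j) => // /ord_inj/eqP; rewrite (negPf ij).
Qed.

Lemma hermitian_coordsK (A : 'M[R[i]]_n) :
  A \is hermsymmx -> hermitian_of_coords (hermitian_coords A) = A.
Proof.
move=> /is_hermitianmxP; rewrite expr0 scale1r => AE.
apply/matrixP => i j; have AEij k l : A k l = (A l k)^*.
  by rewrite {1}AE !mxE.
rewrite !mxE !tnth_mktuple !mxvecE !mxE.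
have [<-|ij] := eqVneq i j.
  rewrite leqnn; have := AEij i i.
  case: (A i i) => a b [] /eqP; rewrite -subr_eq0 opprK -mulr2n mulrn_eq0 /=.
  by move=> /eqP ->.
case: (ltngtP i j) => [_|_|/ord_inj/eqP]; last by rewrite (negPf ij).
  by case: (A i j).
by rewrite (AEij i j); case: (A j i).
Qed.

End HermitianCoordinates.

Section MatrixModel.
Context {R : realType}.
Local Notation RM := (measurableTypeR R).

Section FixedSize.
Context {n : nat}.
Local Notation N := n.+1.

(* Tr V(A), which is real when A is Hermitian. *)
Definition trace_poly (V : {poly R}) (A : 'M[R[i]]_N) : R :=
  complex.Re (\tr (horner_mx A (map_poly (real_complex R) V))).

Definition weight (V : {poly R}) (x : (N * N).-tuple RM) : \bar R :=
  (expR (- N%:R * trace_poly V (hermitian_of_coords x)))%:E.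

Definition partition_function (V : {poly R}) : \bar R :=
  (\int[lebesgue_tuple (N * N)]_x weight V x)%E.

Definition matrix_law (V : {poly R}) (B : set ((N * N).-tuple RM)) : \bar R :=
  ((fine (partition_function V))^-1%:E *
   \int[lebesgue_tuple (N * N)]_(x in B) weight V x)%E.

Definition random_matrix_of d (Omega : measurableType d)
    (P : probability Omega R) (V : {poly R}) (M : Omega -> 'M[R[i]]_N) : Prop :=
  [/\ forall w, M w \is hermsymmx,
      measurable_fun setT (hermitian_coords \o M)
    & forall B, measurable B ->
        P ((hermitian_coords \o M) @^-1` B) = matrix_law V B].

(* The roots of the characteristic polynomial, with multiplicity; they are real
   when A is Hermitian, so that taking real parts only changes their type. *)
Definition eigenvalues (A : 'M[R[i]]_N) : seq R :=
  [seq complex.Re z | z <- sval (closed_field_poly_normal (char_poly A))].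

Definition empirical_measure (A : 'M[R[i]]_N) : {measure set RM -> \bar R} :=
  mscale (N%:R^-1)%:nng (msum (fun i => dirac ((eigenvalues A)`_i : RM)) N).

End FixedSize.

Definition cvg_in_probability d (Omega : measurableType d)
    (P : probability Omega R) (X : nat -> Omega -> R) (l : R) : Prop :=
  (forall n, measurable_fun setT (X n)) /\
  forall eps : R, 0 < eps ->
    P [set w | eps <= `|X n w - l|] @[n --> \oo] --> 0%E.

Definition weak_cvg_in_probability d (Omega : measurableType d)
    (P : probability Omega R)
    (mu : nat -> Omega -> {measure set RM -> \bar R})
    (nu : {measure set RM -> \bar R}) : Prop :=
  forall phi : R -> R, continuous phi -> bounded_fun phi ->
    cvg_in_probability P (fun n w => \int[mu n w]_x phi x) (\int[nu]_x phi x).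

Definition support_equations (V : {poly R}) (a b : R) : Prop :=
  forall q : nat, (q < 2)%N ->
    \int[lebesgue_measure]_(u in `]a, b[)
      (u ^+ q * V^`().[u] / Num.sqrt ((b - u) * (u - a))) =
    2 * pi * (q == 1%N)%:R.

(* The difference quotient takes the junk value 0 at u = x, which does not
   affect the integral. *)
Definition density_factor (V : {poly R}) (a b x : R) : R :=
  (2 * pi ^+ 2)^-1 *
  \int[lebesgue_measure]_(u in `]a, b[)
    ((V^`().[x] - V^`().[u]) / (x - u) / Num.sqrt ((b - u) * (u - a))).

Definition limit_density (V : {poly R}) (a b x : R) : R :=
  if a <= x <= b then density_factor V a b x * Num.sqrt ((b - x) * (x - a))
  else 0.

End MatrixModel.

Arguments partition_function {R} n V.

(* Main.v *)
Require Import Defs.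
From HB Require Import structures.
From mathcomp Require Import all_boot all_order all_algebra.
From mathcomp Require Import complex.
From mathcomp Require Import all_classical all_reals all_analysis.
From mathcomp Require Import measurable_realfun.
From mathcomp Require Import ring lra zify.

(** Why the theorem holds.

    The spectrum is compared with its limit through loop equations.  Write [m_j]
    for the [j]-th moment of the empirical spectral measure and
      [res_m = mean (V' * x ^ m) - \sum_(l < m) m_l * m_(m - 1 - l)].
    Integration by parts in the [n ^ 2] real coordinates along the vector field
    [M ^ m] gives, for every polynomial [X] in the coordinates, the loop equation
      [n ^ 2 * E (res_m * X) = E (derivative of X along M ^ m)]
    ([loop_equation]); the divergence of [M ^ m] is a sum of products of traces
    because the Hermitian basis is complete ([coords_sandwich_sum]).  With [X = 1]
    the coercivity of [V' * x] bounds all moments ([gibbs_int_mom_le]); with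
    [X = res_m] one gets [E (res_m ^ 2) = O(n ^ -2)] ([gibbs_int_resid_sqr]).  Hence,
    with probability close to one, the spectrum has bounded moments and satisfies
    any finite number of loop equations up to a small error ([good_event]).

    What remains is deterministic: such spectra have means close to those of the
    limit law.  Otherwise some sequence of spectra satisfies more and more loop
    equations while the mean of some test function stays away from its limit; the
    means along an ultrafilter converge to a positive functional that satisfies
    all loop equations exactly ([exists_loop_state]), and there is only one:

    - its moments grow geometrically, so it lives on a compact interval
      ([state_support]);
    - with [f] its Stieltjes transform, the loop equations say that
      [U = V' - 2 f] satisfies [U ^ 2 = D] in the upper half plane, for a real
      polynomial [D] ([discr_root_sqr]);
    - since [V'' >= 0], the imaginary part of [U] just above a real point is at
      least of the order of the height, so [D] has no critical point where it is
      positive ([discr_critical]) and [D <= 0] on a single interval [[a, b]];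
    - in the upper half plane [D] is the square of the analytic function [U], so
      its nonreal zeros, which come in conjugate pairs, have even order
      ([even_mup_discr]), and [D = (x - a) (x - b) h ^ 2] ([discr_factor]);
    - the expansion of [U = h * sqrt ((x - a) (x - b))] at infinity, where the
      inverse square root generates the moments of the arcsine law, turns into the
      two equations for [a] and [b], the formula of the density factor and all the
      moments of the functional ([exists_support]);
    - those equations have one solution because [V'] is monotone
      ([support_unique]).

    The existence of [a] and [b] is itself obtained from a limit functional
    ([exists_limit_support]).  Polynomials suffice for the moments, and the
    Weierstrass theorem extends the identification to continuous test functions
    ([state_limit_mean], [mean_eigenvalues_cvg]). *)

Set Implicit Arguments.
Unset Strict Implicit.
Unset Printing Implicit Defensive.

Import Order.TTheory GRing.Theory Num.Theory.
Import numFieldNormedType.Exports.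

Local Open Scope classical_set_scope.
Local Open Scope ring_scope.

(** * Polynomial approximation *)

Section Bernstein.
Context {R : realType}.
Implicit Types (f g : nat -> R) (x : R).

(** Evaluated at [x], the mean of [f] under the binomial law of parameters [n] and
    [x]; conditioning on the first trial gives the recursion. *)
Fixpoint bernstein n f : {poly R} :=
  if n is m.+1 then 'X * bernstein m (f \o succn) + (1 - 'X) * bernstein m f
  else (f 0%N)%:P.

Lemma bernsteinS n f x : (bernstein n.+1 f).[x] =
  x * (bernstein n (f \o succn)).[x] + (1 - x) * (bernstein n f).[x].
Proof. by rewrite /= hornerD !hornerM !hornerE. Qed.

Lemma le_bernstein n f g x : 0 <= x <= 1 ->
  (forall k, (k <= n)%N -> f k <= g k) -> (bernstein n f).[x] <= (bernstein n g).[x].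
Proof.
move=> /andP[x0 x1]; elim: n f g => [|n IH] f g fg.
  by rewrite /= !hornerC; exact: fg.
rewrite !bernsteinS lerD// ler_wpM2l ?subr_ge0// IH// => k kn.
  exact: (fg k.+1).
exact/fg/leqW.
Qed.

Lemma bernstein_lin n a f g x :
  (bernstein n (fun k => a * f k + g k)).[x]
  = a * (bernstein n f).[x] + (bernstein n g).[x].
Proof.
elim: n f g => [|n IH] f g; first by rewrite /= !hornerC.
by rewrite !bernsteinS (IH (f \o succn) (g \o succn)) (IH f g); ring.
Qed.

Lemma bernstein_cst n a x : (bernstein n (fun=> a)).[x] = a.
Proof.
elim: n => [|n IH]; first by rewrite /= hornerC.
have E : (bernstein n ((fun=> a) \o succn)).[x] = a by [].
by rewrite bernsteinS E; ring.
Qed.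

(** The shift by [c] makes the induction close: with [c = - n x] this is the
    binomial variance. *)
Lemma bernstein_var n x c :
  (bernstein n (fun k => (k%:R + c) ^+ 2)).[x]
  = n%:R * x * (1 - x) + (n%:R * x + c) ^+ 2.
Proof.
elim: n c => [|n IH] c; first by rewrite /= hornerC !mul0r !add0r.
rewrite bernsteinS IH.
rewrite (_ : _ \o _ = (fun k => (k%:R + (1 + c)) ^+ 2)) ?IH; last first.
  by apply/funext => k /=; rewrite -natr1 addrA.
by rewrite -natr1; ring.
Qed.

End Bernstein.

Section Weierstrass.
Context {R : realType}.
Implicit Types (f : R -> R).

Lemma continuous_bounded_itv f (B : R) : continuous f ->
  exists M, forall x, `|x| <= B -> `|f x| <= M.
Proof.
move=> cf; have [B0|B0] := ltP B 0.
  by exists 0 => x xB; have := le_lt_trans xB B0; rewrite normr_lt0.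
have cn : {within `[- B, B], continuous (fun x => `|f x|)}.
  apply: continuous_subspaceT => x.
  by apply: continuous_comp; [exact: cf|exact: norm_continuous].
have [|c _ cM] := EVT_max _ cn; first by lra.
by exists `|f c| => x xB; apply: cM; rewrite in_itv/= -ler_norml.
Qed.

(** The form of uniform continuity that a variance bound consumes.  Were it false,
    violating pairs would accumulate on the diagonal by compactness. *)
Lemma quadratic_modulus f (B e : R) : continuous f -> 0 < e ->
  exists2 C : R, 0 <= C & forall x y, `|x| <= B -> `|y| <= B ->
    `|f x - f y| <= e + C * (x - y) ^+ 2.
Proof.
move=> cf e0; apply: contrapT => /forall2NP H.
have [M fM] := continuous_bounded_itv B cf.
have /choice[u uP] (n : nat) : exists xy : R * R,
    [/\ `|xy.1| <= B, `|xy.2| <= B &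
        e + n%:R * (xy.1 - xy.2) ^+ 2 < `|f xy.1 - f xy.2|].
  have [/(_ (ler0n _ _))//|] := H n%:R.
  move=> /existsNP[x /existsNP[y]].
  move=> /not_implyP[xB] /not_implyP[yB] /negP; rewrite -ltNge => xy.
  by exists (x, y).
have bu : bounded_fun (fun n => (u n).1).
  exists B; split; first exact: num_real.
  by move=> z Bz n _ /=; have [h _ _] := uP n; exact: le_trans h (ltW Bz).
have [g gincr /cvg_ex[l /= gl]] := bolzano_weierstrass bu.
have cl := cf l.
have /cvgrPdist_lt/(_ _ (divr_gt0 e0 (ltr0n R 2))) := cl.
move=> /nbhs_ballP[d /= d0 fd].
have M0 : 0 <= M.
  by have [h _ _] := uP 0%N; exact: le_trans (normr_ge0 _) (fM _ h).
have d20 : 0 < d / 2 by rewrite divr_gt0.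
have [n [n1 n2]] : exists n, `|l - (u (g n)).1| < d / 2 /\ 2 * M < (g n)%:R * (d / 2) ^+ 2.
  have n2 : \forall n \near \oo, 2 * M / (d / 2) ^+ 2 < n%:R :> R.
    exact: nbhs_infty_gtr.
  have n1 : \forall n \near \oo, `|l - (u (g n)).1| < d / 2.
    by move/cvgrPdist_lt : gl => /(_ _ d20).
  have [n [h1 h2]] := filter_ex (filterI n1 n2).
  exists n; split => //.
  rewrite -ltr_pdivrMr ?exprn_gt0//; apply: lt_le_trans h2 _.
  rewrite ler_nat; elim: (n) => // m IH; rewrite (leq_ltn_trans IH)//.
  move/increasing_seqP : gincr => /(_ m) /=.
  by [].
have [h1 h2 h3] := uP (g n).
set x := (u (g n)).1 in n1 h1 h3 *; set y := (u (g n)).2 in h2 h3 *.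
have fxy : `|f x - f y| <= 2 * M.
  by rewrite (le_trans (ler_normB _ _))// mulr2n mulrDl mul1r lerD// fM.
have xy : `|x - y| < d / 2.
  rewrite ltNge; apply/negP => dxy.
  have : (d / 2) ^+ 2 <= (x - y) ^+ 2.
    by rewrite -(real_normK (num_real (x - y))) lerXn2r ?nnegrE// ltW.
  move=> /(ler_wpM2l (ler0n R (g n))) hh.
  lra.
have fx : `|f l - f x| < e / 2 by apply: fd; rewrite /ball/=; lra.
have fy : `|f l - f y| < e / 2.
  apply: fd; rewrite /ball/=.
  have := ler_normD (l - x) (x - y); rewrite addrA subrK; lra.
have : `|f x - f y| < e.
  have := ler_normD (f x - f l) (f l - f y); rewrite addrA subrK (distrC (f x) (f l)); lra.
have : 0 <= (g n)%:R * (x - y) ^+ 2 by rewrite mulr_ge0// sqr_ge0.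
lra.
Qed.

(** Bernstein's proof: by [quadratic_modulus] the error is at most
    [e / 2 + C * variance], and the variance of the rescaled binomial law is
    [O(B ^ 2 / n)]. *)
Theorem weierstrass f (B e : R) : continuous f -> 0 < e ->
  exists q : {poly R}, forall x, `|x| <= B -> `|f x - q.[x]| <= e.
Proof.
move=> cf e0.
have [B0|B0] := ltP B 0.
  by exists 0 => x xB; have := le_lt_trans xB B0; rewrite normr_lt0.
wlog B1 : B B0 / 0 < B.
  move=> /(_ (B + 1)); case; [lra|lra|move] => q qP; exists q => x xB; apply: qP; lra.
have [C C0 fC] := quadratic_modulus B cf (divr_gt0 e0 (ltr0n R 2)).
pose n := (Num.Def.archi_bound (2 * C * B ^+ 2 / e)).+1.
have nP : 2 * C * B ^+ 2 < n%:R * e.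
  rewrite -ltr_pdivrMr//; apply: lt_trans (archi_boundP _) _.
    by rewrite divr_ge0 ?mulr_ge0 ?sqr_ge0 // ltW.
  by rewrite ltr_nat.
have n0 : 0 < n%:R :> R by rewrite ltr0n.
(* the nodes [k / n] and the variable are carried from [[0, 1]] to [[- B, B]] *)
pose s (k : nat) : R := B * (2 * (k%:R / n%:R) - 1).
pose T : {poly R} := (2 * B)^-1 *: ('X + B%:P).
exists (bernstein n (f \o s) \Po T) => x xB.
rewrite horner_comp; set t := T.[x].
have tE : t = (x + B) / (2 * B) by rewrite /t /T !hornerE mulrC.
have xt : x = B * (2 * t - 1) by rewrite tE; field; rewrite gt_eqF.
have t01 : 0 <= t <= 1.
  rewrite tE divr_ge0 ?ler_pdivrMr ?mul1r; try by move: xB; rewrite ler_norml; lra.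
have sB k : (k <= n)%N -> `|s k| <= B.
  move=> kn; have : 0 <= (k%:R / n%:R : R) <= 1.
    by rewrite divr_ge0//= ler_pdivrMr// mul1r ler_nat.
  rewrite /s; set z := _ / _ => z01; rewrite ler_norml.
  have : 0 <= B * z by rewrite mulr_ge0//; lra.
  have : 0 <= B * (1 - z) by rewrite mulr_ge0//; lra.
  by lra.
pose c := C * (2 * B / n%:R) ^+ 2.
have key k : (k <= n)%N ->
    `|f x - f (s k)| <= e / 2 + c * (k%:R + - (n%:R * t)) ^+ 2.
  move=> kn; rewrite (le_trans (fC _ _ xB (sB k kn)))// lerD2l.
  rewrite le_eqVlt; apply/orP; left; apply/eqP.
  by rewrite /c /s {1}xt; field; rewrite gt_eqF.
pose E := e / 2 + c * (n%:R * t * (1 - t)).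
have EE : E = (bernstein n (fun k => c * (k%:R + - (n%:R * t)) ^+ 2 + e / 2)).[t].
  by rewrite bernstein_lin bernstein_cst bernstein_var /E; ring.
have Ee : E <= e.
  suff : c * (n%:R * t * (1 - t)) <= e / 2 by rewrite /E; lra.
  have t4 : t * (1 - t) <= 1 / 4 by have := sqr_ge0 (t - 1 / 2); rewrite expr2; lra.
  have -> : c * (n%:R * t * (1 - t)) = 4 * C * B ^+ 2 / n%:R * (t * (1 - t)).
    by rewrite /c; field; rewrite gt_eqF.
  have h0 : 0 <= 4 * C * B ^+ 2 / n%:R by rewrite divr_ge0// !mulr_ge0// sqr_ge0.
  apply: le_trans (ler_wpM2l h0 t4) _.
  rewrite (_ : _ * (1 / 4) = C * B ^+ 2 / n%:R); last by field; rewrite gt_eqF.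
  by rewrite ler_pdivrMr//; lra.
have fE : f x = (bernstein n (fun=> f x)).[t] by rewrite bernstein_cst.
rewrite (le_trans _ Ee)// ler_norml; apply/andP; split.
  rewrite lerBrDr -[leLHS]addrC -subr_ge0.
  rewrite -[X in 0 <= X](_ : (bernstein n (fun k => 1 * f x + (c * (k%:R + - (n%:R * t)) ^+ 2 + e / 2))).[t] - (bernstein n (f \o s)).[t] = _); last first.
    by rewrite bernstein_lin bernstein_cst -EE; ring.
  rewrite subr_ge0 le_bernstein// => k kn /=.
  by have := key k kn; rewrite ler_norml; lra.
rewrite lerBlDr -subr_ge0.
rewrite -[X in 0 <= X](_ : (bernstein n (fun k => 1 * f (s k) + (c * (k%:R + - (n%:R * t)) ^+ 2 + e / 2))).[t] - (bernstein n (fun=> f x)).[t] = _); last first.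
  by rewrite bernstein_lin bernstein_cst -EE mul1r; ring.
rewrite subr_ge0 le_bernstein// => k kn /=.
by have := key k kn; rewrite ler_norml; lra.
Qed.

End Weierstrass.

(** * Integration by parts against Lebesgue measure on R ^ m *)

Section GaussLine.
Context {R : realType}.
Local Notation mu := (@lebesgue_measure R).

Lemma integrable_gauss (c : R) : 0 < c ->
  mu.-integrable setT (EFin \o (fun x => expR (- c * x ^+ 2))).
Proof.
move=> c0; pose s := Num.sqrt (2 * c)^-1.
have s2 : s ^+ 2 = (2 * c)^-1 by rewrite sqr_sqrtr// invr_ge0 mulr_ge0// ltW.
have s0 : s != 0 by rewrite gt_eqF// sqrtr_gt0 invr_gt0 mulr_gt0.
rewrite [X in _.-integrable _ X](_ : _ =
    (fun x => ((normal_peak s)^-1%:E * (normal_pdf 0 s x)%:E)%E)); last first.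
  apply/funext => x /=; rewrite -EFinM normal_pdfE//= [in RHS]mulrA mulVf ?mul1r; last first.
    by rewrite gt_eqF// normal_peak_gt0.
  by rewrite /normal_fun subr0 s2; congr (expR _)%:E; field; rewrite gt_eqF.
by apply: integrableZl => //; exact: integrable_normal_pdf.
Qed.

Lemma cvg_gauss0 (c : R) : 0 < c -> expR (- c * n%:R ^+ 2) @[n --> \oo] --> (0 : R).
Proof.
move=> c0; apply/cvgrPdist_lt => e e0; near=> n.
rewrite sub0r normrN ger0_norm ?expR_ge0//.
have n0 : 0 < n%:R :> R by near: n; exact: nbhs_infty_gtr.
have n1 : (c * e)^-1 < n%:R by near: n; exact: nbhs_infty_gtr.
have n2 : 1 < n%:R :> R by near: n; exact: nbhs_infty_gtr.
rewrite mulNr expRN -[ltRHS]invrK ltf_pV2 ?posrE ?invr_gt0 ?expR_gt0//.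
apply: lt_le_trans (expR_ge1Dx _).
have : e^-1 < c * n%:R.
  by move: n1; rewrite invfM mulrC ltr_pdivrMr// mulrC.
have : c * n%:R <= c * n%:R ^+ 2.
  by rewrite ler_pM2l// expr2 ler_peMl// ltW.
lra.
Unshelve. all: by end_near. Qed.

(** The fundamental theorem of calculus on [[- n, n]]; the Gaussian bound kills the
    boundary terms and dominates the integrals. *)
Lemma integral_derivative_line (F f : R -> R) (c C : R) : 0 < c ->
  (forall x, is_derive x (1:R) F (f x)) -> continuous f ->
  (forall x, `|F x| <= C * expR (- c * x ^+ 2)) ->
  (forall x, `|f x| <= C * expR (- c * x ^+ 2)) ->
  (\int[mu]_x (f x)%:E = 0)%E.
Proof.
move=> c0 dF cf FC fC.
have mf : measurable_fun setT f by exact: continuous_measurable_fun.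
pose f_ n x := (f x * \1_(`[- n%:R, n%:R] : set R) x)%:E.
have h1 : (\int[mu]_x f_ n x)%E @[n --> \oo] --> (\int[mu]_x (f x)%:E)%E.
  apply: (@dominated_cvg _ _ _ mu setT measurableT f_ (EFin \o f)
     (EFin \o (fun x => C * expR (- c * x ^+ 2)))) => //.
  - by move=> n; apply/measurable_EFinP/measurable_funM.
  - move=> x _; apply: cvg_near_cst; near=> n.
    rewrite /f_ indicE mem_set ?mulr1//= in_itv/= -ler_norml.
    by near: n; exact: nbhs_infty_ger.
  - rewrite (_ : _ \o _ = (fun x => C%:E * (EFin \o (fun x => expR (- c * x ^+ 2))) x)%E)//.
    by apply: integrableZl => //; exact: integrable_gauss.
  - move=> n x _; rewrite /f_ abse_EFin lee_fin normrM (le_trans _ (fC x))//.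
    by rewrite ler_piMr// indicE; case: (_ \in _); rewrite ?normr1 ?normr0.
have h2 : (\int[mu]_x f_ n x)%E @[n --> \oo] --> 0%E.
  have E : \forall n \near \oo, (F n%:R - F (- n%:R))%:E = (\int[mu]_x f_ n x)%E.
    near=> n.
    have n0 : 0 < n%:R :> R by near: n; exact: nbhs_infty_gtr.
    transitivity (\int[mu]_(x in `[(- n%:R : R)%R, (n%:R : R)%R]) (f x)%:E)%E; last first.
      rewrite integral_mkcond; apply: eq_integral => x _.
      by rewrite /f_ patchE indicE; case: ifP; rewrite ?mulr1 ?mulr0.
    have cF x : {for x, continuous F}.
      by apply: differentiable_continuous; exact/derivable1_diffP/ex_derive.
    rewrite (@continuous_FTC2 _ _ F)//.
    - by lra.
    - exact: continuous_subspaceT.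
    - split => [x _| |]; first exact: ex_derive.
        by apply: cvg_at_right_filter; exact: cF.
      by apply: cvg_at_left_filter; exact: cF.
    - by move=> x _; rewrite derive1E derive_val.
  apply: (cvg_trans (near_eq_cvg E)); apply: cvg_EFin; first exact: nearW.
  have C0 : C * expR (- c * n%:R ^+ 2) @[n --> \oo] --> C * 0.
    by apply: cvgM; [exact: cvg_cst|exact: cvg_gauss0].
  apply/cvgrPdist_lt => e e0.
  move/cvgrPdist_lt: C0; rewrite mulr0 => /(_ _ (divr_gt0 e0 (ltr0n R 2))) C0.
  near=> n.
  have : `|0 - C * expR (- c * n%:R ^+ 2)| < e / 2 by near: n.
  rewrite !sub0r !normrN => h.
  have := ler_norm (C * expR (- c * n%:R ^+ 2)).
  have := FC n%:R; have := FC (- n%:R); rewrite sqrrN.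
  have := ler_normB (F n%:R) (F (- n%:R)).
  lra.
exact: (cvg_unique _ h1 h2).
Unshelve. all: by end_near. Qed.

End GaussLine.

Section GaussTuple.
Context {R : realType}.
Local Notation RM := (measurableTypeR R).

Definition sqnorm m (t : m.-tuple RM) : R := \sum_(i < m) tnth t i ^+ 2.

Definition cons_pair m (z : RM * m.-tuple RM) : m.+1.-tuple RM := [tuple of z.1 :: z.2].

Definition upd m (t : m.-tuple RM) (k : 'I_m) (s : RM) : m.-tuple RM :=
  [tuple if i == k then s else tnth t i | i < m].

Lemma measurable_cons_pair m : measurable_fun setT (@cons_pair m).
Proof. exact: measurable_cons. Qed.

Lemma sqnorm_ge0 m (t : m.-tuple RM) : 0 <= sqnorm t.
Proof. by apply: sumr_ge0 => i _; exact: sqr_ge0. Qed.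

Lemma sqnorm_cons m (z : RM * m.-tuple RM) :
  sqnorm (cons_pair z) = z.1 ^+ 2 + sqnorm z.2.
Proof.
rewrite /sqnorm big_ord_recl; congr (_ + _).
by apply: eq_bigr => i _; rewrite tnthS.
Qed.

Lemma upd_cons0 m x (t : m.-tuple RM) s :
  upd (cons_pair (x, t)) ord0 s = cons_pair (s, t).
Proof.
apply: eq_from_tnth => i; rewrite tnth_mktuple.
by case: (unliftP ord0 i) => [j|] -> //; rewrite !tnthS.
Qed.

Lemma upd_consS m x (t : m.-tuple RM) k s :
  upd (cons_pair (x, t)) (lift ord0 k) s = cons_pair (x, upd t k s).
Proof.
apply: eq_from_tnth => i; rewrite tnth_mktuple.
case: (unliftP ord0 i) => [j|] -> //.
by rewrite (inj_eq lift_inj) !tnthS tnth_mktuple.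
Qed.

Lemma updE m (t : m.-tuple RM) k : upd t k (tnth t k) = t.
Proof.
by apply: eq_from_tnth => i; rewrite tnth_mktuple; case: eqP => // ->.
Qed.

Lemma measurable_sqnorm m : measurable_fun setT (@sqnorm m).
Proof.
apply: measurable_sum => i; apply: measurable_funX; exact: measurable_tnth.
Qed.

Lemma ge0_integral_lebesgue_cons m (f : m.+1.-tuple RM -> \bar R) :
  measurable_fun setT f -> (forall t, 0 <= f t)%E ->
  (\int[lebesgue_tuple m.+1]_t f t =
   \int[lebesgue_measure \x lebesgue_tuple m]_z f (cons_pair z))%E.
Proof.
move=> mf f0.
rewrite (@ge0_integral_pushforward _ _ _ _ _ _ (@measurable_cons_pair m))//.
Qed.

Lemma integrable_gauss_tuple (c : R) m : 0 < c ->
  (@lebesgue_tuple R m).-integrable setT (EFin \o (fun t => expR (- c * sqnorm t))).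
Proof.
move=> c0.
have mg n : measurable_fun setT (fun t : n.-tuple RM => expR (- c * sqnorm t)).
  apply: measurableT_comp => //; apply: measurable_funM => //.
  exact: measurable_sqnorm.
elim: m => [|m IH].
  apply/integrableP; split; first by apply/measurable_EFinP; exact: mg.
  rewrite /= integral_dirac //; last first.
    apply/measurable_EFinP; apply: measurableT_comp; first exact: normr_measurable.
    exact: mg.
  by rewrite ?diracT ?mul1e ltry.
apply/integrableP; split; first by apply/measurable_EFinP; exact: mg.
rewrite ge0_integral_lebesgue_cons//; last first.
  apply: measurableT_comp => //; apply/measurable_EFinP; exact: mg.
rewrite (eq_integral (fun z : RM * m.-tuple RM =>
    ((expR (- c * z.1 ^+ 2))%:E * (expR (- c * sqnorm z.2))%:E)%E)); last first.
  by move=> z _; rewrite /= ger0_norm ?expR_ge0// sqnorm_cons mulrDr expRD EFinM.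
rewrite fubini_tonelli1; last 2 first.
- apply: emeasurable_funM; apply/measurable_EFinP.
    apply: measurableT_comp => //; apply: measurable_funM => //.
    exact: measurable_funX.
  apply: measurableT_comp (mg m) _; exact: measurable_snd.
- by move=> z; rewrite mule_ge0// lee_fin expR_ge0.
rewrite /fubini_F /=.
have I_ge0 : (0 <= \int[lebesgue_tuple m]_t (expR (- c * sqnorm t))%:E)%E.
  by apply: integral_ge0 => t _; rewrite lee_fin expR_ge0.
have E x : (\int[lebesgue_tuple m]_t ((expR (- c * x ^+ 2))%:E * (expR (- c * sqnorm t))%:E)
    = (expR (- c * x ^+ 2))%:E * \int[lebesgue_tuple m]_t (expR (- c * sqnorm t))%:E)%E.
  by apply: ge0_integralZl => //; apply/measurable_EFinP; exact: mg.
under eq_integral => x _ do rewrite E.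
have I1 : (\int[lebesgue_measure]_x (expR (- c * x ^+ 2))%:E < +oo)%E.
  have /integrableP[_] := integrable_gauss c0; apply: le_lt_trans.
  by under [X in (_ <= X)%E]eq_integral do rewrite /= ger0_norm ?expR_ge0//.
have I2 : (\int[lebesgue_tuple m]_t (expR (- c * sqnorm t))%:E < +oo)%E.
  move/integrableP : IH => [_]; apply: le_lt_trans.
  by under [X in (_ <= X)%E]eq_integral do rewrite /= ger0_norm ?expR_ge0//.
rewrite ge0_integralZr//.
  have I1_ge0 : (0 <= \int[lebesgue_measure]_x (expR (- c * x ^+ 2))%:E)%E.
    by apply: integral_ge0 => x _; rewrite lee_fin expR_ge0.
  apply: lte_mul_pinfty; [exact: I1_ge0| |exact: I2].
  by rewrite ge0_fin_numE.
apply/measurable_EFinP; apply: measurableT_comp => //.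
by apply: measurable_funM => //; exact: measurable_funX.
Qed.

Lemma integrable_gauss_bound (c C : R) m (F : m.-tuple RM -> R) : 0 < c ->
  measurable_fun setT F -> (forall t, `|F t| <= C * expR (- c * sqnorm t)) ->
  (@lebesgue_tuple R m).-integrable setT (EFin \o F).
Proof.
move=> c0 mF FC.
have := integrableZl measurableT C (integrable_gauss_tuple m c0).
apply: le_integrable => //; first exact/measurable_EFinP.
move=> t _ /=; rewrite lee_fin (le_trans (FC t))//.
exact: ler_norm.
Qed.

(** Slicing R ^ m along the k-th axis reduces the statement to the fundamental
    theorem of calculus on each line; the slices are reached by peeling off one
    coordinate of the iterated product measure at a time. *)
Lemma integral_partial_derivative m (k : 'I_m) (c C : R) (F f : m.-tuple RM -> R) :
  0 < c -> measurable_fun setT F -> measurable_fun setT f ->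
  (forall t s, is_derive s (1:R) (fun s : R => F (upd t k s)) (f (upd t k s))) ->
  (forall t, continuous (fun s : R => f (upd t k s))) ->
  (forall t, `|F t| <= C * expR (- c * sqnorm t)) ->
  (forall t, `|f t| <= C * expR (- c * sqnorm t)) ->
  (\int[lebesgue_tuple m]_t (f t)%:E = 0)%E.
Proof.
move=> c0; elim: m k C F f => [[]//|m IH] k C F f mF mf dF cf FC fC.
have mcons := @measurable_cons_pair m.
have mEf : measurable_fun setT (EFin \o f) by exact/measurable_EFinP.
have mEfc : measurable_fun setT (EFin \o f \o @cons_pair m).
  exact: measurableT_comp.
have iprod : (lebesgue_measure \x lebesgue_tuple m)%E.-integrable setT
    (EFin \o f \o @cons_pair m).
  apply/integrableP; split => //.
  rewrite -(@ge0_integral_lebesgue_cons _ (fun t => `|(f t)%:E|)%E)//; last first.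
    exact: measurableT_comp.
  by have /integrableP[] := integrable_gauss_bound c0 mf fC.
have -> : (\int[lebesgue_tuple m.+1]_t (f t)%:E =
   \int[lebesgue_measure \x lebesgue_tuple m]_z (f (cons_pair z))%:E)%E.
  by rewrite (@integral_pushforward _ _ _ _ _ _ mcons _ setT (EFin \o f)).
have gE x t : expR (- c * sqnorm (cons_pair (x, t)))
    = expR (- c * x ^+ 2) * expR (- c * sqnorm t).
  by rewrite sqnorm_cons mulrDr expRD.
have mslice x (G : m.+1.-tuple RM -> R) : measurable_fun setT G ->
    measurable_fun setT (fun t : m.-tuple RM => G (cons_pair (x, t))).
  move=> mG; apply: measurableT_comp mG _; apply: measurableT_comp mcons _.
  exact: measurable_pair1.
case: (unliftP ord0 k) => [k'|] kE; subst k.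
- rewrite -(integral12_prod_meas1 iprod); apply: integral0_eq => x _.
  rewrite /fubini_F /=.
  apply: (IH k' (C * expR (- c * x ^+ 2)) (fun t => F (cons_pair (x, t)))
     (fun t => f (cons_pair (x, t)))).
  + exact: mslice.
  + exact: mslice.
  + move=> t s; have := dF (cons_pair (x, t)) s.
    by under eq_fun do rewrite upd_consS; rewrite upd_consS.
  + move=> t; have := cf (cons_pair (x, t)).
    by under eq_fun do rewrite upd_consS.
  + by move=> t; rewrite -mulrA -gE.
  + by move=> t; rewrite -mulrA -gE.
- rewrite -(integral21_prod_meas1 iprod); apply: integral0_eq => t _.
  rewrite /fubini_G /=.
  apply: (@integral_derivative_line _ (fun x => F (cons_pair (x, t))) _ c
     (C * expR (- c * sqnorm t))) => //.
  + move=> s; have := dF (cons_pair (0, t)) s.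
    by under eq_fun do rewrite upd_cons0; rewrite upd_cons0.
  + have := cf (cons_pair (0, t)).
    by under eq_fun do rewrite upd_cons0.
  + by move=> x; rewrite mulrAC -mulrA -gE.
  + by move=> x; rewrite mulrAC -mulrA -gE.
Qed.

End GaussTuple.

(** * Polynomial functions of the coordinates *)

Section PolyFun.
Context {R : realType}.
Local Notation RM := (measurableTypeR R).
Context {m : nat}.
Implicit Types (F G W : m.-tuple RM -> R) (t : m.-tuple RM) (k : 'I_m).

(** Polynomial functions as an inductive predicate rather than as multivariate
    polynomials: growth, measurability and partial derivatives are all proved by
    induction on this description. *)
Inductive polyfun : (m.-tuple RM -> R) -> Prop :=
| polyfun_cst (a : R) : polyfun (fun=> a)
| polyfun_coord (i : 'I_m) : polyfun (fun t => tnth t i)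
| polyfunD F G : polyfun F -> polyfun G -> polyfun (fun t => F t + G t)
| polyfunM F G : polyfun F -> polyfun G -> polyfun (fun t => F t * G t).

Lemma polyfunZ a F : polyfun F -> polyfun (fun t => a * F t).
Proof. by move=> pF; apply: polyfunM => //; exact: polyfun_cst. Qed.

Lemma polyfunN F : polyfun F -> polyfun (fun t => - F t).
Proof. by move=> /(polyfunZ (-1)); under eq_fun do rewrite mulN1r. Qed.

Lemma polyfunB F G : polyfun F -> polyfun G -> polyfun (fun t => F t - G t).
Proof. by move=> pF /polyfunN; exact: polyfunD. Qed.

Lemma polyfun_sum (I : Type) (r : seq I) (P : pred I) (F : I -> m.-tuple RM -> R) :
  (forall i, P i -> polyfun (F i)) -> polyfun (fun t => \sum_(i <- r | P i) F i t).
Proof.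
move=> pF; elim: r => [|i r IH].
  by under eq_fun do rewrite big_nil; exact: polyfun_cst.
under eq_fun do rewrite big_cons; case Pi : (P i) => //.
by apply: polyfunD => //; exact: pF.
Qed.

Lemma measurable_polyfun F : polyfun F -> measurable_fun setT F.
Proof.
elim=> {F} [a|i|F G _ mF _ mG|F G _ mF _ mG].
- exact: measurable_cst.
- exact: measurable_tnth.
- exact: measurable_funD.
- exact: measurable_funM.
Qed.

Lemma polyfun_growth F : polyfun F ->
  exists C K, 0 <= C /\ forall t, `|F t| <= C * (1 + sqnorm t) ^+ K.
Proof.
have s1 t : 1 <= 1 + sqnorm t :> R by rewrite lerDl sqnorm_ge0.
elim=> {F} [a|i|F G _ [C [K [C0 FC]]] _ [D [L [D0 GD]]]
                |F G _ [C [K [C0 FC]]] _ [D [L [D0 GD]]]].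
- by exists `|a|, 0%N; split => // t; rewrite expr0 mulr1.
- exists 1, 1%N; split => // t; rewrite mul1r expr1.
  have : tnth t i ^+ 2 <= sqnorm t.
    by rewrite /sqnorm (bigD1 i)//= lerDl sumr_ge0// => j _; exact: sqr_ge0.
  rewrite -(real_normK (num_real (tnth t i))).
  by have := sqr_ge0 (`|tnth t i| - 1 / 2); lra.
- exists (C + D), (K + L)%N; split; first exact: addr_ge0.
  move=> t; rewrite (le_trans (ler_normD _ _))// mulrDl lerD//.
    apply: le_trans (FC t) _; rewrite ler_wpM2l// ler_weXn2l//.
    exact: leq_addr.
  apply: le_trans (GD t) _; rewrite ler_wpM2l// ler_weXn2l//.
  exact: leq_addl.
- exists (C * D), (K + L)%N; split; first exact: mulr_ge0.
  by move=> t; rewrite normrM exprD mulrACA ler_pM.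
Qed.

(** From [1 + x <= expR x] at [x = c * s / K], raised to the power [K]. *)
Lemma exprD1_le_expR (c : R) (K : nat) : 0 < c ->
  exists2 C : R, 0 <= C & forall s, 0 <= s -> (1 + s) ^+ K <= C * expR (c * s).
Proof.
move=> c0; have [->|K0] := posnP K.
  exists 1 => // s s0; rewrite expr0 mul1r -expR0 ler_expR mulr_ge0// ltW//.
have KR : 0 < K%:R :> R by rewrite ltr0n.
pose a := 1 + K%:R / c.
have a1 : 0 < K%:R / c by rewrite divr_gt0.
exists (a ^+ K); first by rewrite exprn_ge0// addr_ge0// ltW.
move=> s s0; have -> : c * s = K%:R * (c * s / K%:R).
  by rewrite [RHS]mulrC divfK// gt_eqF.
rewrite expRM_natl -exprMn lerXn2r ?nnegrE//.
- by rewrite addr_ge0.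
- by rewrite mulr_ge0 ?expR_ge0// addr_ge0// ltW.
have h : 1 + c * s / K%:R <= expR (c * s / K%:R) by exact: expR_ge1Dx.
have h0 : 0 <= c * s / K%:R by rewrite divr_ge0 ?mulr_ge0// ltW.
apply: le_trans (_ : a * (1 + c * s / K%:R) <= _); last first.
  by rewrite ler_wpM2l// addr_ge0// ltW.
have -> : a * (1 + c * s / K%:R) = 1 + s + (K%:R / c + c * s / K%:R).
  by rewrite /a; field; rewrite !gt_eqF.
by rewrite lerDl addr_ge0// ltW.
Qed.

Lemma polyfun_gauss F (c : R) : 0 < c -> polyfun F ->
  exists2 C : R, 0 <= C & forall t,
    `|F t| * expR (- (2 * c) * sqnorm t) <= C * expR (- c * sqnorm t).
Proof.
move=> c0 /polyfun_growth[D [K [D0 FD]]].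
have [C C0 hC] := exprD1_le_expR K c0.
exists (D * C); first exact: mulr_ge0.
move=> t; rewrite (_ : - (2 * c) = - c - c); last by ring.
rewrite mulrDl expRD mulrA ler_wpM2r ?expR_ge0//.
rewrite mulNr expRN ler_pdivrMr ?expR_gt0//.
by rewrite (le_trans (FD t))// -mulrA ler_wpM2l// hC// sqnorm_ge0.
Qed.

(** Differentiating at [upd t k s] for all [t] and [s] is differentiating at every
    point of the line through [t] along the [k]-th axis, which is how one-dimensional
    calculus applies. *)
Definition pd k F G := forall t (s : R),
  is_derive s (1:R) (fun s : R => F (upd t k s)) (G (upd t k s)).

Lemma pd_cst k a : pd k (fun=> a) (fun=> 0).
Proof. by move=> t s; exact: is_derive_cst. Qed.

Lemma pd_coord k i : pd k (fun t => tnth t i) (fun=> (i == k)%:R).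
Proof.
move=> t s; under eq_fun do rewrite tnth_mktuple.
case: eqP => _; [exact: is_derive_id|exact: is_derive_cst].
Qed.

Lemma pdD k F G F' G' : pd k F F' -> pd k G G' ->
  pd k (fun t => F t + G t) (fun t => F' t + G' t).
Proof. by move=> dF dG t s; exact: is_deriveD. Qed.

Lemma pdM k F G F' G' : pd k F F' -> pd k G G' ->
  pd k (fun t => F t * G t) (fun t => F' t * G t + F t * G' t).
Proof.
move=> dF dG t s; apply: is_derive_eq; first exact: is_deriveM.
by rewrite /= -![_ *: _]/(_ * _); ring.
Qed.

Lemma pdZ k a F F' : pd k F F' -> pd k (fun t => a * F t) (fun t => a * F' t).
Proof.
move=> dF t s; apply: is_derive_eq; first exact: (is_deriveM (is_derive_cst _ _ _) (dF t s)).
by rewrite /= -![_ *: _]/(_ * _); ring.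
Qed.

Lemma pdN k F F' : pd k F F' -> pd k (fun t => - F t) (fun t => - F' t).
Proof. by move=> dF t s; exact: is_deriveN. Qed.

Lemma pdB k F G F' G' : pd k F F' -> pd k G G' ->
  pd k (fun t => F t - G t) (fun t => F' t - G' t).
Proof. by move=> dF dG; apply: pdD => //; exact: pdN. Qed.

Lemma pd_sum k (I : Type) (r : seq I) (F F' : I -> m.-tuple RM -> R) :
  (forall i, pd k (F i) (F' i)) ->
  pd k (fun t => \sum_(i <- r) F i t) (fun t => \sum_(i <- r) F' i t).
Proof.
move=> dF; elim: r => [|i r IH].
  by move=> t s; under eq_fun do rewrite big_nil; rewrite big_nil; exact: is_derive_cst.
move=> t s; under eq_fun do rewrite big_cons.
by rewrite big_cons; exact: (pdD (dF i) IH).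
Qed.

Lemma pd_unique k F G G' : pd k F G -> pd k F G' -> G = G'.
Proof.
move=> dG dG'; apply/funext => t; rewrite -(updE t k).
have := dG t (tnth t k) => /@derive_val <-.
by have := dG' t (tnth t k) => /@derive_val <-.
Qed.

Lemma polyfun_pd k F : polyfun F -> exists2 G, polyfun G & pd k F G.
Proof.
elim=> {F} [a|i|F G pF [F' pF' dF] pG [G' pG' dG]|F G pF [F' pF' dF] pG [G' pG' dG]].
- by exists (fun=> 0); [exact: polyfun_cst|exact: pd_cst].
- by exists (fun=> (i == k)%:R); [exact: polyfun_cst|exact: pd_coord].
- by exists (fun t => F' t + G' t); [exact: polyfunD|exact: pdD].
- exists (fun t => F' t * G t + F t * G' t); last exact: pdM.
  by apply: polyfunD; exact: polyfunM.
Qed.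

Lemma polyfun_line_continuous k F t : polyfun F ->
  continuous (fun s : R => F (upd t k s)).
Proof.
move=> /(polyfun_pd k)[G _ dG] s.
by apply: differentiable_continuous; apply/derivable1_diffP; have [] := dG t s.
Qed.

Section Confining.
Variables (W : m.-tuple RM -> R) (c C : R).
Hypotheses (c0 : 0 < c) (pW : polyfun W)
  (Wge : forall t, c * sqnorm t - C <= W t).

Let measurable_density F : polyfun F -> measurable_fun setT (fun t => F t * expR (- W t)).
Proof.
move=> /measurable_polyfun mF; apply: measurable_funM => //.
apply: measurableT_comp => //; apply: measurable_funN.
exact: measurable_polyfun.
Qed.

Lemma polyfun_density_gauss F : polyfun F -> exists D, forall t,
  `|F t * expR (- W t)| <= D * expR (- (c / 2) * sqnorm t).
Proof.
move=> pF; have c20 : 0 < c / 2 by rewrite divr_gt0.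
have [D D0 FD] := polyfun_gauss c20 pF.
exists (expR C * D) => t.
rewrite normrM (ger0_norm (expR_ge0 _)) -mulrA.
have h : expR (- W t) <= expR C * expR (- (2 * (c / 2)) * sqnorm t).
  by rewrite -expRD ler_expR; have := Wge t; lra.
apply: le_trans (ler_wpM2l (normr_ge0 _) h) _.
by rewrite mulrCA ler_wpM2l// expR_ge0.
Qed.

Lemma integrable_polyfun F : polyfun F ->
  (@lebesgue_tuple R m).-integrable setT (fun t => (F t * expR (- W t))%:E).
Proof.
move=> pF; have [D FD] := polyfun_density_gauss pF.
apply: (@integrable_gauss_bound _ (c / 2) D) => //; first by rewrite divr_gt0.
exact: measurable_density.
Qed.

(** The integrand is the [k]-th partial derivative of [F * expR (- W)], which the
    quadratic growth of [W] makes Gaussian. *)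
Lemma integration_by_parts_polyfun k F F' W' :
  polyfun F -> polyfun F' -> polyfun W' -> pd k F F' -> pd k W W' ->
  \int[lebesgue_tuple m]_t ((F' t - F t * W' t) * expR (- W t)) = 0.
Proof.
move=> pF pF' pW' dF dW.
have pG : polyfun (fun t => F' t - F t * W' t) by apply: polyfunB => //; exact: polyfunM.
have [D1 h1] := polyfun_density_gauss pF.
have [D2 h2] := polyfun_density_gauss pG.
have hmax D t : D <= Num.max D1 D2 ->
    D * expR (- (c / 2) * sqnorm t) <= Num.max D1 D2 * expR (- (c / 2) * sqnorm t).
  by move=> h; rewrite ler_wpM2r// expR_ge0.
rewrite /Rintegral; set I := (X in fine X); suff -> : I = 0%E by [].
apply: (@integral_partial_derivative _ _ k (c / 2) (Num.max D1 D2)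
  (fun t => F t * expR (- W t))).
- by rewrite divr_gt0.
- exact: measurable_density.
- exact: measurable_density.
- move=> t s; apply: is_derive_eq.
    apply: is_deriveM => /=; last first.
      apply: is_derive1_comp.
      exact: (pdN dW t s).
    exact: dF.
  by rewrite /= -![_ *: _]/(_ * _); ring.
- move=> t s; apply: cvgM.
    exact: polyfun_line_continuous pG s.
  apply: (@continuous_comp _ _ _ (fun s => - W (upd t k s)) expR).
    exact: polyfun_line_continuous (polyfunN pW) s.
  exact: continuous_expR.
- by move=> t; rewrite (le_trans (h1 t))// hmax// le_max lexx.
- by move=> t; rewrite (le_trans (h2 t))// hmax// le_max lexx orbT.
Qed.

End Confining.
End PolyFun.

(** * Calculus of traces of powers of a Hermitian matrix *)

Section ComplexParts.
Context {R : rcfType}.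
Implicit Types x y : R[i].

Lemma cReD x y : complex.Re (x + y) = complex.Re x + complex.Re y.
Proof. by case: x; case: y. Qed.
Lemma cImD x y : complex.Im (x + y) = complex.Im x + complex.Im y.
Proof. by case: x; case: y. Qed.
Lemma cReN x : complex.Re (- x) = - complex.Re x.
Proof. by case: x. Qed.
Lemma cImN x : complex.Im (- x) = - complex.Im x.
Proof. by case: x. Qed.
Lemma cReM x y : complex.Re (x * y) =
  complex.Re x * complex.Re y - complex.Im x * complex.Im y.
Proof. by case: x; case: y. Qed.
Lemma cImM x y : complex.Im (x * y) =
  complex.Re x * complex.Im y + complex.Im x * complex.Re y.
Proof. by case: x => a b; case: y => c d. Qed.
Lemma cRe_sum (I : Type) (r : seq I) (P : pred I) (F : I -> R[i]) :
  complex.Re (\sum_(i <- r | P i) F i) = \sum_(i <- r | P i) complex.Re (F i).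
Proof. by apply: (big_morph _ cReD). Qed.
Lemma cIm_sum (I : Type) (r : seq I) (P : pred I) (F : I -> R[i]) :
  complex.Im (\sum_(i <- r | P i) F i) = \sum_(i <- r | P i) complex.Im (F i).
Proof. by apply: (big_morph _ cImD). Qed.

Lemma complexP x y : complex.Re x = complex.Re y -> complex.Im x = complex.Im y -> x = y.
Proof. by case: x; case: y => ? ? ? ? /= -> ->. Qed.

End ComplexParts.

Section ComplexPolyFun.
Context {R : realType}.
Local Notation RM := (measurableTypeR R).
Context {m : nat}.
Implicit Types (F G : m.-tuple RM -> R[i]) (k : 'I_m).

Definition cpolyfun F :=
  polyfun (fun t => complex.Re (F t)) /\ polyfun (fun t => complex.Im (F t)).

Definition cpd k F G :=
  pd k (fun t => complex.Re (F t)) (fun t => complex.Re (G t)) /\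
  pd k (fun t => complex.Im (F t)) (fun t => complex.Im (G t)).

Lemma cpolyfun_cst a : cpolyfun (fun=> a).
Proof. by split; exact: polyfun_cst. Qed.

Lemma cpolyfunM F G : cpolyfun F -> cpolyfun G -> cpolyfun (fun t => F t * G t).
Proof.
move=> [F1 F2] [G1 G2]; split.
  by under eq_fun do rewrite cReM; apply: polyfunB; exact: polyfunM.
by under eq_fun do rewrite cImM; apply: polyfunD; exact: polyfunM.
Qed.

Lemma cpolyfun_sum (I : Type) (r : seq I) (F : I -> m.-tuple RM -> R[i]) :
  (forall i, cpolyfun (F i)) -> cpolyfun (fun t => \sum_(i <- r) F i t).
Proof.
move=> pF; split.
  by under eq_fun do rewrite cRe_sum; apply: polyfun_sum => i _; have [] := pF i.
by under eq_fun do rewrite cIm_sum; apply: polyfun_sum => i _; have [] := pF i.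
Qed.

Lemma cpd_cst k a : cpd k (fun=> a) (fun=> 0).
Proof. by split; exact: pd_cst. Qed.

Lemma cpd_eq k F G G' : cpd k F G -> (forall t, G t = G' t) -> cpd k F G'.
Proof. by move=> dF /funext <-. Qed.

Lemma pd_ext k (F F' G G' : m.-tuple RM -> R) : pd k F G -> F =1 F' -> G =1 G' -> pd k F' G'.
Proof. by move=> dF /funext <- /funext <-. Qed.

Lemma cpdM k F G F' G' : cpd k F F' -> cpd k G G' ->
  cpd k (fun t => F t * G t) (fun t => F' t * G t + F t * G' t).
Proof.
move=> [F1 F2] [G1 G2]; split.
  by apply: (pd_ext (pdB (pdM F1 G1) (pdM F2 G2))) => t; rewrite ?cReD !cReM; ring.
by apply: (pd_ext (pdD (pdM F1 G2) (pdM F2 G1))) => t; rewrite ?cImD !cImM; ring.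
Qed.

Lemma cpd_sum k (I : Type) (r : seq I) (F F' : I -> m.-tuple RM -> R[i]) :
  (forall i, cpd k (F i) (F' i)) ->
  cpd k (fun t => \sum_(i <- r) F i t) (fun t => \sum_(i <- r) F' i t).
Proof.
move=> dF; split.
  by apply: (pd_ext (pd_sum r (fun i => (dF i).1))) => t; rewrite cRe_sum.
by apply: (pd_ext (pd_sum r (fun i => (dF i).2))) => t; rewrite cIm_sum.
Qed.

Section Matrices.
Context {n : nat}.
Local Notation N := n.+1.
Implicit Types A B : m.-tuple RM -> 'M[R[i]]_N.

Definition mpolyfun A := forall i j, cpolyfun (fun t => A t i j).
Definition mpd k A B := forall i j, cpd k (fun t => A t i j) (fun t => B t i j).

Lemma mpolyfunX A j : mpolyfun A -> mpolyfun (fun t => A t ^+ j).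
Proof.
move=> pA; elim: j => [|j IH] a b.
  under [X in cpolyfun X]eq_fun do rewrite expr0 mxE; exact: cpolyfun_cst.
under [X in cpolyfun X]eq_fun do rewrite exprSr mxE.
by apply: cpolyfun_sum => i; exact: cpolyfunM.
Qed.

Lemma mpdM k A B A' B' : mpd k A A' -> mpd k B B' ->
  mpd k (fun t => A t * B t) (fun t => A' t * B t + A t * B' t).
Proof.
move=> dA dB a b; under eq_fun do rewrite mxE.
apply: cpd_eq; first by apply: cpd_sum => i; exact: cpdM.
by move=> t; rewrite !mxE big_split.
Qed.

(** Leibniz rule for a power of a noncommuting variable. *)
Lemma mpdX k A A' j : mpd k A A' ->
  mpd k (fun t => A t ^+ j) (fun t => \sum_(l < j) A t ^+ l * A' t * A t ^+ (j.-1 - l)).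
Proof.
move=> dA; elim: j => [|j IH] a b.
  apply: cpd_eq; first by under eq_fun do rewrite expr0; exact: cpd_cst.
  by move=> t; rewrite big_ord0 mxE.
apply: cpd_eq; first by under eq_fun do rewrite exprSr; exact: (mpdM IH dA a b).
move=> t /=; rewrite big_ord_recr/= subnn expr0 mulr1.
have -> // : (\sum_(l < j) A t ^+ l * A' t * A t ^+ (j.-1 - l)) * A t =
  \sum_(l < j) A t ^+ l * A' t * A t ^+ (j - l).
rewrite mulr_suml; apply: eq_bigr => l _; rewrite -mulrA -exprSr; congr (_ * _ ^+ _).
by have := ltn_ord l; lia.
Qed.

End Matrices.
End ComplexPolyFun.

Section HermitianBasis.
Context {R : realType} {n : nat}.
Local Notation RM := (measurableTypeR R).
Local Notation N := n.+1.
Local Notation H := (@hermitian_of_coords R N).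
Implicit Types (x : (N * N).-tuple RM) (k : 'I_(N * N)) (A B : 'M[R[i]]_N).

(** The basis dual to the coordinate forms [hcoord]; off the diagonal its vectors
    are [e_ij + e_ji] and [i (e_ij - e_ji)]. *)
Definition hermitian_basis k : 'M[R[i]]_N := H [tuple (i == k)%:R | i < N * N].
Local Notation E := hermitian_basis.

Lemma mxvec_index_eq (i j a b : 'I_N) :
  (mxvec_index i j == mxvec_index a b) = (i == a) && (j == b).
Proof.
by rewrite (inj_eq (@cast_ord_inj _ _ _)) (inj_eq enum_rank_inj).
Qed.

Lemma mpolyfun_hermitian : mpolyfun H.
Proof.
move=> i j; split; under eq_fun do rewrite mxE.
  case: eqP => _ /=; first exact: polyfun_coord.
  by case: (i < j)%N => /=; exact: polyfun_coord.
case: eqP => _ /=; first exact: polyfun_cst.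
by case: (i < j)%N => /=; [|apply: polyfunN]; exact: polyfun_coord.
Qed.

Lemma mpd_hermitian k : mpd k H (fun=> E k).
Proof.
move=> i j; split; under eq_fun do rewrite mxE; rewrite !mxE.
  case: eqP => _ /=; first by rewrite tnth_mktuple; exact: pd_coord.
  by case: ifP => _ /=; rewrite tnth_mktuple; exact: pd_coord.
case: eqP => _ /=; first exact: pd_cst.
case: ifP => _ /=; rewrite tnth_mktuple; first exact: pd_coord.
exact: (pdN (pd_coord _ _)).
Qed.

Lemma hermitian_of_coords_sum x : H x = \sum_k (tnth x k)%:C%C *: E k.
Proof.
have S (i : 'I_(N * N)) : \sum_k tnth x k * (i == k)%:R = tnth x i.
  rewrite (bigD1 i)//= eqxx mulr1 big1 ?addr0// => k; rewrite eq_sym => /negPf ->.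
  by rewrite mulr0.
apply/matrixP => i j; rewrite summxE.
under eq_bigr do rewrite !mxE !tnth_mktuple.
apply: complexP; rewrite ?cRe_sum ?cIm_sum mxE.
  under eq_bigr do rewrite cReM /= mul0r subr0.
  case: eqP => _ /=; first by rewrite S.
  by case: ifP => _ /=; rewrite S.
under eq_bigr do rewrite cImM /= mul0r addr0.
case: eqP => _ /=; first by rewrite big1// => k _; rewrite mulr0.
case: ifP => _ /=; first by rewrite S.
by under eq_bigr do rewrite mulrN; rewrite sumrN S.
Qed.

Lemma hermitian_basisE (i j : 'I_N) : E (mxvec_index i j) =
  if i == j then delta_mx i i else if (i < j)%N then delta_mx i j + delta_mx j i
  else 'i%C *: delta_mx j i - 'i%C *: delta_mx i j.
Proof.
apply/matrixP => a b; rewrite mxE !tnth_mktuple !mxvec_index_eq.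
have [<-{j}|ij] := eqVneq i j.
  rewrite mxE; have [<-{b}|ab] := eqVneq a b.
    by rewrite andbb; case: (a == i).
  rewrite (_ : (a == i) && (b == i) = false); last first.
    by apply/negP => /andP[/eqP e1 /eqP e2]; move: ab; rewrite e1 e2 eqxx.
  rewrite (_ : (b == i) && (a == i) = false); last first.
    by apply/negP => /andP[/eqP e1 /eqP e2]; move: ab; rewrite e1 e2 eqxx.
  by case: ifP => _; apply: complexP => /=; rewrite ?oppr0.
have [ltij|leji] := ltnP i j; rewrite !mxE.
  have [<-{b}|ab] := eqVneq a b.
    rewrite (_ : (a == i) && (a == j) = false); last first.
      by apply/negP => /andP[/eqP e1 /eqP e2]; move: ij; rewrite -e1 -e2 eqxx.
    rewrite (_ : (a == j) && (a == i) = false); last first.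
      by apply/negP => /andP[/eqP e1 /eqP e2]; move: ij; rewrite -e1 -e2 eqxx.
    by apply: complexP => /=; rewrite ?addr0.
  have [ltab|leba] := ltnP a b.
    rewrite (_ : (b == i) && (a == j) = false); last first.
      by apply/negP => /andP[/eqP e1 /eqP e2]; move: ltab; rewrite e1 e2 ltnNge ltnW.
    rewrite (_ : (a == j) && (b == i) = false); last first.
      by apply/negP => /andP[/eqP e1 /eqP e2]; move: ltab; rewrite e1 e2 ltnNge ltnW.
    by rewrite addr0; case: ((a == i) && _).
  rewrite (_ : (a == i) && (b == j) = false); last first.
    by apply/negP => /andP[/eqP e1 /eqP e2]; move: leba; rewrite e1 e2 leqNgt ltij.
  rewrite add0r andbC oppr0; by case: ((a == j) && _).
have ltji : (j < i)%N by rewrite ltn_neqAle leji andbT eq_sym; exact: ij.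
have [<-{b}|ab] := eqVneq a b.
  rewrite (_ : (a == i) && (a == j) = false); last first.
    by apply/negP => /andP[/eqP e1 /eqP e2]; move: ij; rewrite -e1 -e2 eqxx.
  rewrite (_ : (a == j) && (a == i) = false); last first.
    by apply/negP => /andP[/eqP e1 /eqP e2]; move: ij; rewrite -e1 -e2 eqxx.
  by apply: complexP => /=; ring.
have [ltab|leba] := ltnP a b.
  rewrite (_ : (a == i) && (b == j) = false); last first.
    by apply/negP => /andP[/eqP e1 /eqP e2]; move: ltab; rewrite e1 e2 ltnNge leji.
  rewrite andbC; case: ((a == j) && _); apply: complexP => /=; ring.
rewrite (_ : (b == i) && (a == j) = false); last first.
  apply/negP => /andP[/eqP e1 /eqP e2]; move: leba; rewrite e1 e2 leqNgt.
  by rewrite ltji.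
rewrite (_ : (a == j) && (b == i) = false); last first.
  apply/negP => /andP[/eqP e1 /eqP e2]; move: leba; rewrite e1 e2 leqNgt.
  by rewrite ltji.
case: ((a == i) && _); apply: complexP => /=; ring.
Qed.

Definition hcoord A k : R := tnth (hermitian_coords A) k.

Lemma hcoordE A (i j : 'I_N) : hcoord A (mxvec_index i j) =
  if (i <= j)%N then complex.Re (A i j) else complex.Im (A j i).
Proof. by rewrite /hcoord tnth_mktuple mxvecE mxE. Qed.

Lemma mul_delta_mxE A B (i j a b : 'I_N) : (A * delta_mx i j * B) a b = A a i * B j b.
Proof.
rewrite mxE (bigD1 j)//= big1 ?addr0; last first.
  move=> l lj; rewrite mxE big1 ?mul0r// => c _; rewrite mxE (negPf lj) andbF.
  by rewrite mulr0.
rewrite mxE (bigD1 i)//= big1 ?addr0; last first.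
  by move=> c ci; rewrite mxE (negPf ci) mulr0.
by rewrite mxE !eqxx mulr1.
Qed.

(** The two basis vectors attached to a pair of positions contribute together: the
    mixed entries of [A] and [B] cancel between the real and the imaginary one. *)
Lemma coords_sandwich A B (i j : 'I_N) k l :
  k = mxvec_index i j -> l = mxvec_index j i ->
  hcoord (A * E k * B) k + hcoord (A * E l * B) l =
  if (i <= j)%N then 2 * complex.Re (A i i * B j j) else 2 * complex.Re (A j j * B i i).
Proof.
move=> hk hl.
have e1 := hcoordE (A * E k * B) i j.
have e2 := hcoordE (A * E l * B) j i.
have h1 := hermitian_basisE i j; have h2 := hermitian_basisE j i.
rewrite -hk in e1 h1; rewrite -hl in e2 h2.
rewrite e1 e2 h1 h2 {k l hk hl e1 e2 h1 h2}.
rewrite [j == i]eq_sym; have [<-|ij] := eqVneq i j.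
  by rewrite leqnn mul_delta_mxE mulr2n mulrDl mul1r.
have X1 (c d : 'I_N) : (A * (delta_mx i j + delta_mx j i) * B) c d
    = A c i * B j d + A c j * B i d.
  by rewrite mulrDr mulrDl mxE !mul_delta_mxE.
have X2 (e f c d : 'I_N) : (A * ('i%C *: delta_mx e f - 'i%C *: delta_mx f e) * B) c d
    = 'i%C * (A c e * B f d) - 'i%C * (A c f * B e d).
  rewrite mulrBr mulrBl -!scalerAr -!scalerAl mxE [X in X + _]mxE.
  by rewrite mul_delta_mxE [X in _ + X]mxE [X in _ - X]mxE mul_delta_mxE.
case: (ltngtP i j) => [lt|gt|/ord_inj/eqP]; last by rewrite (negPf ij).
  rewrite X1 X2.
  move: (A i i) (A i j) (A j i) (A j j) (B i i) (B i j) (B j i) (B j j).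
  by move=> [? ?] [? ?] [? ?] [? ?] [? ?] [? ?] [? ?] [? ?] /=; ring.
rewrite [delta_mx j i + _]addrC X1 X2.
move: (A i i) (A i j) (A j i) (A j j) (B i i) (B i j) (B j i) (B j j).
by move=> [? ?] [? ?] [? ?] [? ?] [? ?] [? ?] [? ?] [? ?] /=; ring.
Qed.

(** Completeness of the basis: the sum over [k] of [E_k] tensored with its dual is
    the flip, which turns the divergence of [H ^+ m] into products of traces. *)
Lemma coords_sandwich_sum A B :
  \sum_k (hcoord (A * E k * B) k
        + hcoord (B * E k * A) k) = 2 * complex.Re (\tr A * \tr B).
Proof.
pose f (p : 'I_N * 'I_N) := let k := mxvec_index p.1 p.2 in
  hcoord (A * E k * B) k + hcoord (B * E k * A) k.
have -> : \sum_k (hcoord (A * E k * B) k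
        + hcoord (B * E k * A) k) = \sum_i \sum_j f (i, j).
  rewrite pair_bigA /= (reindex (fun p : 'I_N * 'I_N => mxvec_index p.1 p.2)) /=.
    by apply: eq_bigr => -[].
  case: (curry_mxvec_bij N N) => g gK Kg; exists g => [[i j] h|k h].
    exact: (gK (i, j) h).
  by have := Kg k h; case: (g k).
(* each pair of positions is met twice, so twice the sum is what
   [coords_sandwich] computes *)
apply: (mulfI (_ : 2 != 0 :> R)); first by rewrite pnatr_eq0.
rewrite mulr2n mulrDl mul1r {2}exchange_big /= -big_split /=.
under eq_bigr do rewrite -big_split /=.
transitivity (\sum_i \sum_j 2 * complex.Re (A i i * B j j + A j j * B i i)).
  apply: eq_bigr => i _; apply: eq_bigr => j _; rewrite /f /= addrACA.
  rewrite !(@coords_sandwich _ _ i j)//.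
  by rewrite cReD (mulrC (B i i)) (mulrC (B j j)); case: ifP => _; ring.
under eq_bigr do (under eq_bigr do rewrite cReD mulrDr; rewrite big_split /=).
rewrite big_split /=.
rewrite [X in _ + X]exchange_big /= mulr2n mulrDl mul1r.
have -> : \sum_i \sum_j 2 * complex.Re (A i i * B j j) = 2 * complex.Re (\tr A * \tr B).
  rewrite /mxtrace mulr_suml cRe_sum mulr_sumr; apply: eq_bigr => i _.
  by rewrite mulr_sumr cRe_sum mulr_sumr.
by [].
Qed.

End HermitianBasis.

(** * Spectral means *)

Section Mean.
Context {R : realType}.
Implicit Types (s : seq R) (f g : R -> R).

Definition mean s f : R := (\sum_(x <- s) f x) / (size s)%:R.

Lemma meanD s f g : mean s (fun x => f x + g x) = mean s f + mean s g.
Proof. by rewrite /mean big_split mulrDl. Qed.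

Lemma meanZ s a f : mean s (fun x => a * f x) = a * mean s f.
Proof. by rewrite /mean -mulr_sumr mulrA. Qed.

Lemma meanB s f g : mean s (fun x => f x - g x) = mean s f - mean s g.
Proof. by rewrite /mean big_split sumrN mulrBl. Qed.

Lemma mean_cst s a : (0 < size s)%N -> mean s (fun=> a) = a.
Proof.
move=> s0; rewrite /mean big_const_seq count_predT iter_addr_0 -[a *+ _]mulr_natr mulfK//.
by rewrite pnatr_eq0 -lt0n.
Qed.

Lemma ge0_mean s f : (forall x, 0 <= f x) -> 0 <= mean s f.
Proof. by move=> f0; rewrite /mean divr_ge0// sumr_ge0. Qed.

Lemma le_mean s f g : (forall x, f x <= g x) -> mean s f <= mean s g.
Proof. by move=> fg; rewrite /mean ler_wpM2r ?invr_ge0// ler_sum. Qed.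

Lemma eq_mean s f g : f =1 g -> mean s f = mean s g.
Proof. by move=> /funext ->. Qed.

Lemma mean_sum s (I : Type) (r : seq I) (F : I -> R -> R) :
  mean s (fun x => \sum_(i <- r) F i x) = \sum_(i <- r) mean s (F i).
Proof. by rewrite /mean exchange_big /= mulr_suml. Qed.

Lemma norm_mean_le s f g : (forall x, `|f x| <= g x) -> `|mean s f| <= mean s g.
Proof.
move=> fg; rewrite ler_norml; apply/andP; split.
  rewrite -[leLHS]mulN1r -meanZ; apply: le_mean => x; rewrite mulN1r.
  by have := fg x; rewrite ler_norml => /andP[].
by apply: le_mean => x; apply: le_trans (ler_norm _) (fg x).
Qed.

End Mean.

Section Spectrum.
Context {R : realType} {n : nat}.
Local Notation N := n.+1.
Implicit Types (A : 'M[R[i]]_N).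

Lemma hermsymmxE A : (A \is hermsymmx) = (A == (map_mx Num.conj A)^T).
Proof. by rewrite is_hermitianmxE expr0 scale1r map_trmx. Qed.

Lemma hermsymmxX A j : A \is hermsymmx -> A ^+ j \is hermsymmx.
Proof.
rewrite !hermsymmxE => /eqP hA; apply/eqP; elim: j => [|j IH].
  by rewrite !expr0 map_mx1 trmx1.
by rewrite [in RHS]exprSr -[A ^+ j * A]/(_ *m _) map_mxM trmx_mul -hA -IH
  -[RHS]/(_ * _) -exprS.
Qed.

Lemma char_poly_similar (P D : 'M[R[i]]_N) : P \in unitmx ->
  char_poly (invmx P *m D *m P) = char_poly D.
Proof.
move=> uP; rewrite /char_poly /char_poly_mx.
have E : 'X%:M - map_mx polyC (invmx P *m D *m P) =
    map_mx polyC (invmx P) *m ('X%:M - map_mx polyC D) *m map_mx polyC P.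
  rewrite mulmxBr mulmxBl !map_mxM; congr (_ - _).
  by rewrite mul_mx_scalar -scalemxAl -map_mxM mulVmx// map_mx1 scalemx1.
rewrite E !det_mulmx mulrAC -det_mulmx -map_mxM mulVmx// map_mx1 det1 mul1r//.
Qed.

(** The spectral theorem, in the form of power sums: the roots of the characteristic
    polynomial are the diagonal of a unitary diagonalization. *)
Lemma eigenvalues_spectral A : A \is hermsymmx ->
  exists D : 'rV[R]_N,
  (forall j, \tr (A ^+ j) = (\sum_i D 0 i ^+ j)%:C%C) /\
  perm_eq (eigenvalues A) [seq D 0 i | i <- index_enum 'I_N].
Proof.
move=> hA; have /orthomx_spectralP AE := hermitian_normalmx hA.
have dR := hermitian_spectral_diag_real hA.
set P := spectralmx A in AE; set d := spectral_diag A in AE dR.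
have uP : P \in unitmx := spectral_unit A.
pose D : 'rV[R]_N := map_mx (@complex.Re R) d.
have dE i : d 0 i = (D 0 i)%:C%C by rewrite mxE RRe_real//; move/mxOverP: dR; exact.
exists D; split => [j|].
  have -> : A ^+ j = invmx P *m (diag_mx d) ^+ j *m P.
    elim: j => [|j IH]; first by rewrite !expr0 mulmx1 mulVmx.
    rewrite exprSr IH {1}AE -[LHS]/(_ *m _) !mulmxA -(mulmxA _ P) mulmxV// mulmx1.
    by rewrite exprSr -[_ * _]/(_ *m _) !mulmxA.
  rewrite mxtrace_mulC mulmxA mulmxV// mul1mx.
  have -> : diag_mx d ^+ j = diag_mx (map_mx (fun z => z ^+ j) d).
    elim: j => [|j IH].
      by rewrite expr0; apply/matrixP => a b; rewrite !mxE expr0.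
    rewrite exprSr IH -[LHS]/(_ *m _) mulmx_diag; congr diag_mx.
    by apply/rowP => i; rewrite !mxE exprSr.
  rewrite mxtrace_diag rmorph_sum; apply: eq_bigr => i _.
  by rewrite mxE dE rmorphXn.
rewrite /eigenvalues; case: closed_field_poly_normal => r /= rE.
have : perm_eq r [seq d 0 i | i <- index_enum 'I_N].
  apply: prod_XsubC_eq; rewrite big_map.
  have := rE; rewrite (eqP (char_poly_monic A)) scale1r => <-.
  rewrite {1}AE char_poly_similar// char_poly_trig; last first.
    by apply/is_trig_mxP => i j ij; rewrite mxE; case: eqP ij => // ->; rewrite ltnn.
  by apply: eq_bigr => i _; rewrite mxE eqxx mulr1n.
move=> /(perm_map (@complex.Re R)) /perm_trans; apply.
by rewrite -map_comp (eq_map (_ : _ =1 (fun i => D 0 i)))// => i /=; rewrite dE.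
Qed.

Lemma size_eigenvalues A : A \is hermsymmx -> size (eigenvalues A) = N.
Proof.
move=> /eigenvalues_spectral[D [_ /perm_size ->]].
by rewrite size_map -[index_enum _]/(Finite.enum _) -enumT size_enum_ord.
Qed.

Lemma trace_power_eigenvalues A j : A \is hermsymmx ->
  \tr (A ^+ j) = (\sum_(x <- eigenvalues A) x ^+ j)%:C%C.
Proof.
move=> /eigenvalues_spectral[D [-> /(perm_big _) ->]].
by rewrite big_map.
Qed.

Lemma trace_sum (I : Type) (r : seq I) (F : I -> 'M[R[i]]_N) :
  \tr (\sum_(i <- r) F i) = \sum_(i <- r) \tr (F i).
Proof. exact: raddf_sum. Qed.

Lemma Re_trace A : complex.Re (\tr A) = \sum_i complex.Re (A i i).
Proof. exact: cRe_sum. Qed.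

Lemma trace_polyE (V : {poly R}) A :
  trace_poly V A = \sum_(i < size V) V`_i * complex.Re (\tr (A ^+ i)).
Proof.
have -> : trace_poly V A = complex.Re (\tr (\sum_(i < size V) (V`_i)%:C%C *: A ^+ i)).
  rewrite /trace_poly -{1}[V]coefK poly_def rmorph_sum /= rmorph_sum.
  congr (complex.Re (\tr _)); apply: eq_bigr => i _.
  rewrite map_polyZ map_polyXn -mul_polyC rmorphM rmorphXn /= horner_mx_C horner_mx_X.
  exact: mul_scalar_mx.
rewrite trace_sum cRe_sum; apply: eq_bigr => i _.
by rewrite mxtraceZ cReM /= mul0r subr0.
Qed.

Lemma trace_poly_eigenvalues (V : {poly R}) A : A \is hermsymmx ->
  trace_poly V A = N%:R * mean (eigenvalues A) (fun x => V.[x]).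
Proof.
move=> hA; rewrite trace_polyE /mean size_eigenvalues// mulrC divfK ?pnatr_eq0//.
under eq_bigr => i _ do rewrite trace_power_eigenvalues// mulr_sumr.
by rewrite exchange_big; apply: eq_bigr => x _; rewrite horner_coef.
Qed.

End Spectrum.

Section TraceMoments.
Context {R : realType} {n : nat}.
Local Notation RM := (measurableTypeR R).
Local Notation N := n.+1.
Local Notation H := (@hermitian_of_coords R N).
Local Notation E := (@hermitian_basis R n).
Implicit Types (x : (N * N).-tuple RM) (k : 'I_(N * N)).

Lemma hermitian_of_coords_herm x : H x \is hermsymmx.
Proof.
rewrite hermsymmxE; apply/eqP/matrixP => i j; rewrite !mxE.
have [<-|ij] := eqVneq i j; first by apply: complexP; rewrite //= oppr0.
case: (ltngtP i j) => [lt|gt|/ord_inj/eqP]; last by rewrite (negPf ij).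
  by apply: complexP; rewrite //= opprK.
by apply: complexP.
Qed.

Definition spectrum x := eigenvalues (H x).
Definition moment (j : nat) x : R := N%:R^-1 * complex.Re (\tr (H x ^+ j)).

Lemma moment_mean j x : moment j x = mean (spectrum x) (fun y => y ^+ j).
Proof.
have hx := hermitian_of_coords_herm x.
by rewrite /moment trace_power_eigenvalues//= /mean size_eigenvalues// mulrC.
Qed.

Lemma trace_moment j x : \tr (H x ^+ j) = (N%:R * moment j x)%:C%C.
Proof.
rewrite /moment mulrA mulfV ?mul1r ?pnatr_eq0//.
by rewrite trace_power_eigenvalues// hermitian_of_coords_herm.
Qed.

Lemma polyfun_moment j : polyfun (moment j).
Proof.
apply: polyfunZ; under eq_fun do rewrite cRe_sum.
by apply: polyfun_sum => i _; exact: (mpolyfunX j mpolyfun_hermitian i i).1.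
Qed.

Lemma pd_moment k j : pd k (moment j)
  (fun x => j%:R / N%:R * complex.Re (\tr (H x ^+ j.-1 * E k))).
Proof.
have h := pdZ N%:R^-1 (pd_sum (index_enum 'I_N) (fun i => (mpdX j (@mpd_hermitian R n k) i i).1)).
apply: (pd_ext h) => x; first by rewrite /moment Re_trace.
rewrite -Re_trace trace_sum (mulrC j%:R) -mulrA; congr (_ * _).
rewrite cRe_sum (eq_bigr (fun=> complex.Re (\tr (H x ^+ j.-1 * E k)))); last first.
  move=> l _; rewrite -[in LHS]mulrA -[_ * (_ * _)]/(_ *m _) mxtrace_mulC.
  rewrite -[_ *m _]/(_ * _) -mulrA -[_ * (_ * _)]/(_ *m _) mxtrace_mulC.
  rewrite -[_ *m _]/(_ * _) -exprD; congr (complex.Re (\tr (_ ^+ _ * _))).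
  by have := ltn_ord l; lia.
by rewrite sumr_const card_ord mulr_natl.
Qed.

Lemma sum_hcoord (B : 'M[R[i]]_N) j x :
  \sum_k hcoord (H x ^+ j) k * complex.Re (\tr (B * E k)) =
  complex.Re (\tr (B * H x ^+ j)).
Proof.
have hX := hermsymmxX j (hermitian_of_coords_herm x).
rewrite -{2}(hermitian_coordsK hX) (hermitian_of_coords_sum (hermitian_coords _)).
rewrite mulr_sumr trace_sum cRe_sum.
by apply: eq_bigr => k _; rewrite -scalerAr mxtraceZ cReM /= mul0r subr0.
Qed.

(** Euler field computation: the derivative of the [j]-th moment along [H ^+ m] is
    [j] times the [j + m - 1]-st moment. *)
Lemma sum_hcoord_moment m j x :
  \sum_k hcoord (H x ^+ m) k * (j%:R / N%:R * complex.Re (\tr (H x ^+ j.-1 * E k))) =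
  j%:R * moment (j.-1 + m) x.
Proof.
under eq_bigr do rewrite mulrCA.
by rewrite -mulr_sumr sum_hcoord -exprD /moment mulrA.
Qed.

(** The [k]-th diagonal term of the divergence of the vector field [H ^+ m]. *)
Definition field_div m x k : R :=
  hcoord (\sum_(l < m) H x ^+ l * E k * H x ^+ (m.-1 - l)) k.

Lemma hcoord_lin (I : finType) (F : I -> 'M[R[i]]_N) k :
  hcoord (\sum_i F i) k = \sum_i hcoord (F i) k.
Proof.
case/mxvec_indexP: k => i j.
have hE (A : 'M[R[i]]_N) := hcoordE A i j.
rewrite hE (eq_bigr _ (fun l _ => hE (F l))) !summxE cRe_sum cIm_sum.
by case: (i <= j)%N.
Qed.

Lemma pd_field m k : pd k (fun x => hcoord (H x ^+ m) k) (fun x => field_div m x k).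
Proof.
rewrite /field_div; case/mxvec_indexP: k => i j.
set k := mxvec_index i j.
have h := mpdX m (@mpd_hermitian R n k).
have hE (A : 'M[R[i]]_N) : hcoord A k = if (i <= j)%N then complex.Re (A i j) else complex.Im (A j i).
  exact: hcoordE.
case: (leqP i j) hE => ij hE.
  by apply: (pd_ext (h i j).1) => x; rewrite hE.
by apply: (pd_ext (h j i).2) => x; rewrite hE.
Qed.

Lemma polyfun_field m k : polyfun (fun x => hcoord (H x ^+ m) k).
Proof.
case/mxvec_indexP: k => i j; under eq_fun do rewrite hcoordE.
case: (i <= j)%N.
  exact: (mpolyfunX m mpolyfun_hermitian i j).1.
exact: (mpolyfunX m mpolyfun_hermitian j i).2.
Qed.

(** [coords_sandwich_sum], after pairing [l] with [m - 1 - l]. *)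
Lemma sum_field_div m x :
  \sum_k field_div m x k = N%:R ^+ 2 * \sum_(l < m) moment l x * moment (m.-1 - l) x.
Proof.
rewrite /field_div; under eq_bigr do rewrite hcoord_lin.
apply: (mulfI (_ : 2 != 0 :> R)); first by rewrite pnatr_eq0.
rewrite [in LHS]mulr2n mulrDl mul1r {2}(eq_bigr (fun k =>
   \sum_(l < m) hcoord (H x ^+ (m.-1 - l) * E k * H x ^+ l) k)); last first.
  move=> k _; rewrite (reindex_inj rev_ord_inj) /=; apply: eq_bigr => l _.
  have -> : (m - l.+1 = m.-1 - l)%N by lia.
  by have -> : (m.-1 - (m.-1 - l) = l)%N by have := ltn_ord l; lia.
rewrite -big_split /=; under eq_bigr do rewrite -big_split /=.
rewrite exchange_big /= mulr_sumr mulr_sumr; apply: eq_bigr => l _.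
rewrite coords_sandwich_sum !trace_moment -rmorphM /=; ring.
Qed.

End TraceMoments.

(** * Loop equations *)

Section Residual.
Context {R : realType}.
Implicit Types (s : seq R) (V q : {poly R}).

Definition mom s j : R := mean s (fun y => y ^+ j).

(** The defect of [s] in the [m]-th loop equation. *)
Definition resid V m s : R :=
  mean s (fun y => (V^`() * 'X^m).[y]) - \sum_(l < m) mom s l * mom s (m.-1 - l).

(** The derivative of [resid V m] along the flow that moves each [y] in [s] at
    speed [y ^+ m]. *)
Definition flow_deriv_resid V m s : R :=
  \sum_(i < size (V^`() * 'X^m)) (V^`() * 'X^m)`_i * (i%:R * mom s (i.-1 + m))
  - \sum_(l < m) (l%:R * mom s (l.-1 + m) * mom s (m.-1 - l)
                + mom s l * ((m.-1 - l)%:R * mom s ((m.-1 - l).-1 + m))).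

Lemma mean_poly q s : mean s (fun y => q.[y]) = \sum_(i < size q) q`_i * mom s i.
Proof.
rewrite (eq_mean _ (horner_coef q)) mean_sum; apply: eq_bigr => i _.
by rewrite meanZ.
Qed.

Lemma mean_deriv_poly q m s :
  mean s (fun y => (q^`() * 'X^m).[y]) = \sum_(i < size q) q`_i * (i%:R * mom s (i.-1 + m)).
Proof.
under eq_mean => y.
  rewrite hornerM hornerXn -{1}[q]coefK poly_def raddf_sum /= horner_sum mulr_suml.
  under eq_bigr do rewrite derivZ derivXn hornerZ hornerMn hornerXn -mulrA -mulr_natl
     -mulrA -exprD.
  over.
by rewrite mean_sum; apply: eq_bigr => i _; rewrite !meanZ.
Qed.

Lemma mom_even_ge0 s j : 0 <= mom s (2 * j).
Proof. by apply: ge0_mean => y; rewrite mulnC exprM sqr_ge0. Qed.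

Lemma norm_powers_le (u v : R) i j L : (i + j = 2 * L)%N ->
  `|u ^+ i * v ^+ j| <= u ^+ (2 * L) + v ^+ (2 * L).
Proof.
move=> ij; rewrite normrM !normrX.
have e (w : R) : w ^+ (2 * L) = `|w| ^+ (2 * L).
  by rewrite !exprM real_normK ?num_real.
rewrite (e u) (e v) -ij; have [uv|vu] := leP `|u| `|v|.
  rewrite (@le_trans _ _ (`|v| ^+ (i + j)))//; last by rewrite lerDr exprn_ge0.
  by rewrite exprD ler_wpM2r ?exprn_ge0// lerXn2r ?nnegrE.
rewrite (@le_trans _ _ (`|u| ^+ (i + j)))//; last by rewrite lerDl exprn_ge0.
by rewrite exprD ler_wpM2l ?exprn_ge0// lerXn2r ?nnegrE// ltW.
Qed.

(** The pointwise bound [norm_powers_le], averaged over two independent copies. *)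
Lemma mom_mul_le s i j L : (0 < size s)%N -> (i + j = 2 * L)%N ->
  `|mom s i * mom s j| <= 2 * mom s (2 * L).
Proof.
move=> s0 ij; have -> : mom s i * mom s j =
    mean s (fun u => mean s (fun v => u ^+ i * v ^+ j)).
  by rewrite mulrC -meanZ; apply: eq_mean => u; rewrite meanZ mulrC.
have -> : 2 * mom s (2 * L) =
    mean s (fun u => mean s (fun v => u ^+ (2 * L) + v ^+ (2 * L))).
  under [in RHS]eq_mean do rewrite meanD mean_cst//.
  by rewrite meanD mean_cst// mulr2n mulrDl mul1r.
apply: norm_mean_le => u; apply: norm_mean_le => v; exact: norm_powers_le.
Qed.

Lemma norm_power_le1 (u : R) i L : (i <= 2 * L)%N -> `|u ^+ i| <= 1 + u ^+ (2 * L).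
Proof.
move=> iL; have := @norm_powers_le u 1 i (2 * L - i) L.
by rewrite !expr1n mulr1 [1 + _]addrC; apply; lia.
Qed.

Lemma norm_mom_le s i L : (0 < size s)%N -> (i <= 2 * L)%N ->
  `|mom s i| <= 1 + mom s (2 * L).
Proof.
move=> s0 iL; rewrite -(mean_cst 1 s0) -meanD.
by apply: norm_mean_le => u; exact: norm_power_le1.
Qed.

(** Domination by one even moment of arbitrary order: stable under sums and scaling,
    and controlled by the moment bounds. *)
Definition mom_dominated (F : seq R -> R) := exists C L, 0 <= C /\
  forall s, (0 < size s)%N -> `|F s| <= C * (1 + mom s (2 * L)).

Lemma mom_dominated_widen C L L' s : 0 <= C -> (0 < size s)%N -> (L <= L')%N ->
  C * (1 + mom s (2 * L)) <= 2 * C * (1 + mom s (2 * L')).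
Proof.
move=> C0 s0 LL'; rewrite -mulrA mulrCA ler_wpM2l//.
have := @norm_mom_le s (2 * L) L' s0; rewrite leq_mul2l LL' => /(_ isT).
have := mom_even_ge0 s L'; have := ler_norm (mom s (2 * L)); lra.
Qed.

Lemma mom_dominatedD F G : mom_dominated F -> mom_dominated G ->
  mom_dominated (fun s => F s + G s).
Proof.
move=> [C [L [C0 FC]]] [D [L' [D0 GD]]].
exists (2 * C + 2 * D), (maxn L L'); split; first by lra.
move=> s s0; rewrite (le_trans (ler_normD _ _))// mulrDl lerD//.
  by apply: le_trans (FC s s0) _; apply: mom_dominated_widen; rewrite ?leq_maxl.
by apply: le_trans (GD s s0) _; apply: mom_dominated_widen; rewrite ?leq_maxr.
Qed.

Lemma mom_dominatedZ a F : mom_dominated F -> mom_dominated (fun s => a * F s).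
Proof.
move=> [C [L [C0 FC]]]; exists (`|a| * C), L; split; first exact: mulr_ge0.
by move=> s s0; rewrite normrM -mulrA ler_wpM2l// FC.
Qed.

Lemma mom_dominatedN F : mom_dominated F -> mom_dominated (fun s => - F s).
Proof. by move=> [C [L [C0 FC]]]; exists C, L; split=> // s s0; rewrite normrN FC. Qed.

Lemma mom_dominated_sum (I : Type) (r : seq I) (F : I -> seq R -> R) :
  (forall i, mom_dominated (F i)) -> mom_dominated (fun s => \sum_(i <- r) F i s).
Proof.
move=> dF; elim: r => [|i r IH].
  exists 0, 0%N; split => // s _; rewrite big_nil normr0 mul0r//.
under eq_fun do rewrite big_cons; exact: mom_dominatedD.
Qed.

Lemma mom_dominated_mom i : mom_dominated (mom^~ i).
Proof.
exists 1, i; split => // s s0; rewrite mul1r; apply: norm_mom_le => //; lia.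
Qed.

Lemma mom_dominated_mul i j : mom_dominated (fun s => mom s i * mom s j).
Proof.
have sq k s : (0 < size s)%N -> mom s k ^+ 2 <= 2 * mom s (2 * k).
  move=> s0; apply: le_trans (@mom_mul_le s k k k s0 _); last by lia.
  by rewrite expr2; exact: ler_norm.
have h : mom_dominated (fun s => 2 * mom s (2 * i) + 2 * mom s (2 * j)).
  by apply: mom_dominatedD; apply: mom_dominatedZ; exact: mom_dominated_mom.
have [C [L [C0 hC]]] := h; exists C, L; split => // s s0.
apply: le_trans (hC s s0); apply: le_trans (ler_norm _).
have := sq i s s0; have := sq j s s0.
have := sqr_ge0 (`|mom s i| - `|mom s j|).
rewrite sqrrB !real_normK ?num_real// -normrM.
have := normr_ge0 (mom s i * mom s j); lra.
Qed.

Lemma mom_dominated_flow_deriv_resid V m : mom_dominated (flow_deriv_resid V m).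
Proof.
apply: mom_dominatedD.
  apply: mom_dominated_sum => i; do 2 apply: mom_dominatedZ; exact: mom_dominated_mom.
apply: mom_dominatedN; apply: mom_dominated_sum => l; apply: mom_dominatedD.
  by under eq_fun do rewrite -mulrA; apply: mom_dominatedZ; exact: mom_dominated_mul.
by under eq_fun do rewrite mulrCA; apply: mom_dominatedZ; exact: mom_dominated_mul.
Qed.

End Residual.

Section LoopEquation.
Context {R : realType} {n : nat}.
Local Notation RM := (measurableTypeR R).
Local Notation N := n.+1.
Local Notation H := (@hermitian_of_coords R N).
Local Notation E := (@hermitian_basis R n).
Variables (V : {poly R}) (c C : R).
Hypotheses (c0 : 0 < c)
  (VC : forall y, c * y ^+ 2 - C <= V.[y])
  (dVC : forall y, c * y ^+ 2 - C <= V^`().[y] * y).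
Implicit Types (x : (N * N).-tuple RM) (k : 'I_(N * N)) (F : (N * N).-tuple RM -> R).

Definition potential x : R := N%:R * trace_poly V (H x).

Lemma momentE j x : moment j x = mom (spectrum x) j.
Proof. exact: moment_mean. Qed.

Lemma size_spectrum x : size (spectrum x) = N.
Proof. by rewrite size_eigenvalues// hermitian_of_coords_herm. Qed.

Lemma potentialE x : potential x = N%:R ^+ 2 * \sum_(i < size V) V`_i * moment i x.
Proof.
rewrite /potential trace_poly_eigenvalues ?hermitian_of_coords_herm// mulrA -expr2.
rewrite mean_poly; congr (_ * _); apply: eq_bigr => i _.
by rewrite momentE.
Qed.

Lemma polyfun_potential : polyfun potential.
Proof.
have -> := funext potentialE.
by apply: polyfunZ; apply: polyfun_sum => i _; apply: polyfunZ; exact: polyfun_moment.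
Qed.

Lemma sqnorm_le_trace x : sqnorm x <= N%:R * moment 2 x.
Proof.
rewrite /moment mulrA mulfV ?pnatr_eq0// mul1r.
have -> : complex.Re (\tr (H x ^+ 2)) = \sum_i \sum_j complex.Re (H x i j * H x j i).
  by rewrite Re_trace; apply: eq_bigr => i _; rewrite mxE cRe_sum.
have -> : sqnorm x = \sum_(i < N) \sum_(j < N) tnth x (mxvec_index i j) ^+ 2.
  rewrite pair_bigA /= /sqnorm (reindex (fun p : 'I_N * 'I_N => mxvec_index p.1 p.2)) //=.
  case: (curry_mxvec_bij N N) => g gK Kg; exists g => [[i j] h|k h].
    exact: (gK (i, j) h).
  by have := Kg k h; case: (g k).
have sym (f : 'I_N -> 'I_N -> R) :
    2 * \sum_i \sum_j f i j = \sum_i \sum_j (f i j + f j i).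
  rewrite mulr2n mulrDl mul1r {2}exchange_big -big_split /=.
  by apply: eq_bigr => i _; rewrite -big_split.
rewrite -(ler_pM2l (ltr0n R 2)) !sym; apply: ler_sum => i _; apply: ler_sum => j _.
rewrite !mxE [j == i]eq_sym; have [<-|ij] := eqVneq i j.
  by rewrite /= mulr0 subr0 !expr2.
have := sqr_ge0 (tnth x (mxvec_index i j)); have := sqr_ge0 (tnth x (mxvec_index j i)).
by case: (ltngtP i j) => [lt|gt|/ord_inj/eqP]; rewrite ?(negPf ij)//= !expr2; lra.
Qed.

(** The potential confines all [N ^ 2] coordinates, because [sqnorm] is dominated by
    the second spectral moment. *)
Lemma potential_ge x : N%:R * c * sqnorm x - N%:R ^+ 2 * C <= potential x.
Proof.
rewrite /potential trace_poly_eigenvalues ?hermitian_of_coords_herm// mulrA -expr2.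
have h : c * moment 2 x - C <= mean (spectrum x) (fun y => V.[y]).
  rewrite momentE -meanZ -[C](@mean_cst _ (spectrum x)) ?size_spectrum// -meanB.
  exact: le_mean.
have := ler_wpM2l (sqr_ge0 (N%:R : R)) h; apply: le_trans.
rewrite mulrBr lerB// expr2 -!mulrA ler_wpM2l// mulrCA (ler_wpM2l (ltW c0))//.
exact: sqnorm_le_trace.
Qed.

Definition dpotential k x : R := N%:R ^+ 2 *
  \sum_(i < size V) V`_i * (i%:R / N%:R * complex.Re (\tr (H x ^+ i.-1 * E k))).

Lemma pd_potential k : pd k potential (dpotential k).
Proof.
have h := pdZ (N%:R ^+ 2) (pd_sum (index_enum 'I_(size V))
   (fun i => pdZ V`_i (@pd_moment R n k i))).
by apply: (pd_ext h) => x //; rewrite potentialE.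
Qed.

Let polyfun_pd_of F G k : polyfun F -> pd k F G -> polyfun G.
Proof.
by move=> /(polyfun_pd k)[G' pG' dG'] /(pd_unique dG') <-.
Qed.

Let Nc0 : 0 < N%:R * c. Proof. by rewrite mulr_gt0// ltr0n. Qed.

Definition gibbs_int F : R := \int[lebesgue_tuple (N * N)]_x (F x * expR (- potential x)).

Lemma integrable_gibbs F : polyfun F ->
  (@lebesgue_tuple R (N * N)).-integrable setT (fun x => (F x * expR (- potential x))%:E).
Proof. exact: (integrable_polyfun Nc0 polyfun_potential potential_ge). Qed.

Lemma gibbs_intD F G : polyfun F -> polyfun G -> gibbs_int (fun x => F x + G x) = gibbs_int F + gibbs_int G.
Proof.
move=> pF pG; rewrite /gibbs_int -RintegralD//; [|exact: integrable_gibbs|exact: integrable_gibbs].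
by apply: eq_Rintegral => x _; rewrite mulrDl.
Qed.

Lemma gibbs_intZ a F : polyfun F -> gibbs_int (fun x => a * F x) = a * gibbs_int F.
Proof.
move=> pF; rewrite /gibbs_int -RintegralZl//; last exact: integrable_gibbs.
by apply: eq_Rintegral => x _; rewrite mulrA.
Qed.

Lemma gibbs_int_sum (I : Type) (r : seq I) (F : I -> (N * N).-tuple RM -> R) :
  (forall i, polyfun (F i)) -> gibbs_int (fun x => \sum_(i <- r) F i x) = \sum_(i <- r) gibbs_int (F i).
Proof.
move=> pF; elim: r => [|i r IH].
  rewrite big_nil -[RHS](mul0r (gibbs_int (fun=> 0))) -gibbs_intZ; last exact: polyfun_cst.
  by congr gibbs_int; apply/funext => x; rewrite big_nil mul0r.
rewrite big_cons -IH -gibbs_intD//; last by apply: polyfun_sum.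
by congr gibbs_int; apply/funext => x; rewrite big_cons.
Qed.

Lemma le_gibbs_int F G : polyfun F -> polyfun G -> (forall x, F x <= G x) -> gibbs_int F <= gibbs_int G.
Proof.
move=> pF pG FG; apply: le_Rintegral => //; try exact: integrable_gibbs.
by move=> x _; rewrite ler_wpM2r// expR_ge0.
Qed.

Lemma polyfun_resid m : polyfun (fun x => resid V m (spectrum x)).
Proof.
apply: polyfunB.
  under eq_fun do rewrite mean_poly; apply: polyfun_sum => i _; apply: polyfunZ.
  by under eq_fun do rewrite -momentE; exact: polyfun_moment.
apply: polyfun_sum => l _; under eq_fun do rewrite -!momentE.
by apply: polyfunM; exact: polyfun_moment.
Qed.

(** Integration by parts against the vector field [X * H ^+ m], coordinate by
    coordinate: the divergence of the field gives the products of moments, the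
    derivative of the potential gives [V']. *)
Lemma loop_equation m X (dX : 'I_(N * N) -> (N * N).-tuple RM -> R) :
  polyfun X -> (forall k, pd k X (dX k)) ->
  N%:R ^+ 2 * gibbs_int (fun x => resid V m (spectrum x) * X x)
  = gibbs_int (fun x => \sum_k hcoord (H x ^+ m) k * dX k x).
Proof.
move=> pX dXP.
pose f k x := (field_div m x k * X x + hcoord (H x ^+ m) k * dX k x)
   - (hcoord (H x ^+ m) k * X x) * dpotential k x.
have pf k : polyfun (f k).
  have p1 := @polyfun_field R n m k; have p2 := polyfun_pd_of p1 (pd_field m k).
  have p3 := polyfun_pd_of pX (dXP k).
  have p4 := polyfun_pd_of polyfun_potential (pd_potential k).
  rewrite /f; apply: polyfunB; first by apply: polyfunD; exact: polyfunM.
  by apply: polyfunM => //; exact: polyfunM.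
have f0 k : gibbs_int (f k) = 0.
  apply: (integration_by_parts_polyfun Nc0 polyfun_potential potential_ge).
  - by apply: polyfunM => //; exact: polyfun_field.
  - apply: polyfunD; apply: polyfunM => //.
    + exact: polyfun_pd_of (polyfun_field m k) (pd_field m k).
    + exact: polyfun_field.
    + exact: polyfun_pd_of pX (dXP k).
  - exact: polyfun_pd_of polyfun_potential (pd_potential k).
  - by apply: pdM; [exact: pd_field|exact: dXP].
  - exact: pd_potential.
have p5 : polyfun (fun x => \sum_k hcoord (H x ^+ m) k * dX k x).
  apply: polyfun_sum => k _; apply: polyfunM; first exact: polyfun_field.
  exact: polyfun_pd_of pX (dXP k).
have p6 : polyfun (fun x => resid V m (spectrum x) * X x).
  by apply: polyfunM => //; exact: polyfun_resid.
apply/eqP; rewrite -gibbs_intZ// eq_sym -subr_eq0 -mulN1r -gibbs_intZ -?gibbs_intD; last 3 first.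
- exact: p5.
- by do 2 apply: polyfunZ.
- exact: polyfunZ.
apply/eqP; transitivity (gibbs_int (fun x => \sum_k f k x)); last by rewrite gibbs_int_sum// big1.
congr gibbs_int; apply/funext => x.
have e3 : \sum_k hcoord (H x ^+ m) k * X x * dpotential k x =
    X x * (N%:R ^+ 2 * mean (spectrum x) (fun y => (V^`() * 'X^m).[y])).
  rewrite mean_deriv_poly /dpotential.
  under [X in _ = _ * (_ * X)]eq_bigr do
    rewrite -momentE -sum_hcoord_moment mulr_sumr.
  rewrite [X in _ = _ * (_ * X)]exchange_big /= !mulr_sumr; apply: eq_bigr => k _.
  rewrite -mulrA mulrCA; congr (_ * _); rewrite mulrCA; congr (_ * _).
  by rewrite mulr_sumr; apply: eq_bigr => i _; rewrite mulrCA.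
rewrite /f sumrB big_split /= -mulr_suml sum_field_div e3 /resid.
by under [X in _ * X * _]eq_bigr do rewrite !momentE; ring.
Qed.

Lemma gibbs_int1_ge0 : 0 <= gibbs_int (fun=> 1).
Proof. by apply: Rintegral_ge0 => x _; rewrite mul1r expR_ge0. Qed.

Fixpoint moment_bound (l : nat) : R :=
  if l is l'.+1 then (C + 2 * (2 * l' + 1)%:R) / c * moment_bound l' else 1.

Hypothesis C0 : 0 <= C.

Lemma moment_bound_ge0 l : 0 <= moment_bound l.
Proof.
elim: l => [|l IH] //=; rewrite mulr_ge0// divr_ge0 ?(ltW c0)//.
by rewrite addr_ge0// mulr_ge0.
Qed.

(** Coercivity of [V' * x] against the crude bound of the products of moments. *)
Lemma resid_ge s l : (0 < size s)%N ->
  c * mom s (2 * l.+1) - (C + 2 * (2 * l + 1)%:R) * mom s (2 * l)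
  <= resid V (2 * l + 1) s.
Proof.
move=> s0; rewrite mulrDl opprD addrA; apply: lerB.
  rewrite /mom -!meanZ -meanB; apply: le_mean => y.
  rewrite hornerM hornerXn addn1 exprS (_ : 2 * l.+1 = 2 + 2 * l)%N; last by lia.
  have h : 0 <= y ^+ (2 * l) by rewrite exprM exprn_ge0// sqr_ge0.
  by have := ler_wpM2r h (dVC y); rewrite mulrBl exprD !mulrA.
apply: (@le_trans _ _ (\sum_(j < 2 * l + 1) 2 * mom s (2 * l))).
  apply: ler_sum => j _; apply: le_trans (ler_norm _) _; apply: mom_mul_le => //.
  by have := ltn_ord j; lia.
by rewrite sumr_const card_ord -[_ *+ _]mulr_natl mulrA [_ * 2]mulrC.
Qed.

Lemma polyfun_mom j : polyfun (fun x => mom (spectrum x) j).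
Proof. by under eq_fun do rewrite -momentE; exact: polyfun_moment. Qed.

(** With [X = 1] the loop equation says that the residual has mean zero; by
    [resid_ge] each even moment is then bounded through the previous one. *)
Lemma gibbs_int_mom_le l : gibbs_int (fun x => mom (spectrum x) (2 * l)) <= moment_bound l * gibbs_int (fun=> 1).
Proof.
elim: l => [|l IH].
  rewrite mul1r; apply: le_gibbs_int; [exact: polyfun_mom|exact: polyfun_cst|move=> x].
  by rewrite /mom (eq_mean _ (fun=> expr0 _)) mean_cst// size_spectrum.
have p1 : @polyfun R (N * N) (fun=> 1) := polyfun_cst 1; have pm := polyfun_mom.
have := loop_equation (2 * l + 1) p1 (fun k => pd_cst k 1).
rewrite [X in _ = X](_ : _ = 0); last first.
  rewrite -[RHS](mul0r (gibbs_int (fun=> 1))) -gibbs_intZ; last exact: p1.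
  by congr gibbs_int; apply/funext => x; rewrite mul0r big1// => k _; rewrite mulr0.
move=> /eqP; rewrite mulf_eq0 expf_eq0 pnatr_eq0 /= => /eqP E0.
have : gibbs_int (fun x => c * mom (spectrum x) (2 * l.+1) +
    - (C + 2 * (2 * l + 1)%:R) * mom (spectrum x) (2 * l)) <= 0.
  rewrite -E0; apply: le_gibbs_int.
  - by apply: polyfunD; apply: polyfunZ.
  - by apply: polyfunM => //; exact: polyfun_resid.
  - by move=> x; rewrite mulr1 mulNr; apply: resid_ge; rewrite size_spectrum.
rewrite gibbs_intD ?gibbs_intZ//; try exact: polyfunZ.
rewrite mulNr subr_le0 => h.
have d0 : 0 <= C + 2 * (2 * l + 1)%:R by rewrite addr_ge0// mulr_ge0.
rewrite /= -(ler_pM2l c0) (le_trans h)//.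
rewrite (_ : c * _ = (C + 2 * (2 * l + 1)%:R) * (moment_bound l * gibbs_int (fun=> 1))); last first.
  by field; rewrite gt_eqF.
exact: ler_wpM2l.
Qed.

Definition partial_resid m k x : R :=
  let dmom j := j%:R / N%:R * complex.Re (\tr (H x ^+ j.-1 * E k)) in
  \sum_(i < size (V^`() * 'X^m)) (V^`() * 'X^m)`_i * dmom i
  - \sum_(l < m) (dmom l * moment (m.-1 - l) x + moment l x * dmom (m.-1 - l)%N).

Lemma pd_resid m k : pd k (fun x => resid V m (spectrum x)) (partial_resid m k).
Proof.
have h1 := pd_sum (index_enum 'I_(size (V^`() * 'X^m)))
   (fun i => pdZ (V^`() * 'X^m)`_i (@pd_moment R n k i)).
have h2 := pd_sum (index_enum 'I_m)
   (fun l => pdM (@pd_moment R n k l) (@pd_moment R n k (m.-1 - l))).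
apply: (pd_ext (pdB h1 h2)) => x //.
rewrite /resid mean_poly; congr (_ - _); apply: eq_bigr => i _; by rewrite !momentE.
Qed.

Lemma sum_hcoord_partial_resid m x :
  \sum_k hcoord (H x ^+ m) k * partial_resid m k x = flow_deriv_resid V m (spectrum x).
Proof.
rewrite /partial_resid; under eq_bigr do rewrite mulrBr; rewrite sumrB; congr (_ - _).
  under eq_bigr do rewrite mulr_sumr; rewrite exchange_big /=; apply: eq_bigr => i _.
  rewrite -momentE -sum_hcoord_moment mulr_sumr; apply: eq_bigr => k _.
  by rewrite mulrCA.
under eq_bigr do rewrite mulr_sumr; rewrite exchange_big /=; apply: eq_bigr => l _.
under eq_bigr do rewrite mulrDr; rewrite big_split /=; congr (_ + _).
  rewrite -!momentE -sum_hcoord_moment mulr_suml; apply: eq_bigr => k _.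
  by rewrite mulrA.
rewrite -!momentE -sum_hcoord_moment mulr_sumr; apply: eq_bigr => k _.
by rewrite mulrCA.
Qed.

(** The loop equation with [X] the residual itself: its derivative along [H ^+ m] is
    bounded, whence the factor [N ^ -2]. *)
Lemma gibbs_int_resid_sqr m D L : 0 <= D ->
  (forall s, (0 < size s)%N -> `|flow_deriv_resid V m s| <= D * (1 + mom s (2 * L))) ->
  N%:R ^+ 2 * gibbs_int (fun x => resid V m (spectrum x) ^+ 2)
  <= D * (1 + moment_bound L) * gibbs_int (fun=> 1).
Proof.
move=> D0 hD; have pr := @polyfun_resid m.
have := loop_equation m pr (pd_resid m).
under [X in _ * gibbs_int X]eq_fun do rewrite -expr2.
move=> ->; have p1 : @polyfun R (N * N) (fun=> 1) := polyfun_cst 1; have pm := polyfun_mom.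
apply: (@le_trans _ _ (gibbs_int (fun x => D * (1 + mom (spectrum x) (2 * L))))).
  apply: le_gibbs_int.
  - apply: polyfun_sum => k _; apply: polyfunM; first exact: polyfun_field.
    exact: polyfun_pd_of pr (pd_resid m k).
  - by apply: polyfunZ; apply: polyfunD => //; exact: p1.
  - move=> x; rewrite sum_hcoord_partial_resid; apply: le_trans (ler_norm _) (hD _ _).
    by rewrite size_spectrum.
rewrite gibbs_intZ; last by apply: polyfunD => //; exact: p1.
rewrite -mulrA ler_wpM2l// gibbs_intD//.
by rewrite mulrDl mul1r lerD2l gibbs_int_mom_le.
Qed.

End LoopEquation.

(** * Probability estimates *)

Section Law.
Context {R : realType} {n : nat}.
Local Notation RM := (measurableTypeR R).
Local Notation N := n.+1.
Local Notation leb := (@lebesgue_tuple R (N * N)).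
Variables (V : {poly R}) (c C : R).
Hypotheses (c0 : 0 < c)
  (VC : forall y, c * y ^+ 2 - C <= V.[y]).
Implicit Types (x : (N * N).-tuple RM) (F : (N * N).-tuple RM -> R).

Lemma weightE x : weight V x = (expR (- potential V x))%:E.
Proof. by rewrite /weight mulNr. Qed.

Lemma integral_weight F : polyfun F ->
  (\int[leb]_x (F x * expR (- potential V x))%:E = (gibbs_int V F)%:E)%E.
Proof.
move=> pF; rewrite /gibbs_int /Rintegral fineK//.
exact: integrable_fin_num (integrable_gibbs c0 VC pF).
Qed.

Lemma partition_functionE : partition_function n V = (@gibbs_int R n V (fun=> 1))%:E.
Proof.
rewrite -integral_weight; last exact: polyfun_cst.
by apply: eq_integral => x _; rewrite weightE mul1r.
Qed.

Context d (Omega : measurableType d) (P : probability Omega R)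
  (M : Omega -> 'M[R[i]]_N).
Hypothesis hM : random_matrix_of P V M.
Local Notation X := (hermitian_coords \o M).

(** A vanishing partition function would give [Omega] probability zero. *)
Lemma gibbs_int1_gt0 : 0 < @gibbs_int R n V (fun=> 1).
Proof.
case: hM => _ _ /(_ setT measurableT); rewrite preimage_setT probability_setT.
rewrite /matrix_law partition_functionE /= lt_def gibbs_int1_ge0 andbT => h.
apply/eqP => e; move: h; rewrite e invr0 mul0e => /eqP.
by rewrite onee_eq0.
Qed.

Lemma measurable_superlevel F (a : R) : polyfun F -> measurable [set x | a < F x].
Proof.
move=> /measurable_polyfun mF; rewrite -[X in measurable X]setTI.
have := mF measurableT `]a, +oo[%classic (measurable_itv _).
rewrite !setTI; congr (measurable _); apply/seteqP; split => x /=;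
  by rewrite in_itv/= andbT.
Qed.

Lemma measurable_preimage_coords B : measurable B -> measurable (X @^-1` B).
Proof.
case: hM => _ mX _ mB; rewrite -[_ @^-1` _]setTI; exact: mX.
Qed.

(** Markov's inequality, for polynomial observables and with the unnormalized
    weight on both sides. *)
Lemma markov_matrix F (a K : R) : polyfun F -> (forall x, 0 <= F x) -> 0 < a ->
  gibbs_int V F <= K * @gibbs_int R n V (fun=> 1) ->
  (P (X @^-1` [set x | (a < F x)%R]) <= (K / a)%:E)%E.
Proof.
move=> pF F0 a0 FK; have mB := measurable_superlevel a pF.
have mFw G : polyfun G -> measurable_fun setT (fun x => (G x * expR (- potential V x))%:E).
  by move=> /(integrable_gibbs c0 VC)/integrableP[].
have m1 : measurable_fun setT (fun x => (expR (- potential V x))%:E).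
  have := mFw _ (polyfun_cst 1); congr measurable_fun.
  by apply/funext => x; rewrite mul1r.
have paF : polyfun (fun x => a^-1 * F x) by exact: polyfunZ.
have aF0 x : 0 <= a^-1 * F x by rewrite mulr_ge0// invr_ge0 ltW.
case: hM => _ mX /(_ _ mB) ->.
rewrite /matrix_law partition_functionE -[fine _]/(@gibbs_int R n V (fun=> 1)); have Z0 := gibbs_int1_gt0.
have h : (\int[leb]_(x in [set x | (a < F x)%R]) weight V x <= (gibbs_int V (fun x => a^-1 * F x)%R)%:E)%E.
  rewrite -integral_weight//.
  apply: (@le_trans _ _ (\int[leb]_(x in [set x | (a < F x)%R])
      (a^-1 * F x * expR (- potential V x))%:E)%E).
    apply: ge0_le_integral => //.
    - by move=> x _; rewrite weightE lee_fin expR_ge0.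
    - by rewrite (funext weightE); exact: measurable_funTS.
    - by apply: measurable_funTS; exact: mFw paF.
    - move=> x /= aF; rewrite weightE lee_fin ler_peMl ?expR_ge0//.
      by rewrite mulrC ler_pdivlMr// mul1r ltW.
  apply: ge0_subset_integral => //; first exact: mFw paF.
  by move=> x _; rewrite lee_fin mulr_ge0// expR_ge0.
have iZ0 : (0 <= (@gibbs_int R n V (fun=> 1%R))^-1%:E)%E.
  by rewrite lee_fin invr_ge0 ltW.
apply: le_trans (lee_wpmul2l iZ0 h) _.
rewrite -EFinM lee_fin (gibbs_intZ c0 VC)// mulrC ler_pdivrMr//.
by rewrite mulrC mulrAC ler_wpM2r// invr_ge0 ltW.
Qed.

Lemma eigenvalues_coords w : eigenvalues (M w) = spectrum (X w).
Proof. by case: hM => hw _ _; rewrite /spectrum /= hermitian_coordsK. Qed.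

End Law.

Lemma union_bound {R : realType} d (Omega : measurableType d) (P : probability Omega R)
    (L : nat) (A : nat -> set Omega) (e : nat -> R) :
  (forall i, measurable (A i)) -> (forall i, (P (A i) <= (e i)%:E)%E) ->
  exists B, [/\ measurable B, (P B <= (\sum_(i < L) e i)%:E)%E &
     forall w, ~ B w -> forall i, (i < L)%N -> ~ A i w].
Proof.
move=> mA Ae; elim: L => [|L [B [mB PB hB]]].
  by exists set0; split => //; rewrite measure0 big_ord0.
exists (B `|` A L); split; first exact: measurableU.
  by rewrite (le_trans (measureU2 _ _ _))// big_ord_recr/= EFinD leeD.
by move=> w /not_orP[h1 h2] i; rewrite ltnS leq_eqVlt => /predU1P[->//|]; exact: hB.
Qed.


Section GoodEvent.
Context {R : realType} d (Omega : measurableType d) (P : probability Omega R).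
Variables (V : {poly R}) (c C : R).
Hypotheses (c0 : 0 < c) (C0 : 0 <= C)
  (VC : forall y, c * y ^+ 2 - C <= V.[y])
  (dVC : forall y, c * y ^+ 2 - C <= V^`().[y] * y).
Variables (M : forall n : nat, Omega -> 'M[R[i]]_n.+1).
Hypothesis hM : forall n : nat, random_matrix_of P V (M n).

Let sum_half L : \sum_(l < L) (2 ^+ (l + 2))^-1 <= 2^-1 :> R.
Proof.
suff -> : \sum_(l < L) (2 ^+ (l + 2))^-1 = 2^-1 - (2 ^+ (L + 1))^-1 :> R.
  by rewrite gerBl invr_ge0 exprn_ge0.
elim: L => [|L IH]; first by rewrite big_ord0 add0n expr1 subrr.
rewrite big_ord_recr /= IH !addn1 !addn2 !exprS.
by field; rewrite expf_eq0 pnatr_eq0 andbF.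
Qed.

(** Markov for the moments and for the squared residuals.  The bounds [K] are chosen
    before [L] and [delta], so that one sequence of bounds serves all the loop
    equations. *)
Lemma good_event (tau : R) : 0 < tau -> exists K : nat -> R, forall L delta, 0 < delta ->
  \forall n \near \oo, exists B : set Omega,
  [/\ measurable B, (P B <= tau%:E)%E & forall w, ~ B w ->
    (forall l, (l <= L)%N -> mom (eigenvalues (M n w)) (2 * l) <= K l) /\
    (forall m, (m <= L)%N -> `|resid V m (eigenvalues (M n w))| <= delta)].
Proof.
move=> tau0; pose mb := moment_bound c C; have mb0 l : 0 <= mb l by exact: (moment_bound_ge0 c0).
(* the weights [2 ^ -(l + 2)] sum to at most [1 / 2] over all [l], which leaves
   [tau / 2] for the residuals *)
pose K l := (mb l + 1) * 2 ^+ (l + 2) / tau.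
have K0 l : 0 < K l by rewrite divr_gt0// mulr_gt0 ?exprn_gt0// ltr_wpDl.
exists K => L delta d0.
have /choice[D /choice[l' hD]] := mom_dominated_flow_deriv_resid V.
pose e m := D m * (1 + mb (l' m)).
have e0 m : 0 <= e m by rewrite mulr_ge0 ?(hD m).1// addr_ge0.
pose S := \sum_(m < L.+1) e m / delta ^+ 2.
near=> n.
have nS : S <= tau / 2 * n.+1%:R ^+ 2.
  have nt : S / (tau / 2) <= n%:R by near: n; exact: nbhs_infty_ger.
  rewrite mulrC -ler_pdivrMr ?divr_gt0// (le_trans nt)//.
  rewrite (le_trans _ (_ : n.+1%:R <= _))// ?ler_nat//.
  by rewrite expr2 ler_peMl// ler1n.
have N0 : 0 < n.+1%:R :> R by rewrite ltr0n.
have Z0 := gibbs_int1_gt0 c0 VC (hM n).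
have pm j : polyfun (fun x => mom (@spectrum R n x) j) := @polyfun_mom R n j.
have pr m : polyfun (fun x => resid V m (@spectrum R n x) ^+ 2).
  by apply: polyfunM; exact: polyfun_resid.
have [l|B1 [mB1 PB1 hB1]] := @union_bound R d Omega P L.+1
  (fun l => (hermitian_coords \o M n) @^-1` [set x | K l < mom (spectrum x) (2 * l)])
  (fun l => tau * (2 ^+ (l + 2))^-1)
  (fun l => measurable_preimage_coords (hM n) (measurable_superlevel _ (pm _))).
  apply: le_trans (markov_matrix c0 VC (hM n) (pm _) (fun x => mom_even_ge0 _ l) (K0 l)
    (gibbs_int_mom_le c0 VC dVC C0 l)) _.
  rewrite lee_fin ler_pdivrMr// -/(mb l) /K.
  have -> : tau / 2 ^+ (l + 2) * ((mb l + 1) * 2 ^+ (l + 2) / tau) = mb l + 1.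
    by field; rewrite (gt_eqF tau0) expf_eq0 pnatr_eq0 andbF.
  by lra.
have [m|B2 [mB2 PB2 hB2]] := @union_bound R d Omega P L.+1
  (fun m => (hermitian_coords \o M n) @^-1` [set x | delta ^+ 2 < resid V m (spectrum x) ^+ 2])
  (fun m => e m / n.+1%:R ^+ 2 / delta ^+ 2)
  (fun m => measurable_preimage_coords (hM n) (measurable_superlevel _ (pr m))).
  apply: (markov_matrix c0 VC (hM n) (pr m) (fun x => sqr_ge0 _) (exprn_gt0 2 d0)).
  rewrite mulrAC ler_pdivlMr ?exprn_gt0// mulrC.
  exact: (gibbs_int_resid_sqr c0 VC dVC C0 (hD m).1 (hD m).2).
exists (B1 `|` B2); split; first exact: measurableU.
  rewrite (le_trans (measureU2 _ _ _))// (splitr tau) EFinD leeD//.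
    by rewrite (le_trans PB1)// lee_fin -mulr_sumr ler_wpM2l// ltW.
  rewrite (le_trans PB2)// lee_fin; move: nS; rewrite -ler_pdivrMr ?exprn_gt0//.
  apply: le_trans; rewrite /S mulr_suml ler_sum// => m _.
  by rewrite mulrAC.
move=> w /not_orP[h1 h2]; rewrite (eigenvalues_coords (hM n)); split => l lL.
  by have /negP := hB1 w h1 l lL; rewrite -leNgt.
have /negP := hB2 w h2 l lL; rewrite -leNgt /=.
by rewrite -(real_normK (num_real (resid _ _ _))) ler_pXn2r ?nnegrE// ltW.
Unshelve. all: by end_near. Qed.

End GoodEvent.

(** * Limits of spectral means along an ultrafilter *)

Section PolyBounded.
Context {R : realType}.
Implicit Types (f g : R -> R).

(** One even power as the gauge: these functions form an algebra that contains the
    polynomials. *)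
Definition poly_growth f := exists C L, 0 <= C /\ forall x, `|f x| <= C * (1 + x ^+ (2 * L)).

Lemma even_power_ge0 (x : R) L : 0 <= x ^+ (2 * L).
Proof. by rewrite exprM exprn_ge0// sqr_ge0. Qed.

Lemma even_power_le (x : R) L L' : (L <= L')%N -> 1 + x ^+ (2 * L) <= 2 * (1 + x ^+ (2 * L')).
Proof.
move=> LL'; have := @norm_power_le1 R x (2 * L) L'; rewrite leq_mul2l LL' => /(_ isT).
have := even_power_ge0 x L'; have := ler_norm (x ^+ (2 * L)); lra.
Qed.

Lemma poly_growth_le f g : poly_growth g -> (forall x, `|f x| <= `|g x|) -> poly_growth f.
Proof.
move=> [C [L [C0 gC]]] fg; exists C, L; split => // x; exact: le_trans (fg x) (gC x).
Qed.

Lemma poly_growth_bounded f C : (forall x, `|f x| <= C) -> poly_growth f.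
Proof.
move=> fC; exists `|C|, 0%N; split => // x.
apply: le_trans (fC x) _; apply: le_trans (ler_norm C) _.
by rewrite ler_peMr// lerDl expr0.
Qed.

Lemma poly_growth_cst a : poly_growth (fun=> a).
Proof. by apply: (@poly_growth_bounded _ `|a|). Qed.

Lemma poly_growthD f g : poly_growth f -> poly_growth g -> poly_growth (fun x => f x + g x).
Proof.
move=> [C [L [C0 fC]]] [D [L' [D0 gD]]].
exists (2 * C + 2 * D), (maxn L L'); split; first by lra.
move=> x; rewrite (le_trans (ler_normD _ _))// mulrDl lerD//.
  apply: le_trans (fC x) _; rewrite -mulrA mulrCA ler_wpM2l//.
  exact: even_power_le (leq_maxl _ _).
apply: le_trans (gD x) _; rewrite -mulrA mulrCA ler_wpM2l//.
exact: even_power_le (leq_maxr _ _).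
Qed.

Lemma poly_growthM f g : poly_growth f -> poly_growth g -> poly_growth (fun x => f x * g x).
Proof.
move=> [C [L [C0 fC]]] [D [L' [D0 gD]]].
exists (C * D * 5), (L + L')%N; split; first by rewrite !mulr_ge0.
move=> x; rewrite normrM (le_trans (ler_pM _ _ (fC x) (gD x)))//.
rewrite mulrACA -[leRHS]mulrA ler_wpM2l ?mulr_ge0// mulrDl mul1r mulrDr mulr1.
rewrite -exprD -mulnDr.
have l1 := @even_power_le x L (L + L') (leq_addr _ _).
have l2 := @even_power_le x L' (L + L') (leq_addl _ _).
have := even_power_ge0 x (L + L'); lra.
Qed.

Lemma poly_growthZ a f : poly_growth f -> poly_growth (fun x => a * f x).
Proof. by apply: poly_growthM; exact: poly_growth_cst. Qed.

Lemma poly_growthN f : poly_growth f -> poly_growth (fun x => - f x).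
Proof. by move=> /poly_growth_le; apply => x; rewrite normrN. Qed.

Lemma poly_growthB f g : poly_growth f -> poly_growth g -> poly_growth (fun x => f x - g x).
Proof. by move=> pf /poly_growthN; exact: poly_growthD. Qed.

Lemma poly_growth_power j : poly_growth (fun x => x ^+ j).
Proof.
exists 1, j; split => // x; rewrite mul1r; apply: norm_power_le1; lia.
Qed.

Lemma poly_growth_sum (I : Type) (r : seq I) (F : I -> R -> R) :
  (forall i, poly_growth (F i)) -> poly_growth (fun x => \sum_(i <- r) F i x).
Proof.
move=> pF; elim: r => [|i r IH].
  by under eq_fun do rewrite big_nil; exact: poly_growth_cst.
by under eq_fun do rewrite big_cons; exact: poly_growthD.
Qed.

Lemma poly_growth_poly (q : {poly R}) : poly_growth (horner q).
Proof.
rewrite (funext (horner_coef q)); apply: poly_growth_sum => i; apply: poly_growthZ.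
exact: poly_growth_power.
Qed.

(** A limit of spectral means is kept as a positive functional on the functions of
    polynomial growth, on which moments of all orders make sense. *)
Record loop_state (V : {poly R}) (Lam : (R -> R) -> R) : Prop := LoopState {
  stateD : forall f g, poly_growth f -> poly_growth g -> Lam (fun x => f x + g x) = Lam f + Lam g;
  stateZ : forall a f, poly_growth f -> Lam (fun x => a * f x) = a * Lam f;
  state_le : forall f g, poly_growth f -> poly_growth g -> (forall x, f x <= g x) -> Lam f <= Lam g;
  state1 : Lam (fun=> 1) = 1;
  state_loop : forall m, Lam (horner (V^`() * 'X^m)) =
    \sum_(l < m) Lam (fun x => x ^+ l) * Lam (fun x => x ^+ (m.-1 - l)) }.

End PolyBounded.

(** A bounded interval is compact and an ultrafilter converges to any of its cluster
    points. *)
Lemma ultrafilter_cvg {R : realType} T (U : set_system T) (u : T -> R) (B : R) :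
  UltraFilter U -> (\forall j \near U, `|u j| <= B) -> cvg (u @ U).
Proof.
move=> UU uB.
have PU : ProperFilter U by exact: ultra_proper.
have uBB : (u @ U) `[- B, B]%classic.
  by apply: filterS uB => j; rewrite /= in_itv/= -ler_norml.
have [p [_ pU]] := @segment_compact R (- B) B (u @ U) _ uBB.
apply/cvg_ex; exists p => A pA.
have [//|hA] := in_ultra_setVsetC (u @^-1` A) UU.
have [z [/= h1 h2]] := pU (~` A) A hA pA.
by [].
Qed.

Section UltraLimit.
Context {R : realType}.
Variables (V : {poly R}) (s : nat -> seq R) (K : nat -> R).
Hypotheses (s0 : forall j, (0 < size (s j))%N)
  (sK : forall j l, (l <= j)%N -> mom (s j) (2 * l) <= K l)
  (sV : forall j m, (m <= j)%N -> `|resid V m (s j)| <= j.+1%:R^-1).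

(** An ultrafilter makes the means of all functions of polynomial growth converge at
    once, and limits along it are additive, positive and multiplicative. *)
Lemma exists_loop_state : exists (U : set_system nat) (Lam : (R -> R) -> R),
  [/\ UltraFilter U, \oo `<=` U, loop_state V Lam &
      forall f, poly_growth f -> mean (s j) f @[j --> U] --> Lam f].
Proof.
have [U [UU sU]] := ultraFilterLemma eventually_filter.
have PU : ProperFilter U by exact: ultra_proper.
pose Lam f : R := lim (mean (s j) f @[j --> U]).
have LamP f : poly_growth f -> mean (s j) f @[j --> U] --> Lam f.
  move=> [C [L [C0 fC]]]; apply: (@ultrafilter_cvg _ _ _ _ (C * (1 + K L))) => //.
  apply: sU; near=> j.
  have Lj : (L <= j)%N by near: j; exact: nbhs_infty_ge.
  apply: (@le_trans _ _ (mean (s j) (fun x => C * (1 + x ^+ (2 * L))))).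
    exact: norm_mean_le.
  by rewrite meanZ meanD mean_cst// ler_wpM2l// lerD2l sK.
have LamE f l : poly_growth f -> mean (s j) f @[j --> U] --> l -> Lam f = l.
  by move=> pf fl; exact: (cvg_unique _ (LamP f pf) fl).
have pp := @poly_growth_power R.
exists U, Lam; split => //; split.
- move=> f g pf pg; apply: LamE; first exact: poly_growthD.
  under eq_fun do rewrite meanD; apply: cvgD; exact: LamP.
- move=> a f pf; apply: LamE; first exact: poly_growthZ.
  under eq_fun do rewrite meanZ; apply: cvgM; [exact: cvg_cst|exact: LamP].
- move=> f g pf pg fg; apply: ler_cvg_to (LamP f pf) (LamP g pg) _.
  by apply: nearW => j; exact: le_mean.
- apply: LamE; first exact: poly_growth_cst.
  under eq_fun do rewrite mean_cst//; exact: cvg_cst.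
- move=> m.
  have h1 : resid V m (s j) @[j --> U] --> (0 : R).
    apply/cvgrPdist_lt => e e0; apply: sU; near=> j.
    rewrite sub0r normrN (le_lt_trans (sV _))//.
      by near: j; exact: nbhs_infty_ge.
    near: j; exact: near_infty_natSinv_lt (PosNum e0).
  have h2 : resid V m (s j) @[j --> U] --> Lam (horner (V^`() * 'X^m)) -
      \sum_(l < m) Lam (fun x => x ^+ l) * Lam (fun x => x ^+ (m.-1 - l)).
    apply: cvgB; first by apply: LamP; exact: poly_growth_poly.
    elim: (index_enum _) => [|l r IH].
      by under eq_fun do rewrite big_nil; rewrite big_nil; exact: cvg_cst.
    under eq_fun do rewrite big_cons; rewrite big_cons; apply: cvgD => //.
    by apply: cvgM; apply: LamP.
  by apply/eqP; rewrite -subr_eq0; apply/eqP; exact: (cvg_unique _ h2 h1).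
Unshelve. all: by end_near. Qed.

End UltraLimit.

(** * Compact support of the limiting state *)

Section StateTheory.
Context {R : realType}.
Variables (V : {poly R}) (Lam : (R -> R) -> R).
Hypothesis HL : loop_state V Lam.
Implicit Types (f g : R -> R).

Let LamD := stateD HL.
Let LamZ := stateZ HL.
Let Lam_le := state_le HL.
Local Notation m_ j := (Lam (fun x => x ^+ j)).

Lemma state_cst a : Lam (fun=> a) = a.
Proof.
rewrite -[RHS]mulr1 -(state1 HL) -LamZ; last exact: poly_growth_cst.
by congr Lam; apply/funext => x; rewrite mulr1.
Qed.

Lemma stateN f : poly_growth f -> Lam (fun x => - f x) = - Lam f.
Proof. by move=> pf; rewrite -mulN1r -LamZ//; congr Lam; apply/funext => x; rewrite mulN1r. Qed.

Lemma stateB f g : poly_growth f -> poly_growth g -> Lam (fun x => f x - g x) = Lam f - Lam g.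
Proof. by move=> pf pg; rewrite LamD ?stateN//; exact: poly_growthN. Qed.

Lemma state_power0 : m_ 0 = 1.
Proof. by rewrite -(state1 HL); congr Lam; apply/funext => x; rewrite expr0. Qed.

Lemma state_sum (I : Type) (r : seq I) (F : I -> R -> R) :
  (forall i, poly_growth (F i)) -> Lam (fun x => \sum_(i <- r) F i x) = \sum_(i <- r) Lam (F i).
Proof.
move=> pF; elim: r => [|i r IH].
  by under eq_fun do rewrite big_nil; rewrite big_nil state_cst.
under eq_fun do rewrite big_cons; rewrite big_cons LamD//; last exact: poly_growth_sum.
by rewrite IH.
Qed.

Lemma state_poly (q : {poly R}) : Lam (horner q) = \sum_(i < size q) q`_i * m_ i.
Proof.
rewrite (funext (horner_coef q)) state_sum.
  by apply: eq_bigr => i _; rewrite LamZ//; exact: poly_growth_power.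
by move=> i; apply: poly_growthZ; exact: poly_growth_power.
Qed.

Lemma state_ge0 f : poly_growth f -> (forall x, 0 <= f x) -> 0 <= Lam f.
Proof. by move=> pf f0; rewrite -(state_cst 0); apply: Lam_le => //; exact: poly_growth_cst. Qed.

Lemma state_even_ge0 l : 0 <= m_ (2 * l).
Proof. by apply: state_ge0 => [|x]; [exact: poly_growth_power|exact: even_power_ge0]. Qed.

(** Positivity in two variables at once, used on the square of [u - v], replaces the
    Cauchy-Schwarz inequality for moments. *)
Lemma state_mul_le l j : (j <= 2 * l)%N ->
  m_ j * m_ (2 * l - j) <= 2^-1 * (m_ (2 * j./2) * m_ (2 * (l - j./2))
     + m_ (2 * uphalf j) * m_ (2 * (l - uphalf j))).
Proof.
move=> jl; have pp := @poly_growth_power R.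
have key (u v : R) : u ^+ j * v ^+ (2 * l - j) <= 2^-1 *
   (u ^+ (2 * j./2) * v ^+ (2 * (l - j./2)) + u ^+ (2 * uphalf j) * v ^+ (2 * (l - uphalf j))).
  have : (j = 2 * j./2 \/ j = (2 * j./2).+1)%N.
    by have := odd_double_half j; case: (odd j) => /=; lia.
  move=> [e|e].
    have -> : uphalf j = j./2 by lia.
    rewrite {1}e; have -> : (2 * l - j = 2 * (l - j./2))%N by lia.
    lra.
  have -> : uphalf j = (j./2).+1 by lia.
  set i := j./2 in e *.
  have -> : (2 * l - j = (2 * (l - i.+1)).+1)%N by lia.
  have -> : (2 * (l - i) = (2 * (l - i.+1)).+2)%N by lia.
  rewrite e mulnS !exprS; set a := u ^+ _; set b := v ^+ _.
  have ab : 0 <= a * b by rewrite mulr_ge0// even_power_ge0.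
  have := mulr_ge0 ab (sqr_ge0 (u - v)); rewrite expr2; lra.
have k2 (u : R) : m_ (2 * l - j) * u ^+ j <= 2^-1 *
   (m_ (2 * (l - j./2)) * u ^+ (2 * j./2) + m_ (2 * (l - uphalf j)) * u ^+ (2 * uphalf j)).
  have := Lam_le (poly_growthZ (u ^+ j) (pp (2 * l - j)%N)) (poly_growthZ 2^-1 (poly_growthD
     (poly_growthZ (u ^+ (2 * j./2)) (pp _)) (poly_growthZ (u ^+ (2 * uphalf j)) (pp _)))) (key u).
  rewrite !LamZ// ?LamD ?LamZ//; try exact: poly_growthZ; try by apply: poly_growthD; exact: poly_growthZ.
  by rewrite [m_ _ * _]mulrC ![m_ _ * u ^+ _]mulrC.
have := Lam_le (poly_growthZ (m_ (2 * l - j)) (pp j)) (poly_growthZ 2^-1 (poly_growthD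
     (poly_growthZ (m_ (2 * (l - j./2))) (pp _)) (poly_growthZ (m_ (2 * (l - uphalf j))) (pp _)))) k2.
rewrite !LamZ// ?LamD ?LamZ//; try exact: poly_growthZ; try by apply: poly_growthD; exact: poly_growthZ.
by rewrite [m_ _ * m_ j]mulrC ![m_ (2 * (_ - _)) * _]mulrC.
Qed.

Lemma sum_half_ge0 (F : nat -> R) l : (forall i, 0 <= F i) ->
  \sum_(j < 2 * l + 1) (F j./2 + F (uphalf j)) <= 4 * \sum_(i < l.+1) F i.
Proof.
move=> F0.
suff -> : \sum_(j < 2 * l + 1) (F j./2 + F (uphalf j)) =
    4 * \sum_(i < l.+1) F i - F 0%N - F l.
  by have := F0 0%N; have := F0 l; lra.
elim: l => [|l IH]; first by rewrite !big_ord_recr !big_ord0 /=; lra.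
rewrite (_ : 2 * l.+1 + 1 = (2 * l + 1).+2)%N; last by lia.
rewrite 2!big_ord_recr /= IH [\sum_(i < l.+2) _]big_ord_recr /=.
have -> : ((2 * l + 1)./2 = l)%N by lia.
have -> : (uphalf (2 * l + 1) = l.+1)%N by lia.
lra.
Qed.

Variables (c C : R).
Hypotheses (c0 : 0 < c) (C0 : 0 <= C)
  (dVC : forall y, c * y ^+ 2 - C <= V^`().[y] * y).

(** The loop equation of odd order [2 l + 1], with coercivity of [V' * x] on one side
    and even moments on the other. *)
Lemma state_even_rec l : c * m_ (2 * l.+1) <=
  (C + 2) * \sum_(i < l.+1) m_ (2 * i) * m_ (2 * (l - i)).
Proof.
pose F i := m_ (2 * i) * m_ (2 * (l - i)).
have F0 i : 0 <= F i by rewrite mulr_ge0// state_even_ge0.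
have pp := @poly_growth_power R.
have h1 : c * m_ (2 * l.+1) - C * m_ (2 * l) <= Lam (horner (V^`() * 'X^(2 * l + 1))).
  rewrite -!LamZ// -stateB; try exact: poly_growthZ.
  apply: Lam_le; [by apply: poly_growthB; exact: poly_growthZ|exact: poly_growth_poly|move=> y].
  rewrite hornerM hornerXn addn1 exprS (_ : 2 * l.+1 = 2 + 2 * l)%N; last by lia.
  by have := ler_wpM2r (even_power_ge0 y l) (dVC y); rewrite mulrBl exprD !mulrA.
have h2 : Lam (horner (V^`() * 'X^(2 * l + 1))) <= 2 * \sum_(i < l.+1) F i.
  rewrite (state_loop HL) -(ler_pM2l (ltr0n R 2)) mulrA -natrM.
  apply: le_trans (sum_half_ge0 l F0); rewrite mulr_sumr; apply: ler_sum => j _.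
  have jl : (j <= 2 * l)%N by have := ltn_ord j; lia.
  rewrite (_ : (2 * l + 1).-1 - j = 2 * l - j)%N; last by lia.
  by have := state_mul_le jl; rewrite /F; lra.
have h3 : m_ (2 * l) <= \sum_(i < l.+1) F i.
  rewrite big_ord_recr /= {2}/F subnn muln0 state_power0 mulr1.
  by rewrite lerDr sumr_ge0.
have := ler_wpM2l C0 h3; rewrite mulrDl -/F; lra.
Qed.

Lemma sum_inv_sqr_le n : \sum_(i < n) (i.+1%:R ^+ 2)^-1 <= 2 :> R.
Proof.
case: n => [|n]; first by rewrite big_ord0.
suff : \sum_(i < n.+1) (i.+1%:R ^+ 2)^-1 + n.+1%:R^-1 <= 2 :> R.
  by apply: le_trans; rewrite lerDl invr_ge0.
elim: n => [|n IH].
  by rewrite big_ord_recr big_ord0 /= expr1n invr1 add0r.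
rewrite big_ord_recr /= (le_trans _ IH)// -addrA lerD2l.
have a0 : 0 < n.+1%:R :> R by rewrite ltr0n.
rewrite -[n.+2%:R]natr1; set a := n.+1%:R in a0 *.
have a1 : 0 < a + 1 by rewrite addr_gt0.
rewrite -subr_ge0.
have -> : a^-1 - (((a + 1) ^+ 2)^-1 + (a + 1)^-1) = (a * (a + 1) ^+ 2)^-1.
  by field; rewrite !gt_eqF.
by rewrite invr_ge0 mulr_ge0 ?exprn_ge0 ?(ltW a0) ?(ltW a1).
Qed.

Lemma sum_inv_sqr_conv_le n :
  \sum_(i < n.+1) ((i.+1%:R * (n - i).+1%:R) ^+ 2)^-1 <= 8 / n.+2%:R ^+ 2 :> R.
Proof.
have n20 : 0 < n.+2%:R :> R by rewrite ltr0n.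
apply: (@le_trans _ _ (\sum_(i < n.+1) 2 / n.+2%:R ^+ 2 *
    ((i.+1%:R ^+ 2)^-1 + ((n - i).+1%:R ^+ 2)^-1))).
  apply: ler_sum => i _; have in' : (i <= n)%N by rewrite -ltnS.
  have a0 : 0 < i.+1%:R :> R by rewrite ltr0n.
  have b0 : 0 < (n - i).+1%:R :> R by rewrite ltr0n.
  have -> : n.+2%:R = i.+1%:R + (n - i).+1%:R :> R by rewrite -natrD; congr _%:R; lia.
  set a := i.+1%:R in a0 *; set b := (n - i).+1%:R in b0 *.
  have ab0 : 0 < a + b by rewrite addr_gt0.
  rewrite -subr_ge0.
  have -> : 2 / (a + b) ^+ 2 * ((a ^+ 2)^-1 + (b ^+ 2)^-1) - ((a * b) ^+ 2)^-1 =
    ((a - b) / (a * b * (a + b))) ^+ 2.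
    by field; rewrite !gt_eqF.
  exact: sqr_ge0.
rewrite -mulr_sumr (_ : 8 / _ = 2 / n.+2%:R ^+ 2 * 4); last by field; rewrite gt_eqF.
rewrite ler_wpM2l ?divr_ge0 ?exprn_ge0// big_split /=.
have := sum_inv_sqr_le n.+1.
have -> : \sum_(i < n.+1) ((n - i).+1%:R ^+ 2)^-1 = \sum_(i < n.+1) (i.+1%:R ^+ 2)^-1 :> R.
  by rewrite (reindex_inj rev_ord_inj); apply: eq_bigr => i _ /=; rewrite subSS subKn// -ltnS.
lra.
Qed.

(** A recursion of Catalan type; the induction carries the extra factor
    [(l + 1) ^ -2] because inverse squares are stable under convolution. *)
Lemma state_even_growth : exists2 B : R, 0 < B & forall l, m_ (2 * l) <= B ^+ l.
Proof.
pose B := 8 * (C + 2) / c.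
have C2 : 0 < C + 2 by rewrite ltr_wpDl.
have B0 : 0 < B by rewrite divr_gt0// mulr_gt0.
exists B => // l.
suff : m_ (2 * l) <= B ^+ l / l.+1%:R ^+ 2.
  move/le_trans; apply; rewrite ler_piMr ?exprn_ge0 ?(ltW B0)//.
  by rewrite invf_le1 ?exprn_gt0 ?ltr0n// exprn_ege1// ler1n.
elim/ltn_ind: l => [[|l]] IH.
  by rewrite muln0 expr0 expr1n divr1 state_power0.
rewrite -(ler_pM2l c0) (le_trans (state_even_rec l))//.
apply: (@le_trans _ _ ((C + 2) * (B ^+ l * (8 / l.+2%:R ^+ 2)))); last first.
  rewrite le_eqVlt; apply/orP; left; apply/eqP.
  rewrite [B ^+ l.+1]exprS; move: (B ^+ l) (l.+2%:R ^+ 2 : R) => y w; rewrite /B.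
  have [->|w0] := eqVneq w 0; first by rewrite invr0; ring.
  by field; rewrite w0 gt_eqF.
rewrite ler_wpM2l ?addr_ge0//.
apply: le_trans (ler_wpM2l (exprn_ge0 l (ltW B0)) (sum_inv_sqr_conv_le l)).
rewrite mulr_sumr; apply: ler_sum => i _.
have il : (i <= l)%N by rewrite -ltnS.
apply: (@le_trans _ _ (B ^+ i / i.+1%:R ^+ 2 * (B ^+ (l - i) / (l - i).+1%:R ^+ 2))).
  by apply: ler_pM; rewrite ?state_even_ge0//; apply: IH; lia.
rewrite mulrACA -exprD subnKC// -invfM -exprMn//.
Qed.

(** A function that vanishes on [[- b, b]] and is [O(x ^ (2 L))] is at most
    [(x / b) ^ (2 l)] times a fixed polynomial, for every [l]; geometric growth of the
    moments with ratio below [b ^ 2] then sends its mean to [0]. *)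
Lemma state_support : exists2 b : R, 0 < b & forall f (e : R), poly_growth f ->
  (forall x, `|x| <= b -> `|f x| <= e) -> `|Lam f| <= e.
Proof.
have [B B0 mB] := state_even_growth.
pose b := B + 1; have b0 : 0 < b by rewrite addr_gt0.
have pp := @poly_growth_power R.
have vanish g : poly_growth g -> (forall x, 0 <= g x) -> (forall x, `|x| <= b -> g x = 0) ->
    Lam g <= 0.
  move=> pg g0 gb; have [D [L [D0 gD]]] := pg.
  pose r := B / b ^+ 2.
  have r01 : 0 <= r < 1.
    rewrite divr_ge0 ?exprn_ge0 ?(ltW B0) ?(ltW b0)//= ltr_pdivrMr ?exprn_gt0// mul1r /b expr2.
    by have := mulr_gt0 B0 B0; lra.
  have gl l : Lam g <= D * (1 + B ^+ L) * r ^+ l.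
    have h x : g x <= D / b ^+ (2 * l) * (x ^+ (2 * l) + x ^+ (2 * (l + L))).
      have [xb|bx] := leP `|x| b.
        rewrite gb// mulr_ge0 ?divr_ge0 ?exprn_ge0 ?(ltW b0)//.
        by rewrite addr_ge0// even_power_ge0.
      have := gD x; rewrite ger0_norm// => /le_trans; apply.
      rewrite -mulrA ler_wpM2l// mulnDr exprD -[X in X + _ * _]mulr1 -mulrDr mulrA.
      rewrite ler_peMl// ?addr_ge0 ?even_power_ge0// mulrC ler_pdivlMr ?exprn_gt0// mul1r.
      rewrite !exprM lerXn2r ?nnegrE ?sqr_ge0// -(real_normK (num_real x)).
      by rewrite lerXn2r ?nnegrE// ltW.
    have := Lam_le pg (poly_growthZ _ (poly_growthD (pp _) (pp _))) h.
    rewrite LamZ; last exact: poly_growthD.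
    rewrite LamD// => /le_trans; apply.
    have -> : D * (1 + B ^+ L) * r ^+ l = D / b ^+ (2 * l) * (B ^+ l + B ^+ (l + L)).
      by rewrite /r exprMn exprVn -exprM exprD; ring.
    by rewrite ler_wpM2l ?divr_ge0 ?exprn_ge0 ?(ltW b0)// lerD.
  have rl : (fun l => D * (1 + B ^+ L) * r ^+ l) @ \oo --> D * (1 + B ^+ L) * 0.
    apply: cvgM; first exact: cvg_cst.
    by apply: cvg_expr; rewrite ger0_norm; case/andP: r01.
  rewrite mulr0 in rl; apply: (ler_cvg_to (cvg_cst (Lam g)) rl).
  exact: nearW.
exists b => // f e pf fe.
have e0 : 0 <= e by apply: le_trans (normr_ge0 _) (fe 0 _); rewrite normr0 ltW.
(* the excess of [f] over [e] vanishes on [[- b, b]] *)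
pose g x : R := Num.max (`|f x| - e) 0.
have pg : poly_growth g.
  apply: (poly_growth_le pf) => x; rewrite /g; case: (leP (`|f x| - e) 0) => h.
    by rewrite normr0.
  by rewrite (ger0_norm (ltW h)); lra.
have g0 x : 0 <= g x by rewrite /g le_max lexx orbT.
have gb x : `|x| <= b -> g x = 0.
  by move=> /fe h; rewrite /g; apply/max_idPr; lra.
have fg x : `|f x| <= e + g x by rewrite /g; case: (leP (`|f x| - e) 0) => h; lra.
have h := vanish g pg g0 gb.
have peg : poly_growth (fun x => e + g x) by apply: poly_growthD => //; exact: poly_growth_cst.
have E : Lam (fun x => e + g x) = e + Lam g.
  by rewrite LamD ?state_cst//; exact: poly_growth_cst.
rewrite ler_norml; apply/andP; split.
  rewrite lerNl -stateN//.
  apply: (@le_trans _ _ (Lam (fun x => e + g x))); last by rewrite E; lra.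
  apply: Lam_le => // [|x]; first exact: poly_growthN.
  by have := fg x; rewrite ler_norml; lra.
apply: (@le_trans _ _ (Lam (fun x => e + g x))); last by rewrite E; lra.
by apply: Lam_le => // x; have := fg x; rewrite ler_norml; lra.
Qed.

End StateTheory.

(** * The resolvent equation *)

Section PrimitivePoly.
Context {R : realType}.

Definition primitive_poly (q : {poly R}) : {poly R} :=
  \sum_(i < size q) (q`_i / i.+1%:R) *: 'X^(i.+1).

Lemma deriv_primitive_poly q : (primitive_poly q)^`() = q.
Proof.
rewrite /primitive_poly raddf_sum -[RHS]coefK poly_def; apply: eq_bigr => i _.
by rewrite /= derivZ derivXn /= -scalerMnr scalerMnl -[_ *+ _]mulr_natr divfK// pnatr_eq0.
Qed.

Lemma primitive_poly0 q : (primitive_poly q).[0] = 0.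
Proof.
rewrite /primitive_poly horner_sum big1// => i _.
by rewrite hornerZ hornerXn expr0n mulr0.
Qed.

End PrimitivePoly.

Section DiffQuot.
Variable K : comPzRingType.

(** Both the diagonal value and the off-diagonal values of the difference quotient of
    a polynomial are read off this double sum. *)
Lemma sum_diff_quot n (c : nat -> K) (x y : K) :
  (x - y) * \sum_(i < n) \sum_(l < i) c i * x ^+ l * y ^+ (i.-1 - l) =
  \sum_(i < n) c i * x ^+ i - \sum_(i < n) c i * y ^+ i.
Proof.
rewrite -sumrB mulr_sumr; apply: eq_bigr => i _.
rewrite -mulrBr subrXX mulrCA; congr (_ * _); rewrite mulr_sumr.
rewrite (reindex_inj rev_ord_inj) /=; apply: eq_bigr => l _.
have il := ltn_ord l; rewrite mulrA; congr (_ * _ ^+ _ * _ ^+ _); lia.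
Qed.

End DiffQuot.

Lemma poly_diff_quot {R : realType} (p : {poly R}) (x y : R) :
  (x - y) * \sum_(i < size p) \sum_(l < i) p`_i * x ^+ l * y ^+ (i.-1 - l) = p.[x] - p.[y].
Proof. by rewrite sum_diff_quot !horner_coef. Qed.

Lemma poly_diff_quot_diag {R : realType} (p : {poly R}) (x : R) :
  \sum_(i < size p) \sum_(l < i) p`_i * x ^+ l * x ^+ (i.-1 - l) = p^`().[x].
Proof.
rewrite -[in RHS](coefK p) poly_def raddf_sum horner_sum; apply: eq_bigr => i _.
rewrite /= derivZ derivXn hornerZ hornerMn hornerXn.
rewrite (eq_bigr (fun=> p`_i * x ^+ i.-1)) => [|l _].
  by rewrite sumr_const card_ord mulrnAr.
by have := ltn_ord l => il; rewrite -mulrA -exprD subnKC//; lia.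
Qed.

Section TestFunctions.
Context {R : realType}.
Variables (V : {poly R}) (Lam : (R -> R) -> R).
Hypothesis HL : loop_state V Lam.
Variable b : R.
Hypotheses (b0 : 0 < b) (supp : forall f (e : R), poly_growth f ->
  (forall x, `|x| <= b -> `|f x| <= e) -> `|Lam f| <= e).
Local Notation m_ j := (Lam (fun x => x ^+ j)).

(** The functional applied in each of two variables to a finite sum of products is
    bounded by the sup of that kernel on the square. *)
Lemma state_kernel_bound (I : Type) (r : seq I) (u v : I -> R -> R) (e : R) :
  (forall i, poly_growth (u i)) -> (forall i, poly_growth (v i)) ->
  (forall x y, `|x| <= b -> `|y| <= b -> `|\sum_(i <- r) u i x * v i y| <= e) ->
  `|\sum_(i <- r) Lam (u i) * Lam (v i)| <= e.
Proof.
move=> pu pv h.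
have E1 y : Lam (fun x => \sum_(i <- r) v i y * u i x) = \sum_(i <- r) v i y * Lam (u i).
  rewrite (state_sum HL); last by move=> i; exact: poly_growthZ.
  by apply: eq_bigr => i _; rewrite (stateZ HL).
have E2 : Lam (fun y => \sum_(i <- r) Lam (u i) * v i y) = \sum_(i <- r) Lam (u i) * Lam (v i).
  rewrite (state_sum HL); last by move=> i; exact: poly_growthZ.
  by apply: eq_bigr => i _; rewrite (stateZ HL).
rewrite -E2; apply: supp => [|y yb]; first by apply: poly_growth_sum => i; exact: poly_growthZ.
under eq_bigr do rewrite mulrC; rewrite -E1.
apply: supp => [|x xb]; first by apply: poly_growth_sum => i; exact: poly_growthZ.
by under eq_bigr do rewrite mulrC; exact: h.
Qed.

Definition loop_rhs (p : {poly R}) : R :=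
  \sum_(i < size p) \sum_(l < i) p`_i * m_ l * m_ (i.-1 - l).

Lemma state_loop_poly (p : {poly R}) : Lam (horner (V^`() * p)) = loop_rhs p.
Proof.
have -> : horner (V^`() * p) =
    (fun x => \sum_(i < size p) p`_i * (V^`() * 'X^i).[x]).
  apply/funext => x; rewrite hornerM (horner_coef p) mulr_sumr.
  by apply: eq_bigr => i _; rewrite hornerM hornerXn mulrCA.
rewrite (state_sum HL); last by move=> i; apply: poly_growthZ; exact: poly_growth_poly.
apply: eq_bigr => i _; rewrite (stateZ HL); last exact: poly_growth_poly.
rewrite (state_loop HL) mulr_sumr; apply: eq_bigr => l _.
by rewrite mulrA.
Qed.

(** Polynomials are dense in [C^1] on the support, and the difference quotient of
    [f - P] is bounded there by the sup of its derivative; so the loop equation passes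
    from polynomials to every [C^1] function whose difference quotient is a finite sum
    of products. *)
Lemma state_loop_C1 (f f' : R -> R) (I : finType) (u v : I -> R -> R) :
  poly_growth f -> (forall x, is_derive x (1:R) f (f' x)) -> continuous f' ->
  (forall i, poly_growth (u i)) -> (forall i, poly_growth (v i)) ->
  (forall x y, (x - y) * (\sum_i u i x * v i y) = f x - f y) ->
  (forall x, \sum_i u i x * v i x = f' x) ->
  Lam (fun x => V^`().[x] * f x) = \sum_i Lam (u i) * Lam (v i).
Proof.
move=> pf df cf' pu pv uvq uvd.
have [A A0] : exists2 A : R, 0 <= A & forall x, `|x| <= b -> `|V^`().[x]| <= A.
  have cV : continuous (horner V^`() : R -> R) by exact: continuous_horner.
  have [A hA] := continuous_bounded_itv b cV; exists A => //.
  by apply: le_trans (normr_ge0 _) (hA 0 _); rewrite normr0 ltW.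
move=> hA.
suff key e : 0 < e -> `|Lam (fun x => V^`().[x] * f x) - \sum_i Lam (u i) * Lam (v i)| <= (A * b + 1) * e.
  have Ab : 0 < A * b + 1 by rewrite ltr_wpDl// mulr_ge0// ltW.
  apply/eqP; rewrite -subr_eq0 -normr_le0; apply/ler_addgt0Pl => e e0; rewrite addr0.
  by have := key _ (divr_gt0 e0 Ab); rewrite mulrC divfK// gt_eqF.
move=> e0; have [q qf'] := weierstrass b cf' e0.
pose P : {poly R} := primitive_poly q + (f 0)%:P.
have P' : P^`() = q by rewrite /P derivD derivC addr0 deriv_primitive_poly.
have P0 : P.[0] = f 0 by rewrite /P hornerD hornerC primitive_poly0 add0r.
have lip x y : `|x| <= b -> `|y| <= b -> `|(f x - P.[x]) - (f y - P.[y])| <= e * `|x - y|.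
  wlog xy : x y / y <= x.
    move=> W xb yb; have [yx|xy] := leP y x; first exact: W.
    by rewrite distrC [`|x - y|]distrC; apply: W => //; exact: ltW.
  move=> xb yb.
  have dg z : is_derive z (1:R) (fun z => f z - P.[z]) (f' z - q.[z]).
    by have hP := is_derive_poly P z; rewrite P' in hP; exact: (is_deriveB (df z) hP).
  have cg : {within `[y, x], continuous (fun z => f z - P.[z])}.
    apply: continuous_subspaceT => z.
    by apply: differentiable_continuous; apply/derivable1_diffP; have [] := dg z.
  have [z zxy ->] := MVT_segment xy (fun z _ => dg z) cg.
  rewrite normrM ler_wpM2r//; apply: qf'.
  move: zxy xb yb; rewrite in_itv /= !ler_norml => /andP[? ?] /andP[? ?] /andP[? ?].
  by apply/andP; split; lra.
have fP x : `|x| <= b -> `|f x - P.[x]| <= b * e.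
  move=> xb; have := lip x 0 xb; rewrite normr0 P0 subrr !subr0 (ltW b0) => /(_ isT).
  by move=> /le_trans; apply; rewrite mulrC ler_wpM2r// ltW.
have pV : poly_growth (horner V^`()) by exact: poly_growth_poly.
have pP : poly_growth (horner P) by exact: poly_growth_poly.
have -> : Lam (fun x => V^`().[x] * f x) - \sum_i Lam (u i) * Lam (v i) =
    (Lam (fun x => V^`().[x] * (f x - P.[x]))) - (\sum_i Lam (u i) * Lam (v i) - loop_rhs P).
  rewrite -state_loop_poly (_ : Lam (fun x => V^`().[x] * (f x - P.[x])) =
     Lam (fun x => V^`().[x] * f x) - Lam (horner (V^`() * P))); first by ring.
  rewrite -(stateB HL); [|exact: poly_growthM|exact: poly_growth_poly].
  by congr Lam; apply/funext => x; rewrite hornerM mulrBr.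
rewrite (le_trans (ler_normB _ _))// mulrDl mul1r lerD//.
  apply: supp => [|x xb]; first by apply: poly_growthM => //; exact: poly_growthB.
  by rewrite normrM -mulrA ler_pM// ?hA// fP.
(* the products of [f] and those of [P], as one family *)
pose J := (I + {i : 'I_(size P) & 'I_i})%type.
pose U (j : J) : R -> R := match j with
  | inl i => u i | inr s => fun x => - P`_(tag s) * x ^+ (tagged s) end.
pose W (j : J) : R -> R := match j with
  | inl i => v i | inr s => fun y => y ^+ ((tag s).-1 - tagged s) end.
have sumJ (F : J -> R) : \sum_j F j = \sum_i F (inl i) +
    \sum_(i < size P) \sum_(l < i) F (inr (Tagged (fun i : 'I_(size P) => 'I_i) l)).
  rewrite big_sumType /=; congr (_ + _).
  by rewrite sig_big_dep /=; apply: eq_bigr => -[].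
have pp := @poly_growth_power R.
have pU j : poly_growth (U j) by case: j => [i|s] //=; exact: poly_growthZ.
have pW j : poly_growth (W j) by case: j => [i|s] //=.
have -> : \sum_i Lam (u i) * Lam (v i) - loop_rhs P = \sum_j Lam (U j) * Lam (W j).
  rewrite sumJ /=; congr (_ + _); rewrite -sumrN; apply: eq_bigr => i _.
  rewrite -sumrN; apply: eq_bigr => l _.
  by rewrite (stateZ HL)// !mulNr.
apply: state_kernel_bound => // x y xb yb.
have E : \sum_j U j x * W j y = \sum_i u i x * v i y -
    \sum_(i < size P) \sum_(l < i) P`_i * x ^+ l * y ^+ (i.-1 - l).
  rewrite sumJ /=; congr (_ + _); rewrite -sumrN; apply: eq_bigr => i _.
  by rewrite -sumrN; apply: eq_bigr => l _; rewrite !mulNr.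
rewrite E; have [<-|xy] := eqVneq x y.
  by rewrite uvd poly_diff_quot_diag P'; exact: qf'.
have xy0 : 0 < `|x - y| by rewrite normr_gt0 subr_eq0.
rewrite -(ler_pM2l xy0) -normrM mulrBr uvq poly_diff_quot.
have := lip x y xb yb; rewrite [e * _]mulrC.
by rewrite (_ : f x - P.[x] - (f y - P.[y]) = f x - f y - (P.[x] - P.[y]))//; ring.
Qed.

End TestFunctions.

Section Resolvent.
Context {R : realType}.
Local Notation C := R[i].

Definition cpoly (p : {poly R}) : {poly C} := map_poly (real_complex R) p.

Definition cpoly_growth (F : R -> C) :=
  poly_growth (fun x => complex.Re (F x)) /\ poly_growth (fun x => complex.Im (F x)).

Definition resolvent (z : C) (y : R) : C := (z - y%:C%C)^-1.

Variables (V : {poly R}) (Lam : (R -> R) -> R).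
Hypothesis HL : loop_state V Lam.
Variable b : R.
Hypotheses (b0 : 0 < b) (supp : forall f (e : R), poly_growth f ->
  (forall x, `|x| <= b -> `|f x| <= e) -> `|Lam f| <= e).
Local Notation m_ j := (Lam (fun x => x ^+ j)).

Definition Lamc (F : R -> C) : C :=
  Complex (Lam (fun x => complex.Re (F x))) (Lam (fun x => complex.Im (F x))).

Lemma LamcD F G : cpoly_growth F -> cpoly_growth G -> Lamc (fun x => F x + G x) = Lamc F + Lamc G.
Proof.
move=> [F1 F2] [G1 G2]; apply: complexP; rewrite /= -(stateD HL)//; congr Lam;
  by apply/funext => x; rewrite ?cReD ?cImD.
Qed.

Lemma cpoly_growthM F G : cpoly_growth F -> cpoly_growth G -> cpoly_growth (fun x => F x * G x).
Proof.
move=> [F1 F2] [G1 G2]; split.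
  by under eq_fun do rewrite cReM; apply: poly_growthB; exact: poly_growthM.
by under eq_fun do rewrite cImM; apply: poly_growthD; exact: poly_growthM.
Qed.

Lemma cpoly_growth_cst a : cpoly_growth (fun=> a).
Proof. by split; exact: poly_growth_cst. Qed.

Lemma cpoly_growthZ a F : cpoly_growth F -> cpoly_growth (fun x => a * F x).
Proof. by apply: cpoly_growthM; exact: cpoly_growth_cst. Qed.

Lemma cpoly_growthD F G : cpoly_growth F -> cpoly_growth G -> cpoly_growth (fun x => F x + G x).
Proof.
move=> [F1 F2] [G1 G2]; split.
  by under eq_fun do rewrite cReD; exact: poly_growthD.
by under eq_fun do rewrite cImD; exact: poly_growthD.
Qed.

Lemma LamcZ a F : cpoly_growth F -> Lamc (fun x => a * F x) = a * Lamc F.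
Proof.
move=> [F1 F2]; apply: complexP; rewrite ?cReM ?cImM /=.
  rewrite -!(stateZ HL)// -(stateB HL); [|exact: poly_growthZ|exact: poly_growthZ].
  by congr Lam; apply/funext => x; rewrite cReM.
rewrite -!(stateZ HL)// -(stateD HL); [|exact: poly_growthZ|exact: poly_growthZ].
by congr Lam; apply/funext => x; rewrite cImM.
Qed.

Lemma Lamc_real f : poly_growth f -> Lamc (fun x => (f x)%:C%C) = (Lam f)%:C%C.
Proof. by move=> pf; apply: complexP => //=; exact: state_cst HL 0. Qed.

Lemma Lamc_sum (I : Type) (r : seq I) (F : I -> R -> C) :
  (forall i, cpoly_growth (F i)) -> Lamc (fun x => \sum_(i <- r) F i x) = \sum_(i <- r) Lamc (F i).
Proof.
move=> pF.
have ps r' : cpoly_growth (fun x => \sum_(i <- r') F i x).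
  elim: r' => [|i r' IH]; first by under eq_fun do rewrite big_nil; exact: cpoly_growth_cst.
  by under eq_fun do rewrite big_cons; exact: cpoly_growthD.
elim: r => [|i r IH].
  rewrite big_nil -[RHS](mul0r (Lamc (fun=> 0))) -LamcZ; last exact: cpoly_growth_cst.
  by congr Lamc; apply/funext => x; rewrite big_nil mul0r.
rewrite big_cons -IH -LamcD//; congr Lamc; apply/funext => x.
by rewrite big_cons.
Qed.

Section Point.
Variables (x eta : R).
Hypothesis eta0 : 0 < eta.
Let z : C := Complex x eta.

Let den y := (x - y) ^+ 2 + eta ^+ 2.
Definition res_re y := (x - y) / den y.
Definition res_im y := - eta / den y.

Let den_gt0 y : 0 < den y.
Proof. by rewrite ltr_wpDl ?sqr_ge0// exprn_gt0. Qed.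

Lemma resolventE y : resolvent z y = Complex (res_re y) (res_im y).
Proof.
have d0 := den_gt0 y; rewrite /resolvent.
have nz : z - y%:C%C != 0.
  by rewrite eq_complex /= negb_and subr0 (gt_eqF eta0) orbT.
apply: (mulfI nz); rewrite mulfV//; apply: complexP; rewrite ?cReM ?cImM /= /res_re /res_im.
  by rewrite subr0 /den; rewrite /den in d0; field; rewrite gt_eqF.
by rewrite subr0 /den; rewrite /den in d0; field; rewrite gt_eqF.
Qed.

Lemma res_bounds y : `|res_re y| <= eta^-1 /\ `|res_im y| <= eta^-1.
Proof.
have d0 := den_gt0 y; have h := sqr_ge0 (`|x - y| - eta / 2).
rewrite /res_re /res_im !normrM normfV (gtr0_norm d0) normrN (gtr0_norm eta0).
have hn := real_normK (num_real (x - y)).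
split; rewrite ler_pdivrMr// mulrC ler_pdivlMr// /den; move: h; rewrite sqrrB hn;
  have := sqr_ge0 (x - y); have := normr_ge0 (x - y); nra.
Qed.

Lemma pb_res_re : poly_growth res_re.
Proof. by apply: (@poly_growth_bounded _ _ eta^-1) => y; have [] := res_bounds y. Qed.
Lemma pb_res_im : poly_growth res_im.
Proof. by apply: (@poly_growth_bounded _ _ eta^-1) => y; have [] := res_bounds y. Qed.

Lemma cpoly_growth_resolvent : cpoly_growth (resolvent z).
Proof.
split; under eq_fun do rewrite resolventE.
  exact: pb_res_re.
exact: pb_res_im.
Qed.

Let is_derive_den y : is_derive y (1:R) den (- 2 * (x - y)).
Proof.
rewrite /den; apply: is_derive_eq.
rewrite /= -![_ *: _]/(_ * _); ring.
Qed.

Let is_derive_res_re y : is_derive y (1:R) res_re (res_re y ^+ 2 - res_im y ^+ 2).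
Proof.
have d0 := den_gt0 y.
have h1 : is_derive y (1:R) (fun y => (den y)^-1) (- (den y) ^- 2 * (- 2 * (x - y))).
  exact: (is_deriveV (lt0r_neq0 d0) (is_derive_den y)).
have h2 : is_derive y (1:R) (fun y => x - y) (-1).
  exact: (is_derive_eq (is_deriveB (is_derive_cst x y 1) (is_derive_id y 1)) (sub0r 1)).
have E : (x - y) *: (- den y ^- 2 * (-2 * (x - y))) + (den y)^-1 *: -1 =
    res_re y ^+ 2 - res_im y ^+ 2.
  by rewrite -![_ *: _]/(_ * _) /res_re /res_im /den; rewrite /den in d0; field; rewrite gt_eqF.
by rewrite -E; exact: (is_deriveM h2 h1).
Qed.

Let is_derive_res_im y : is_derive y (1:R) res_im (2 * (res_re y * res_im y)).
Proof.
have d0 := den_gt0 y.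
have h1 : is_derive y (1:R) (fun y => (den y)^-1) (- (den y) ^- 2 * (- 2 * (x - y))).
  exact: (is_deriveV (lt0r_neq0 d0) (is_derive_den y)).
have h2 : is_derive y (1:R) (fun=> - eta) 0 by exact: is_derive_cst.
have E : - eta *: (- den y ^- 2 * (-2 * (x - y))) + (den y)^-1 *: 0 =
    2 * (res_re y * res_im y).
  by rewrite -![_ *: _]/(_ * _) /res_re /res_im /den; rewrite /den in d0; field; rewrite gt_eqF.
by rewrite -E; exact: (is_deriveM h2 h1).
Qed.

Let cont_re : continuous res_re.
Proof.
move=> y; apply: differentiable_continuous; apply/derivable1_diffP.
by have [] := is_derive_res_re y.
Qed.
Let cont_im : continuous res_im.
Proof.
move=> y; apply: differentiable_continuous; apply/derivable1_diffP.
by have [] := is_derive_res_im y.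
Qed.

(** The resolvent has difference quotient [resolvent x * resolvent y]; this is the
    real part of that identity. *)
Lemma state_loop_res_re : Lam (fun y => V^`().[y] * res_re y) =
  Lam res_re ^+ 2 - Lam res_im ^+ 2.
Proof.
have p1 := pb_res_re; have p2 := pb_res_im.
pose u (i : bool) := if i then res_re else (fun y => - res_im y).
pose v (i : bool) := if i then res_re else res_im.
have -> : Lam res_re ^+ 2 - Lam res_im ^+ 2 = \sum_i Lam (u i) * Lam (v i).
  rewrite (bigD1 true)//= (bigD1 false)//= big1 ?addr0; last by case.
  by rewrite (stateN HL)// mulNr !expr2.
apply: (@state_loop_C1 _ _ _ HL b b0 supp res_re
  (fun y => res_re y ^+ 2 - res_im y ^+ 2) bool u v) => //.
- rewrite (_ : (fun y => _) = (fun y => res_re y * res_re y - res_im y * res_im y)) => [y|]; last by apply/funext.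
  apply: cvgB; apply: cvgM; exact: cont_re || exact: cont_im.
- by case => //=; exact: poly_growthN.
- by case.
- move=> y y'; rewrite (bigD1 true)//= (bigD1 false)//= big1 ?addr0; last by case.
  have d0 := den_gt0 y; have d1 := den_gt0 y'; rewrite /res_re /res_im.
  by rewrite /den in d0 d1 *; field; rewrite !gt_eqF.
- move=> y; rewrite (bigD1 true)//= (bigD1 false)//= big1 ?addr0; last by case.
  by rewrite mulNr !expr2.
Qed.

Lemma state_loop_res_im : Lam (fun y => V^`().[y] * res_im y) =
  2 * (Lam res_re * Lam res_im).
Proof.
have p1 := pb_res_re; have p2 := pb_res_im.
pose u (i : bool) := if i then res_re else res_im.
pose v (i : bool) := if i then res_im else res_re.
have -> : 2 * (Lam res_re * Lam res_im) = \sum_i Lam (u i) * Lam (v i).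
  rewrite (bigD1 true)//= (bigD1 false)//= big1 ?addr0; last by case.
  by rewrite /=; ring.
apply: (@state_loop_C1 _ _ _ HL b b0 supp res_im
  (fun y => 2 * (res_re y * res_im y)) bool u v) => //.
- move=> y; apply: cvgM; first exact: cvg_cst.
  by apply: cvgM; [exact: cont_re|exact: cont_im].
- by case.
- by case.
- move=> y y'; rewrite (bigD1 true)//= (bigD1 false)//= big1 ?addr0; last by case.
  have d0 := den_gt0 y; have d1 := den_gt0 y'; rewrite /res_re /res_im.
  by rewrite /den in d0 d1 *; field; rewrite !gt_eqF.
- move=> y; rewrite (bigD1 true)//= (bigD1 false)//= big1 ?addr0; last by case.
  by ring.
Qed.

Definition stieltjes (z : C) : C := Lamc (resolvent z).

Lemma stieltjesE : stieltjes z = Complex (Lam res_re) (Lam res_im).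
Proof.
rewrite /stieltjes; congr Complex; congr Lam; apply/funext => y;
  by rewrite resolventE.
Qed.

(** The difference quotient of [V'], with the second variable averaged out. *)
Definition quot_poly : {poly R} :=
  \sum_(i < size V^`()) \sum_(l < i) (V^`()`_i * m_ (i.-1 - l)) *: 'X^l.

Definition discr_poly : {poly R} := V^`() ^+ 2 - 4 *: quot_poly.

(** The loop equation of the resolvent, after writing
    [V'(y) / (z - y) = V'(z) / (z - y) - (V'(z) - V'(y)) / (z - y)]. *)
Lemma stieltjes_loop :
  stieltjes z ^+ 2 = (cpoly V^`()).[z] * stieltjes z - (cpoly quot_poly).[z].
Proof.
have pz := cpoly_growth_resolvent; have pp := @poly_growth_power R.
have pV : cpoly_growth (fun y => (V^`().[y])%:C%C).
  by split; [exact: poly_growth_poly|exact: poly_growth_cst].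
have -> : stieltjes z ^+ 2 = Lamc (fun y => (V^`().[y])%:C%C * resolvent z y).
  rewrite stieltjesE (_ : (fun y => _) =
      fun y => Complex (V^`().[y] * res_re y) (V^`().[y] * res_im y)); last first.
    by apply/funext => y; rewrite resolventE; apply: complexP; rewrite ?cReM ?cImM /=; ring.
  apply: complexP; rewrite expr2 ?cReM ?cImM.
    rewrite [RHS]state_loop_res_re !expr2; exact: erefl.
  rewrite [RHS]state_loop_res_im.
  set A := Lam res_re; set B := Lam res_im; change (A * B + B * A = 2 * (A * B)); ring.
pose g y : C := \sum_(i < size V^`()) \sum_(l < i)
   ((V^`()`_i)%:C%C * z ^+ l) * (y ^+ (i.-1 - l))%:C%C.
have pt (i : nat) (l : nat) (a : C) : cpoly_growth (fun y => a * (y ^+ (i.-1 - l))%:C%C).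
  by apply: cpoly_growthZ; split; [exact: pp|exact: poly_growth_cst].
have ps (I : Type) (r : seq I) (F : I -> R -> C) : (forall i, cpoly_growth (F i)) ->
    cpoly_growth (fun x => \sum_(i <- r) F i x).
  move=> pF; elim: r => [|i r IH]; first by under eq_fun do rewrite big_nil; exact: cpoly_growth_cst.
  by under eq_fun do rewrite big_cons; exact: cpoly_growthD.
have pg : cpoly_growth g by apply: (ps) => i; apply: (ps) => l; exact: pt.
have gE : Lamc g = (cpoly quot_poly).[z].
  rewrite /g Lamc_sum; last by move=> i; apply: (ps) => l; exact: pt.
  rewrite /cpoly /quot_poly rmorph_sum horner_sum; apply: eq_bigr => i _.
  rewrite Lamc_sum; last by move=> l; exact: pt.
  rewrite rmorph_sum horner_sum; apply: eq_bigr => l _.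
  rewrite LamcZ; last by split; [exact: pp|exact: poly_growth_cst].
  rewrite Lamc_real// -[RHS]/((cpoly ((V^`()`_i * m_ (i.-1 - l)) *: 'X^l)).[z]).
  by rewrite /cpoly map_polyZ map_polyXn hornerZ hornerXn rmorphM mulrAC.
rewrite -gE -mulN1r -!LamcZ// -LamcD; last 2 first.
- exact: cpoly_growthZ.
- exact: cpoly_growthZ.
congr Lamc; apply/funext => y.
have nz : z - y%:C%C != 0.
  by rewrite eq_complex /= negb_and subr0 (gt_eqF eta0) orbT.
apply: (mulIf nz); rewrite /resolvent mulrDl -!mulrA mulVf// !mulr1 mulN1r [g y * _]mulrC.
suff -> : (z - y%:C%C) * g y = (cpoly V^`()).[z] - (V^`().[y])%:C%C by ring.
have -> : (V^`().[y])%:C%C = \sum_(i < size V^`()) (V^`()`_i)%:C%C * y%:C%C ^+ i.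
  rewrite horner_coef rmorph_sum; apply: eq_bigr => i _.
  by rewrite rmorphM rmorphXn.
have -> : (cpoly V^`()).[z] = \sum_(i < size V^`()) (V^`()`_i)%:C%C * z ^+ i.
  rewrite horner_coef size_map_poly; apply: eq_bigr => i _.
  by rewrite coef_map.
rewrite -(sum_diff_quot _ (fun i => (V^`()`_i)%:C%C)); congr (_ * _).
apply: eq_bigr => i _; apply: eq_bigr => l _.
by rewrite rmorphXn.
Qed.

Definition discr_root (z : C) : C := (cpoly V^`()).[z] - 2 * stieltjes z.

(** Completing the square in [stieltjes_loop]. *)
Lemma discr_root_sqr : discr_root z ^+ 2 = (cpoly discr_poly).[z].
Proof.
rewrite /discr_root /discr_poly /cpoly rmorphB rmorphXn /= map_polyZ.
rewrite hornerD hornerN hornerZ horner_exp sqrrB exprMn stieltjes_loop -/(cpoly _).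
rewrite rmorph_nat -[map_poly _ quot_poly]/(cpoly quot_poly); ring.
Qed.

End Point.
End Resolvent.

(** * The zeros of the discriminant *)

Section RealPolynomials.
Context {R : realType}.

Lemma poly_quadratic_lower (p : {poly R}) : odd (size p) -> (1 < size p)%N ->
  0 < lead_coef p ->
  exists c C : R, [/\ 0 < c, 0 <= C & forall x, c * x ^+ 2 - C <= p.[x]].
Proof.
move=> op p1 lp; set a := lead_coef p in lp.
have [m pm m0] : exists2 m, size p = (2 * m).+1 & (0 < m)%N.
  by exists (size p)./2; have := odd_double_half (size p); rewrite op; lia.
pose S := \sum_(i < 2 * m) `|p`_i|.
have S0 : 0 <= S by apply: sumr_ge0.
pose B := 1 + 2 * S / a.
have B0 : 0 <= 2 * S / a by rewrite divr_ge0 ?mulr_ge0 ?(ltW lp).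
have [M hM] := poly_disk_bound p B.
have M0 : 0 <= M by apply: le_trans (normr_ge0 _) (hM 0 _); rewrite normr0 addr_ge0.
have a2 : 0 < a / 2 by rewrite divr_gt0.
exists (a / 2), (M + a / 2 * B ^+ 2); split=> // [|x].
  by rewrite addr_ge0// mulr_ge0 ?sqr_ge0// ltW.
have [xB|xB] := leP `|x| B.
  have := hM _ xB; rewrite ler_norml => /andP[h _].
  suff : a / 2 * x ^+ 2 <= a / 2 * B ^+ 2 by lra.
  rewrite ler_pM2l// -(real_normK (num_real x)).
  by rewrite ler_sqr ?nnegrE// addr_ge0.
have x1 : 1 <= `|x| by rewrite (le_trans _ (ltW xB))// /B lerDl.
have pE : p.[x] = a * x ^+ (2 * m) + \sum_(i < 2 * m) p`_i * x ^+ i.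
  rewrite horner_coef pm big_ord_recr /= addrC; congr (_ * _ + _).
  by rewrite /a lead_coefE pm.
have lo : - (S * `|x| ^+ (2 * m).-1) <= \sum_(i < 2 * m) p`_i * x ^+ i.
  rewrite lerNl.
  apply: le_trans (ler_norm _) _; rewrite normrN.
  apply: le_trans (ler_norm_sum _ _ _) _; rewrite mulr_suml.
  apply: ler_sum => i _; rewrite normrM normrX ler_wpM2l// ler_weXn2l//.
  by have := ltn_ord i; lia.
have xe : x ^+ (2 * m) = `|x| * `|x| ^+ (2 * m).-1.
  rewrite -exprS prednK; last by lia.
  by rewrite !exprM real_normK ?num_real.
have xq : x ^+ 2 <= x ^+ (2 * m).
  rewrite !exprM -(real_normK (num_real x)) -!exprM.
  by rewrite ler_weXn2l//; lia.
have Y0 : 0 < `|x| ^+ (2 * m).-1 by rewrite exprn_gt0// (lt_le_trans _ x1).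
have SB : S <= a / 2 * `|x|.
  have h : 2 * S / a <= `|x| by rewrite (le_trans _ (ltW xB))// /B lerDr.
  by move: h; rewrite ler_pdivrMr//; lra.
have MB : 0 <= M + a / 2 * B ^+ 2 by rewrite addr_ge0// mulr_ge0 ?sqr_ge0// ltW.
rewrite pE; move: lo xq; rewrite xe; move: (`|x| ^+ _) Y0 => Y Y0.
have : S * Y <= a / 2 * `|x| * Y by rewrite ler_wpM2r// ltW.
have X0 := sqr_ge0 x.
move=> h1 h2 h3; have : a / 2 * x ^+ 2 <= a / 2 * (`|x| * Y) by rewrite ler_pM2l.
by lra.
Qed.

Lemma poly_critical_min (D : {poly R}) (x y m : R) : x < m < y ->
  (forall t, x < t < y -> D.[m] <= D.[t]) -> D^`().[m] = 0.
Proof.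
move=> /andP[xm my] h.
have dD t : is_derive t (1:R) (horner D : R -> R) D^`().[t] by exact: is_derive_poly.
have h0 : is_derive m (1:R) (horner D : R -> R) 0.
  apply: (@derive1_at_min _ _ x y) => //.
  - exact: ltW (lt_trans xm my).
  - by rewrite in_itv /= xm.
by rewrite -(@derive_val _ _ _ _ _ _ _ (dD m)) (@derive_val _ _ _ _ _ _ _ h0).
Qed.

(** A minimum of [D] on the line with positive value, or a maximum of [D] on the hull
    of [D <= 0] with positive value, would be a forbidden critical point. *)
Lemma sublevel_interval (D : {poly R}) : odd (size D) -> (1 < size D)%N ->
  0 < lead_coef D -> (forall x, 0 < D.[x] -> D^`().[x] <> 0) ->
  exists a b : R, [/\ a <= b, D.[a] = 0, D.[b] = 0 & forall x, (D.[x] <= 0) = (a <= x <= b)].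
Proof.
move=> oD D1 lD crit; have [c [C [c0 C0 lo]]] := poly_quadratic_lower oD D1 lD.
have cD (x y : R) : {within `[x, y]%classic, continuous (horner D : R -> R)}.
  by apply: continuous_subspaceT; exact: continuous_horner.
have far K : exists2 B : R, 0 < B & forall x, B <= `|x| -> K < D.[x].
  pose s := 1 + (`|K| + C) / c.
  have s1 : 1 <= s by rewrite /s lerDl divr_ge0 ?addr_ge0// ltW.
  exists s; first by rewrite (lt_le_trans _ s1).
  move=> x sx; apply: lt_le_trans (lo x).
  have : s <= x ^+ 2.
    rewrite -(real_normK (num_real x)) expr2 (le_trans sx)//.
    by rewrite ler_peMl ?(le_trans s1).
  rewrite -(ler_pM2l c0) /s mulrDr mulr1 mulrCA divff ?gt_eqF// mulr1.
  by have := ler_norm K; lra.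
pose Z := [set x | D.[x] <= 0].
have Z0 : Z !=set0.
  have [[x Zx]|nZ] := pselect (exists x, Z x); first by exists x.
  have [B B0 hB] := far (D.[0]).
  have [m] := @EVT_min _ (horner D : R -> R) (- B) B (ge0_cp (ltW B0)).2 (cD _ _).
  rewrite in_itv /= => /andP[m1 m2] hm.
  have m0 : D.[m] <= D.[0] by apply: hm; rewrite in_itv /=; apply/andP; split; lra.
  have mB : `|m| < B by rewrite ltNge; apply/negP => /hB; rewrite ltNge m0.
  have Dm : 0 < D.[m] by rewrite ltNge; apply/negP => h; apply: nZ; exists m.
  exfalso; apply: (crit m Dm); apply: (@poly_critical_min D (- B) B).
    by move: mB; rewrite ltr_norml.
  by move=> t /andP[t1 t2]; apply: hm; rewrite in_itv /= !ltW.
have [B B0 hB] := far 0.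
have ZB x : Z x -> `|x| < B.
  by move=> Zx; rewrite ltNge; apply/negP => /hB; rewrite ltNge Zx.
have clZ : closed Z.
  apply: (@closed_comp _ _ (horner D : R -> R) [set y | y <= 0]).
    by move=> x _; exact: continuous_horner.
  exact: closed_le.
have cZ : compact Z.
  apply: (subclosed_compact clZ (@segment_compact _ (- B) B)) => x /ZB.
  by rewrite ltr_norml /= in_itv /= => /andP[/ltW -> /ltW ->].
have cid : {within Z, continuous (id : R -> R)} by apply: continuous_subspaceT => x; exact: cvg_id.
have [a /set_mem Za lea'] := compact_EVT_min Z0 cZ cid.
have [b /set_mem Zb geb'] := compact_EVT_max Z0 cZ cid.
have lea x : Z x -> a <= x by move=> Zx; apply: lea'; exact: mem_set.
have geb x : Z x -> x <= b by move=> Zx; apply: geb'; exact: mem_set.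
exists (a), (b); split.
- exact: lea.
- have h : (- D).[a - 1] <= 0 <= (- D).[a].
    rewrite !hornerN oppr_le0 oppr_ge0 Za andbT leNgt; apply/negP => /ltW /lea.
    by lra.
  have [|x /andP[x1 x2]] := poly_ivt _ h; first by lra.
  rewrite rootN => /rootP Dx; suff <- : x = a by [].
  by apply/eqP; rewrite eq_le x2 lea// /Z /= Dx.
- have h : D.[b] <= 0 <= D.[b + 1].
    rewrite Zb leNgt; apply/negP => /ltW /geb.
    by lra.
  have [|x /andP[x1 x2]] := poly_ivt _ h; first by lra.
  move=> /rootP Dx; suff <- : x = b by [].
  by apply/eqP; rewrite eq_le x1 andbT geb// /Z /= Dx.
- move=> x; apply/idP/andP => [Zx|[x1 x2]]; first by split; [exact: lea|exact: geb].
  rewrite leNgt; apply/negP => Dx.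
  have ab : a <= b by rewrite (le_trans x1).
  have [m] := @EVT_max _ (horner D : R -> R) _ _ ab (cD _ _).
  rewrite in_itv /= => /andP[m1 m2] hm.
  have Dm : 0 < D.[m] by apply: lt_le_trans Dx (hm x _); rewrite in_itv /= x1.
  have m3 : a < m.
    by rewrite lt_neqAle m1 andbT; apply/eqP => E; move: Dm; rewrite -E ltNge Za.
  have m4 : m < b.
    by rewrite lt_neqAle m2 andbT; apply/eqP => E; move: Dm; rewrite E ltNge Zb.
  apply: (crit m Dm); apply/eqP; rewrite -oppr_eq0 -hornerN -derivN; apply/eqP.
  apply: (@poly_critical_min (- D) (a) (b)); first by rewrite m3.
  by move=> t /andP[t1 t2]; rewrite !hornerN lerN2; apply: hm; rewrite in_itv /= !ltW.
Qed.

(** Taylor expansion in the imaginary direction, by induction on [p]: the [e ^ 2] term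
    is the first correction to the real part. *)
Lemma horner_imag (p : {poly R}) (x : R) : exists2 K : R, 0 <= K &
  forall e, 0 <= e <= 1 ->
    `|complex.Re (cpoly p).[Complex x e] - p.[x]| <= K * e ^+ 2 /\
    `|complex.Im (cpoly p).[Complex x e] - e * p^`().[x]| <= K * e ^+ 2.
Proof.
elim/poly_ind: p => [|q c [K K0 hK]].
  exists 0 => // e _; rewrite /cpoly rmorph0 deriv0 !horner0 mulr0 subr0 mul0r.
  by rewrite normr0.
exists (K * `|x| + `|q^`().[x]| + K); first by rewrite !addr_ge0// mulr_ge0.
move=> e e01; have [h1 h2] := hK e e01; case/andP: (e01) => e0 e1.
have -> : (cpoly (q * 'X + c%:P)).[Complex x e] =
    (cpoly q).[Complex x e] * Complex x e + c%:C%C.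
  by rewrite /cpoly rmorphD rmorphM /= map_polyX map_polyC hornerMXaddC.
rewrite hornerMXaddC derivD derivM derivX derivC mulr1 addr0.
rewrite hornerD hornerM hornerX cReD cImD cReM cImM /=.
move: h1 h2; set A := complex.Re _; set B := complex.Im _ => h1 h2.
split.
  rewrite (_ : _ - _ = (A - q.[x]) * x - (B - e * q^`().[x]) * e - e ^+ 2 * q^`().[x]); last by ring.
  apply: le_trans (ler_normB _ _) _; rewrite normrM normrX (ger0_norm e0).
  apply: le_trans (lerD (ler_normB _ _) (lexx _)) _; rewrite !normrM (ger0_norm e0).
  have := ler_wpM2r (normr_ge0 x) h1; have := ler_wpM2r e0 h2.
  have : K * e ^+ 2 * e <= K * e ^+ 2 by rewrite ler_piMr// mulr_ge0// sqr_ge0.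
  lra.
rewrite (_ : _ - _ = (A - q.[x]) * e + (B - e * q^`().[x]) * x); last by ring.
apply: le_trans (ler_normD _ _) _; rewrite !normrM (ger0_norm e0).
have := ler_wpM2r (normr_ge0 x) h2; have := ler_wpM2r e0 h1.
have : K * e ^+ 2 * e <= K * e ^+ 2 by rewrite ler_piMr// mulr_ge0// sqr_ge0.
have : 0 <= `|q^`().[x]| * e ^+ 2 by rewrite mulr_ge0// sqr_ge0.
lra.
Qed.

End RealPolynomials.

Section Gap.
Context {R : realType}.
Variables (V : {poly R}) (Lam : (R -> R) -> R).
Hypothesis HL : loop_state V Lam.
Variable b : R.
Hypotheses (b0 : 0 < b) (supp : forall f (e : R), poly_growth f ->
  (forall x, `|x| <= b -> `|f x| <= e) -> `|Lam f| <= e).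
Local Notation D := (discr_poly V Lam).

(** The Poisson kernel has mean at least of order [eta]; Jensen's inequality for the
    convex function [1 / d], as the tangent line bound at the mean [sg]. *)
Lemma state_res_im_lower x : exists2 c : R, 0 < c & forall eta, 0 < eta <= 1 ->
  Lam (res_im x eta) <= - (eta * c).
Proof.
pose s := ('X - x%:P) ^+ 2 + 1 : {poly R}.
have sE y : s.[y] = (x - y) ^+ 2 + 1 by rewrite /s !hornerE; ring.
have ps : poly_growth (horner s) by exact: poly_growth_poly.
have s1 : 1 <= Lam (horner s).
  rewrite -(state1 HL); apply: (state_le HL) => //; first exact: poly_growth_cst.
  by move=> y; rewrite sE lerDr sqr_ge0.
set sg := Lam (horner s) in s1; have sg0 : 0 < sg by rewrite (lt_le_trans _ s1).
exists sg^-1; first by rewrite invr_gt0.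
move=> eta /andP[e0 e1].
have pr := pb_res_im x e0.
suff : Lam (fun y => - eta * (2 / sg) + eta / sg ^+ 2 * s.[y]) >= Lam (res_im x eta).
  rewrite (stateD HL); [|exact: poly_growth_cst|exact: poly_growthZ].
  rewrite (state_cst HL) (stateZ HL _ ps) -/sg => /le_trans; apply.
  by rewrite le_eqVlt; apply/orP; left; apply/eqP; field; rewrite gt_eqF.
apply: (state_le HL) => // [|y]; first by apply: poly_growthD; [exact: poly_growth_cst|exact: poly_growthZ].
rewrite sE /res_im.
set d := (x - y) ^+ 2 + eta ^+ 2; have d0 : 0 < d by rewrite ltr_wpDl ?sqr_ge0// exprn_gt0.
have ds : d <= (x - y) ^+ 2 + 1 by rewrite lerD2l expr_le1// ltW.
set S := _ + 1 in ds *.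
have h : 0 <= (sg - d) ^+ 2 / (d * sg ^+ 2).
  by rewrite divr_ge0 ?sqr_ge0// mulr_ge0 ?sqr_ge0// ltW.
have E : (sg - d) ^+ 2 / (d * sg ^+ 2) = d^-1 - 2 / sg + d / sg ^+ 2.
  by field; rewrite !gt_eqF.
rewrite E in h.
have h2 : d / sg ^+ 2 <= S / sg ^+ 2 by rewrite ler_pM2r// invr_gt0 exprn_gt0.
have := ler_wpM2l (ltW e0) (le_trans h (lerD (lexx _) h2)).
lra.
Qed.

(** Just above a real zero of [D'] at which [D > 0], the square root [U] of [D]
    would have an imaginary part of order [eta ^+ 2]; convexity of [V] makes it
    at least of order [eta]. *)
Lemma discr_critical (convV : forall x, 0 <= V^`()^`().[x]) x :
  0 < D.[x] -> D^`().[x] <> 0.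
Proof.
move=> d0 D'0; set d := D.[x] in d0.
have [K K0 hK] := horner_imag D x.
have [K' K'0 hK'] := horner_imag V^`() x.
have [c c0 hc] := state_res_im_lower x.
pose A := 2 * K / d; pose B := K' / c; pose E := K ^+ 2 / (2 * d * c ^+ 2).
have A0 : 0 <= A by rewrite divr_ge0 ?mulr_ge0 ?(ltW d0).
have B0 : 0 <= B by rewrite divr_ge0 ?(ltW c0).
have E0 : 0 <= E by apply: divr_ge0; [exact: sqr_ge0|have := ltW d0; have := sqr_ge0 c; nra].
have t0 : 0 < 1 + A + B + E by rewrite ltr_wpDr// ltr_wpDr// ltr_wpDr.
(* one height [e] at which all three second order errors are too small *)
pose e := (1 + A + B + E)^-1; have e0 : 0 < e by rewrite invr_gt0.
have te : (1 + A + B + E) * e = 1 by rewrite divff ?gt_eqF.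
have Ae : 0 <= A * e by rewrite mulr_ge0 ?(ltW e0).
have Be : 0 <= B * e by rewrite mulr_ge0 ?(ltW e0).
have Ee : 0 <= E * e by rewrite mulr_ge0 ?(ltW e0).
have e1 : e <= 1 by lra.
have ee : e ^+ 2 <= e by rewrite expr2 ler_piMr ?(ltW e0).
have e01 : 0 <= e <= 1 by rewrite (ltW e0).
have e01' : 0 < e <= 1 by rewrite e0.
have [r1 r2] := hK e e01; have [_ r3] := hK' e e01; have r4 := hc e e01'.
rewrite D'0 mulr0 subr0 in r2.
have KA : K * e ^+ 2 <= d / 2.
  have h : A * e <= 1 by lra.
  have : K * e <= d / 2.
    have : d / 2 * (A * e) <= d / 2 * 1 by rewrite ler_wpM2l// divr_ge0// ltW.
    by rewrite /A mulr1; rewrite (_ : d / 2 * (2 * K / d * e) = K * e)//; field; rewrite gt_eqF.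
  by apply: le_trans; rewrite ler_wpM2l.
have KB : K' * e ^+ 2 <= e * c.
  have h : B * e <= 1 by lra.
  have : K' * e <= c.
    have : c * (B * e) <= c * 1 by rewrite ler_wpM2l// ltW.
    by rewrite /B mulr1; rewrite (_ : c * (K' / c * e) = K' * e)//; field; rewrite gt_eqF.
  by move/(ler_wpM2l (ltW e0)); rewrite expr2; lra.
have KE : K ^+ 2 * e ^+ 2 < 2 * d * c ^+ 2.
  have h : E * e < 1 by lra.
  have q0 : 0 < 2 * d * c ^+ 2 by rewrite !mulr_gt0// exprn_gt0.
  apply: (@le_lt_trans _ _ (K ^+ 2 * e)); first by rewrite ler_wpM2l ?sqr_ge0.
  move: h; rewrite -(ltr_pM2l q0) mulr1.
  by rewrite (_ : 2 * d * c ^+ 2 * (E * e) = K ^+ 2 * e)// /E; field; rewrite !gt_eqF.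
have U2 := discr_root_sqr HL b0 supp x e0.
set U := discr_root V Lam _ in U2.
have uI : complex.Im U >= e * c.
  have -> : complex.Im U = complex.Im (cpoly V^`()).[Complex x e] - 2 * Lam (res_im x e).
    rewrite /U /discr_root (stieltjesE Lam x e0) cImD cImN; congr (_ - _).
    by rewrite !mulr_natl !mulr2n cImD.
  move: r3; rewrite ler_norml => /andP[r3 _].
  have := mulr_ge0 (ltW e0) (convV x).
  lra.
have uRe : complex.Re U ^+ 2 - complex.Im U ^+ 2 = complex.Re (cpoly D).[Complex x e].
  by rewrite -U2 expr2 cReM !expr2.
have uIm : 2 * (complex.Re U * complex.Im U) = complex.Im (cpoly D).[Complex x e].
  by rewrite -U2 expr2 cImM; ring.
move: uI uRe uIm r1 r2; set u1 := complex.Re U; set u2 := complex.Im U.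
set Dr := complex.Re _; set Di := complex.Im _ => uI uRe uIm r1 r2.
have u1d : d / 2 <= u1 ^+ 2.
  by move: r1; rewrite -/d ler_norml => /andP[r1 _]; have := sqr_ge0 u2; lra.
have ec0 : 0 < e * c by rewrite mulr_gt0.
have u2c : (e * c) ^+ 2 <= u2 ^+ 2.
  by rewrite ler_sqr ?nnegrE ?(ltW ec0)// (le_trans (ltW ec0)).
have h : Di ^+ 2 <= (K * e ^+ 2) ^+ 2.
  rewrite -(real_normK (num_real Di)) ler_sqr ?nnegrE//.
  by rewrite mulr_ge0// sqr_ge0.
have h1 : d / 2 * (e * c) ^+ 2 <= u1 ^+ 2 * u2 ^+ 2.
  by rewrite ler_pM// ?sqr_ge0// divr_ge0// ltW.
have h2 : 2 * d * c ^+ 2 * e ^+ 2 <= K ^+ 2 * e ^+ 2 * e ^+ 2.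
  have E1 : 2 * d * c ^+ 2 * e ^+ 2 = 4 * (d / 2 * (e * c) ^+ 2) by field.
  have E2 : Di ^+ 2 = 4 * (u1 ^+ 2 * u2 ^+ 2) by rewrite -uIm; ring.
  have E3 : K ^+ 2 * e ^+ 2 * e ^+ 2 = (K * e ^+ 2) ^+ 2 by ring.
  by rewrite E1 E3; lra.
have := ltr_pM2r (exprn_gt0 2 e0) (K ^+ 2 * e ^+ 2) (2 * d * c ^+ 2).
by rewrite KE ltNge h2.
Qed.

End Gap.

Section ComplexBounds.
Context {R : realType}.
Local Notation C := R[i].

(** Bounding both parts instead of the modulus keeps all estimates real. *)
Definition cbnd (A : R) (z : C) := `|complex.Re z| <= A /\ `|complex.Im z| <= A.

Lemma cbnd_le A B z : cbnd A z -> A <= B -> cbnd B z.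
Proof. by move=> [h1 h2] AB; split; exact: le_trans AB. Qed.

Lemma cbnd_ge0 A z : cbnd A z -> 0 <= A.
Proof. by move=> [h _]; exact: le_trans h. Qed.

Lemma cbndM A B z w : cbnd A z -> cbnd B w -> cbnd (2 * A * B) (z * w).
Proof.
move=> [a1 a2] [b1 b2]; split; rewrite ?cReM ?cImM.
  apply: le_trans (ler_normB _ _) _; rewrite !normrM.
  by have := ler_pM (normr_ge0 _) (normr_ge0 _) a1 b1;
     have := ler_pM (normr_ge0 _) (normr_ge0 _) a2 b2; lra.
apply: le_trans (ler_normD _ _) _; rewrite !normrM.
by have := ler_pM (normr_ge0 _) (normr_ge0 _) a1 b2;
   have := ler_pM (normr_ge0 _) (normr_ge0 _) a2 b1; lra.
Qed.

Lemma cbndD A B z w : cbnd A z -> cbnd B w -> cbnd (A + B) (z + w).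
Proof.
move=> [a1 a2] [b1 b2]; split; rewrite ?cReD ?cImD;
  by apply: le_trans (ler_normD _ _) _; rewrite lerD.
Qed.

Lemma cbndN A z : cbnd A z -> cbnd A (- z).
Proof. by move=> [a1 a2]; split; rewrite ?cReN ?cImN normrN. Qed.

Lemma cbnd_self (z : C) : cbnd (`|complex.Re z| + `|complex.Im z|) z.
Proof. by split; rewrite ?lerDl ?lerDr. Qed.

Lemma cbnd_scale A (h : R) z : 0 <= h -> cbnd A z -> cbnd (A * h) (z * h%:C%C).
Proof.
move=> h0 [a1 a2]; split; rewrite ?cReM ?cImM /= mulr0 ?subr0 ?add0r ?mulr0.
  by rewrite normrM (ger0_norm h0) ler_wpM2r.
by rewrite normrM (ger0_norm h0) ler_wpM2r.
Qed.

Lemma poly_cbnd (P : {poly C}) : exists2 K : R, 0 <= K &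
  forall h : R, 0 <= h <= 1 -> cbnd K P.[h%:C%C].
Proof.
elim/poly_ind: P => [|P c [K K0 hK]].
  by exists 0 => // h _; rewrite horner0; split; rewrite /= normr0.
exists (K + (`|complex.Re c| + `|complex.Im c|)); first by rewrite !addr_ge0.
move=> h h01; rewrite hornerMXaddC; apply: cbndD; last exact: cbnd_self.
case/andP: (h01) => h0 h1; apply: cbnd_le (cbnd_scale h0 (hK h h01)) _.
by rewrite ler_piMr.
Qed.

(** The constant coefficient is the limit of the values at [0], hence [0]; then divide
    by the variable. *)
Lemma poly_flat_dvd N (T : {poly C}) (M : R) :
  (forall h : R, 0 < h <= 1 -> cbnd (M * h ^+ N) T.[h%:C%C]) -> 'X^N %| T.
Proof.
elim: N T => [|N IH] T hT; first by rewrite expr0 dvd1p.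
have [q [c TE]] : exists (q : {poly C}) c, T = q * 'X + c%:P.
  by elim/poly_ind: T {hT} => [|q c _]; [exists 0, 0; rewrite mul0r addr0|exists q, c].
have [K K0 hK] := poly_cbnd q.
have M0 : 0 <= M.
  have /hT/cbnd_ge0 : 0 < (1:R) <= 1 by rewrite ltr01 lexx.
  by rewrite expr1n mulr1.
have c0 : c = 0.
  have cb (h : R) : 0 < h <= 1 -> cbnd ((M + K) * h) c.
    move=> /andP[h0 h1].
    have -> : c = T.[h%:C%C] + - (q.[h%:C%C] * h%:C%C).
      by rewrite TE hornerMXaddC addrC addKr.
    have h01 : 0 <= h <= 1 by rewrite (ltW h0).
    have h01' : 0 < h <= 1 by rewrite h0.
    apply: cbnd_le (cbndD (hT _ h01') (cbndN (cbnd_scale (ltW h0) (hK _ h01)))) _.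
    rewrite mulrDl lerD2r ler_wpM2l// exprS ler_piMr ?(ltW h0)//.
    by rewrite exprn_ile1// ltW.
  have small (y : R) : (forall h : R, 0 < h <= 1 -> `|y| <= (M + K) * h) -> y = 0.
    move=> hy; apply/eqP; rewrite -normr_le0; apply/ler_addgt0Pl => e e0; rewrite addr0.
    have MK : 0 < M + K + 1 + e by rewrite ltr_wpDl ?addr_ge0.
    have lt1 : e / (M + K + 1 + e) <= 1 by rewrite ler_pdivrMr// mul1r; lra.
    have h01 : 0 < e / (M + K + 1 + e) <= 1 by rewrite divr_gt0.
    apply: le_trans (hy _ h01) _.
    by rewrite mulrCA ler_piMr ?(ltW e0)// ler_pdivrMr// mul1r; lra.
  apply: complexP; apply: small => h /cb[]//.
rewrite TE c0 addr0 mulrC exprS dvdp_mul2l ?polyX_eq0//; apply: IH => h h01.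
case/andP: (h01) => h0 h1; have := hT h h01.
rewrite TE c0 addr0 hornerM hornerX /cbnd cReM cImM /= !mulr0 subr0 add0r exprSr mulrA.
by rewrite !normrM (gtr0_norm h0) !(ler_pM2r h0).
Qed.

Lemma mup_map (F L : fieldType) (f : {rmorphism F -> L}) (p : {poly F}) (x : F) :
  p != 0 -> mup (f x) (map_poly f p) = mup x p.
Proof.
move=> p0.
have fp0 : map_poly f p != 0 by rewrite map_poly_eq0.
have E n : (n <= mup (f x) (map_poly f p))%N = (n <= mup x p)%N.
  rewrite !mup_geq// -(dvdp_map f) rmorphXn rmorphB /= map_polyX map_polyC.
  by [].
by apply/eqP; rewrite eqn_leq -E leqnn E leqnn.
Qed.

Lemma cpoly_eq0 (p : {poly R}) : (cpoly p == 0) = (p == 0).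
Proof. exact: map_poly_eq0. Qed.

Lemma conj_cpoly (p : {poly R}) : map_poly (@conjc R) (cpoly p) = cpoly p.
Proof. by apply/polyP => i; rewrite !coef_map /= oppr0. Qed.

Lemma mup_conj (p : {poly R}) (w : C) : p != 0 -> mup (conjc w) (cpoly p) = mup w (cpoly p).
Proof. by move=> p0; rewrite -{1}conj_cpoly mup_map// cpoly_eq0. Qed.

Lemma poly_ge0_lim (T : {poly R}) (x s : R) :
  (forall e : R, 0 < e <= 1 -> 0 <= T.[x + s * e]) -> 0 <= T.[x].
Proof.
move=> h; pose Q := T \Po (s *: 'X + x%:P).
have QE e : Q.[e] = T.[x + s * e] by rewrite horner_comp !hornerE addrC.
have [q [c QqE]] : exists (q : {poly R}) c, Q = q * 'X + c%:P.
  by elim/poly_ind: Q {QE} => [|q c _]; [exists 0, 0; rewrite mul0r addr0|exists q, c].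
have cE : T.[x] = c by rewrite -[x in LHS]addr0 -(mulr0 s) -QE QqE hornerMXaddC mulr0 add0r.
have [K hK] := poly_disk_bound q 1.
have K0 : 0 <= K by apply: le_trans (hK 0 _); rewrite ?normr0.
apply/ler_addgt0Pl => e e0.
have Ke : 0 < K + 1 + e by rewrite addr_gt0// ltr_wpDl.
have lt1 : e / (K + 1 + e) <= 1 by rewrite ler_pdivrMr// mul1r; lra.
have h01 : 0 < e / (K + 1 + e) <= 1 by rewrite divr_gt0.
have := h _ h01; rewrite -QE QqE hornerMXaddC cE; move: h01; set t := e / _ => /andP[t0 t1].
have := hK t; rewrite (gtr0_norm t0) => /(_ t1); rewrite ler_norml => /andP[_ qK].
have : q.[t] * t <= K * t by rewrite ler_wpM2r// ltW.
have : K * t <= e.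
  by rewrite /t mulrCA ler_piMr ?(ltW e0)// ler_pdivrMr// mul1r; lra.
lra.
Qed.

(** A zero of odd order is a sign change. *)
Lemma even_mup_ge0 (S : {poly R}) (x : R) : S != 0 ->
  (forall y, 0 <= S.[y]) -> ~~ odd (mup x S).
Proof.
move=> S0 Sge; apply/negP => om.
have [m [q]] := multiplicity_XsubC S x; rewrite S0 /= => qx SE.
have mE : mup x S = m by rewrite SE mupMr// mup_XsubCX eqxx.
rewrite mE in om; move/negP: qx; apply; apply/rootP/eqP; rewrite eq_le; apply/andP; split.
  rewrite -oppr_ge0 -hornerN; apply: (@poly_ge0_lim _ _ (-1)) => e /andP[e0 _].
  have := Sge (x + -1 * e); rewrite SE hornerM horner_exp hornerXsubC hornerN.
  set t := q.[_]; have -> : x + -1 * e - x = - e by ring.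
  rewrite exprNn -signr_odd om expr1 mulN1r mulrN -mulNr.
  by rewrite pmulr_lge0 ?exprn_gt0.
apply: (@poly_ge0_lim _ _ 1) => e /andP[e0 _].
have := Sge (x + 1 * e); rewrite SE hornerM horner_exp hornerXsubC.
by rewrite [x + _]addrC addrK mul1r pmulr_lge0 ?exprn_gt0.
Qed.

Lemma prod_XsubC_even (F : fieldType) (r : seq F) :
  (forall w, ~~ odd (count_mem w r)) ->
  \prod_(w <- r) ('X - w%:P) =
  (\prod_(w <- undup r) ('X - w%:P) ^+ (count_mem w r)./2) ^+ 2.
Proof.
move=> ev; rewrite -big_undup_iterop_count -prodrXl; apply: eq_bigr => w _.
by rewrite -exprM muln2 even_halfK.
Qed.

(** All roots of [S] have even multiplicity, so [S] is a square over the complex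
    numbers; the root with positive leading coefficient is fixed by conjugation, hence
    real. *)
Lemma poly_square (S : {poly R}) : S != 0 -> (forall x, 0 <= S.[x]) -> 0 < lead_coef S ->
  (forall w : C, complex.Im w != 0 -> ~~ odd (mup w (cpoly S))) ->
  exists2 h : {poly R}, S = h ^+ 2 & 0 < lead_coef h.
Proof.
move=> S0 Sge lS evS.
have [r rE] := closed_field_poly_normal (cpoly S).
have cS0 : cpoly S != 0 by rewrite cpoly_eq0.
have lE : lead_coef (cpoly S) = (lead_coef S)%:C%C by rewrite lead_coef_map.
have ev w : ~~ odd (count_mem w r).
  have <- : mup w (cpoly S) = count_mem w r.
    rewrite rE -mul_polyC mupMr ?mu_prod_XsubC// rootC lead_coef_eq0//.
  have [w0|] := eqVneq (complex.Im w) 0; last exact: evS.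
  have -> : w = (complex.Re w)%:C%C by apply: complexP.
  by rewrite mup_map//; exact: even_mup_ge0.
pose l : R := Num.sqrt (lead_coef S); have l0 : 0 < l by rewrite sqrtr_gt0.
pose g0 := \prod_(w <- undup r) ('X - w%:P) ^+ (count_mem w r)./2.
pose g : {poly C} := l%:C%C *: g0.
have gE : g ^+ 2 = cpoly S.
  rewrite /g exprZn -prod_XsubC_even// rE lE -rmorphXn /= sqr_sqrtr// ltW//.
have lg0 : lead_coef g0 = 1.
  by rewrite /g0; apply/monicP/monic_prod => w _; exact/monic_exp/monicXsubC.
have lg : lead_coef g = l%:C%C by rewrite /g lead_coefZ lg0 mulr1.
have cg : map_poly (@conjc R) g = g.
  have /eqP : map_poly (@conjc R) g ^+ 2 = g ^+ 2.
    by rewrite -rmorphXn /= gE conj_cpoly.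
  rewrite eqf_sqr => /orP[/eqP//|/eqP E]; exfalso.
  have := congr1 lead_coef E; rewrite lead_coefN lead_coef_map lg /= => -[] /eqP.
  by rewrite -addr_eq0 (gt_eqF (addr_gt0 l0 l0)).
pose h : {poly R} := \poly_(i < size g) complex.Re g`_i.
have hE : cpoly h = g.
  apply/polyP => i; rewrite coef_map coef_poly; case: ltnP => [_|hi].
    apply: complexP => //=; have := congr1 (fun q : {poly C} => complex.Im q`_i) cg.
    rewrite coef_map /=; case: (g`_i) => u v /= /eqP.
    by rewrite eq_sym -subr_eq0 opprK -mulr2n mulrn_eq0 /= => /eqP ->.
  by rewrite nth_default.
exists h.
  apply: (@map_poly_inj _ _ (real_complex R)).
  by rewrite rmorphXn /= -/(cpoly h) hE gE.
by have := lg; rewrite -hE lead_coef_map => -[] ->.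
Qed.

End ComplexBounds.

Section DerivSize.
Variable R : realType.

Lemma size_deriv_real (p : {poly R}) : size p^`() = (size p).-1.
Proof.
have [p1|p1] := leqP (size p) 1; first by rewrite (size1_polyC p1) derivC size_poly0 size_polyC; case: eqP.
have p0 : p != 0 by rewrite -size_poly_gt0 (ltn_trans _ p1).
have h1 := lt_size_deriv p0.
apply/eqP; rewrite eqn_leq; apply/andP; split; first by lia.
rewrite leqNgt; apply/negP => h.
have : p^`()`_((size p).-2) = 0 by rewrite nth_default// -ltnS prednK//; lia.
rewrite coef_deriv prednK; last by lia.
rewrite -lead_coefE => /eqP; rewrite mulrn_eq0 lead_coef_eq0 (negPf p0) orbF; lia.
Qed.

Lemma lead_coef_deriv_gt0 (p : {poly R}) : (1 < size p)%N -> 0 < lead_coef p ->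
  0 < lead_coef p^`().
Proof.
move=> s1; rewrite !lead_coefE coef_deriv size_deriv_real prednK; last by lia.
by move=> h; rewrite pmulrn_lgt0//; lia.
Qed.

End DerivSize.

(** Averaging one variable of the difference quotient of [V'] leaves degree at most
    that of [V'']. *)
Lemma quot_poly_coef0 {R : realType} (V : {poly R}) (Lam : (R -> R) -> R) j :
  ((size V).-2 <= j)%N -> (quot_poly V Lam)`_j = 0.
Proof.
move=> hj; rewrite /quot_poly coef_sum big1// => i _; rewrite coef_sum big1// => l _.
rewrite coefZ coefXn; case: eqP => [E|_]; last by rewrite mulr0.
have iV : (i < (size V).-1)%N by rewrite -size_deriv_real.
have li := ltn_ord l; exfalso; move: iV hj li; rewrite E.
by case: (size V) => [|[|k]] /=; lia.
Qed.

Section Factorization.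
Context {R : realType}.
Local Notation C := R[i].
Variables (V : {poly R}) (Lam : (R -> R) -> R).
Hypothesis HL : loop_state V Lam.
Variable b0 : R.
Hypotheses (b0_gt0 : 0 < b0) (supp : forall f (e : R), poly_growth f ->
  (forall x, `|x| <= b0 -> `|f x| <= e) -> `|Lam f| <= e).
Local Notation D := (discr_poly V Lam).

Lemma cbnd_resolvent (x eta : R) y : 0 < eta -> cbnd eta^-1 (resolvent (Complex x eta) y).
Proof. by move=> e0; rewrite resolventE//; exact: res_bounds. Qed.

Lemma cpoly_growth_cbnd (F : R -> C) A : (forall y, cbnd A (F y)) -> cpoly_growth F.
Proof.
move=> h; split; apply: (@poly_growth_bounded _ _ A) => y; have [] := h y; done.
Qed.

Lemma Lamc_cbnd (F : R -> C) A : (forall y, cbnd A (F y)) -> cbnd A (Lamc Lam F).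
Proof.
move=> h; have [p1 p2] := cpoly_growth_cbnd h.
by split; apply: supp => // y _; have [] := h y.
Qed.

Lemma resolvent_shift (x eta h : R) y N : 0 < eta ->
  resolvent (Complex (x + h) eta) y =
  \sum_(k < N) (- h%:C%C) ^+ k * resolvent (Complex x eta) y ^+ k.+1 +
  (- h%:C%C) ^+ N * (resolvent (Complex x eta) y ^+ N * resolvent (Complex (x + h) eta) y).
Proof.
move=> e0; set r := resolvent (Complex x eta) y; set rh := resolvent (Complex (x + h) eta) y.
have nz x' : Complex x' eta - y%:C%C != 0.
  by rewrite eq_complex /= negb_and subr0 (gt_eqF e0) orbT.
have E : rh = r - h%:C%C * (r * rh).
  rewrite /r /rh /resolvent.
  have -> : Complex (x + h) eta - y%:C%C = Complex x eta - y%:C%C + h%:C%C.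
    by apply: complexP => /=; ring.
  have : Complex x eta - y%:C%C + h%:C%C != 0.
    by have -> : Complex x eta - y%:C%C + h%:C%C = Complex (x + h) eta - y%:C%C
      by apply: complexP => /=; ring.
  by move: (nz x) => n1 n2; field; rewrite n1 n2.
elim: N => [|N IH]; first by rewrite big_ord0 !expr0 !mul1r add0r.
rewrite big_ord_recr /= {1}IH -addrA; congr (_ + _).
by rewrite {1}E !exprS; ring.
Qed.

(** The Taylor polynomial of [discr_root] at a point of the upper half plane, along
    the real direction; it comes from the geometric expansion of the resolvent. *)
Definition root_taylor (w : C) N : {poly C} :=
  cpoly V^`() \Po ('X + w%:P) -
  2 *: \poly_(k < N) ((-1) ^+ k * Lamc Lam (fun y => resolvent w y ^+ k.+1)).

Lemma discr_root_shift (x eta : R) N : 0 < eta -> exists M : R, forall h : R, exists2 L : C,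
  cbnd M L & discr_root V Lam (Complex (x + h) eta) =
    (root_taylor (Complex x eta) N).[h%:C%C] + L * (h%:C%C) ^+ N.
Proof.
move=> e0; set w := Complex x eta.
have rpow k : exists A : R, forall y, cbnd A (resolvent w y ^+ k).
  elim: k => [|k [A hA]]; first by exists 1 => y; split; rewrite /= ?normr0 ?normr1.
  by exists (2 * eta^-1 * A) => y; rewrite exprS; apply: cbndM => //; exact: cbnd_resolvent.
have pr k : cpoly_growth (fun y => resolvent w y ^+ k) by have [A hA] := rpow k; exact: cpoly_growth_cbnd hA.
have [A hA] := rpow N.
have hL h y : cbnd (2 * A * eta^-1) (resolvent w y ^+ N * resolvent (Complex (x + h) eta) y).
  by apply: cbndM => //; exact: cbnd_resolvent.
have two : cbnd 2 (- 2 : C).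
  by split; rewrite ?cReN ?cImN normrN /= -?[2 : C]/(1 + 1) ?cReD ?cImD /= ?addr0 ?normr0 ?ger0_norm.
have one : cbnd 1 ((-1 : C) ^+ N).
  rewrite -signr_odd; case: odd; rewrite ?expr1 ?expr0; split;
    by rewrite ?cReN ?cImN /= ?oppr0 ?normrN ?normr0 ?normr1.
exists (2 * 2 * (2 * 1 * (2 * A * eta^-1))) => h.
pose L0 := Lamc Lam (fun y => resolvent w y ^+ N * resolvent (Complex (x + h) eta) y).
exists (- 2 * ((-1) ^+ N * L0)).
  by apply: cbndM => //; apply: cbndM => //; exact: Lamc_cbnd.
have pR : cpoly_growth (fun y => resolvent w y ^+ N * resolvent (Complex (x + h) eta) y).
  exact: cpoly_growth_cbnd (hL h).
have sE : stieltjes Lam (Complex (x + h) eta) =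
    \sum_(k < N) (- h%:C%C) ^+ k * Lamc Lam (fun y => resolvent w y ^+ k.+1) +
    (- h%:C%C) ^+ N * L0.
  rewrite /stieltjes (funext (fun y => resolvent_shift x h y N e0)) -/w.
  rewrite (LamcD HL); last 2 first.
  - elim: (index_enum _) => [|i s IH]; first by under eq_fun do rewrite big_nil; exact: cpoly_growth_cst.
    by under eq_fun do rewrite big_cons; apply: cpoly_growthD => //; exact: cpoly_growthZ.
  - exact: cpoly_growthZ.
  rewrite (LamcZ HL)// (Lamc_sum HL); last by move=> i; exact: cpoly_growthZ.
  by congr (_ + _); apply: eq_bigr => i _; rewrite (LamcZ HL).
rewrite /discr_root sE /root_taylor hornerD hornerN hornerZ horner_comp hornerD hornerX hornerC.
have -> : h%:C%C + w = Complex (x + h) eta by apply: complexP; rewrite /= ?add0r// addrC.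
rewrite (horner_poly N).
have -> : \sum_(k < N) (- h%:C%C) ^+ k * Lamc Lam (fun y => resolvent w y ^+ k.+1) =
    \sum_(k < N) (-1) ^+ k * Lamc Lam (fun y => resolvent w y ^+ k.+1) * h%:C%C ^+ k.
  by apply: eq_bigr => k _; rewrite [(- h%:C%C) ^+ k]exprNn mulrAC.
by rewrite [(- h%:C%C) ^+ N]exprNn; ring.
Qed.

Lemma dvdp_discr_taylor (x eta : R) N : 0 < eta ->
  'X^N %| (cpoly D \Po ('X + (Complex x eta)%:P)) - root_taylor (Complex x eta) N ^+ 2.
Proof.
move=> e0; have [M hM] := discr_root_shift x N e0.
set P := root_taylor _ _ in hM *.
have [K K0 hK] := poly_cbnd P.
apply: (@poly_flat_dvd _ N _ (2 * M * (2 * 2 * K + M))) => h /andP[h0 h1].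
have [L bL UE] := hM h.
have h01 : 0 <= h <= 1 by rewrite (ltW h0).
have hN0 : 0 <= h ^+ N by rewrite exprn_ge0// ltW.
have two : cbnd 2 (2 : C).
  by split; rewrite /= -?[2 : C]/(1 + 1) ?cReD ?cImD /= ?addr0 ?normr0 ?ger0_norm.
rewrite hornerD hornerN horner_exp horner_comp hornerD hornerX hornerC.
have -> : h%:C%C + Complex x eta = Complex (x + h) eta.
  by apply: complexP; rewrite /= ?add0r// addrC.
rewrite -(discr_root_sqr HL b0_gt0 supp _ e0) UE.
have -> : (P.[h%:C%C] + L * h%:C%C ^+ N) ^+ 2 - P.[h%:C%C] ^+ 2 =
    L * (2 * P.[h%:C%C] + L * h%:C%C ^+ N) * h%:C%C ^+ N by ring.
rewrite -rmorphXn /=; apply: cbnd_scale => //; apply: cbndM => //; apply: cbndD.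
  by apply: cbndM => //; exact: hK.
apply: cbnd_le (cbnd_scale hN0 bL) _.
by rewrite ler_piMr ?(cbnd_ge0 bL)// exprn_ile1// ltW.
Qed.

(** Near a nonreal [w] the discriminant agrees to any order with the square of a
    polynomial, and a square has even order. *)
Lemma even_mup_discr (w : C) : D != 0 -> complex.Im w != 0 -> ~~ odd (mup w (cpoly D)).
Proof.
move=> D0; wlog w0 : w / 0 < complex.Im w.
  move=> W; case: ltgtP => // [w0|w0] _.
    rewrite -(mup_conj w D0); apply: W; case: w w0 => u v /=; first by rewrite oppr_gt0.
    by move=> v0; rewrite oppr_eq0 lt_eqF.
  by apply: W => //; rewrite gt_eqF.
move=> _; set m := mup w _; apply/negP => om.
have cD0 : cpoly D != 0 by rewrite cpoly_eq0.
have wE : w = Complex (complex.Re w) (complex.Im w) by case: w {w0 m om}.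
have /(_ m.+1) hN := fun N => dvdp_discr_taylor (complex.Re w) N w0.
rewrite -wE in hN; set P := root_taylor w m.+1 in hN.
have shift k : ('X^k %| cpoly D \Po ('X + w%:P)) = (k <= m)%N.
  rewrite mup_geq//; apply/idP/idP => [/(dvdp_comp_poly ('X - w%:P))|/(dvdp_comp_poly ('X + w%:P))].
    by rewrite comp_polyXaddC_K rmorphXn /= comp_polyX.
  by rewrite rmorphXn /= comp_polyB comp_polyX comp_polyC addrK.
have mh : m./2.*2.+1 = m by rewrite -[RHS]odd_double_half om.
have Xm : 'X^m %| P ^+ 2.
  have := shift m; rewrite leqnn => h1.
  rewrite -[P ^+ 2](subKr (cpoly D \Po ('X + w%:P))).
  by rewrite dvdp_sub//; apply: dvdp_trans (hN); rewrite dvdp_exp2l.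
have P0 : 'X^(m./2.+1) %| P.
  have [->|Pn0] := eqVneq P 0; first exact: dvdp0.
  rewrite -['X](subr0) -[0]/(0%:P) -mup_geq//.
  move: Xm; rewrite -['X](subr0) -[0]/(0%:P) -mup_geq ?expf_neq0// expr2 mupM//.
  by rewrite -mh; lia.
have : 'X^(m.+1) %| cpoly D \Po ('X + w%:P).
  rewrite -[_ \Po _](subrK (P ^+ 2)); apply: dvdp_add => //.
  rewrite -mh -doubleS -muln2 exprM; exact: dvdp_exp2r.
by rewrite shift ltnn.
Qed.

(** [D] is positive exactly outside [[a, b]], so [D = (x - a) (x - b) S] with
    [S >= 0]; real zeros of [S] have even order by sign, nonreal ones by
    [even_mup_discr], and [S] is a square. *)
Lemma discr_factor : odd (size V) -> (1 < size V)%N -> 0 < lead_coef V ->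
  (forall x, 0 <= V^`()^`().[x]) ->
  exists (a b : R) (h : {poly R}), [/\ a <= b, D = ('X - a%:P) * ('X - b%:P) * h ^+ 2,
    size h = (size V).-2 & 0 < lead_coef h].
Proof.
move=> oV s1 lV convV.
have lV' := lead_coef_deriv_gt0 s1 lV.
have V'0 : V^`() != 0 by rewrite -lead_coef_eq0 gt_eqF.
have sV' : size V^`() = (size V).-1 by rewrite size_deriv_real.
have s2 : size (V^`() ^+ 2) = ((size V).-2 * 2).+1.
  by rewrite -(@prednK (size _)) ?size_poly_gt0 ?expf_neq0// size_exp sV'.
have sq : (size (- (4 *: quot_poly V Lam)) < size (V^`() ^+ 2)%R)%N.
  rewrite size_polyN (leq_ltn_trans (size_scale_leq _ _))// s2 ltnS.
  have h : (size (quot_poly V Lam) <= (size V).-2)%N by apply/leq_sizeP => j; exact: quot_poly_coef0.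
  by rewrite (leq_trans h)// leq_pmulr.
have sD : size D = size (V^`() ^+ 2) by rewrite /discr_poly size_polyDl.
have lD : lead_coef D = lead_coef V^`() ^+ 2 by rewrite /discr_poly lead_coefDl// lead_coef_exp.
have lD0 : 0 < lead_coef D by rewrite lD exprn_gt0.
have D0 : D != 0 by rewrite -lead_coef_eq0 gt_eqF.
have oD : odd (size D) by rewrite sD s2 muln2 /= odd_double.
have D1 : (1 < size D)%N.
  by rewrite sD s2; move: oV s1; case: (size V) => [|[|[|k]]].
have [a [b [ab Da Db Dle]]] := sublevel_interval oD D1 lD0 (discr_critical HL b0_gt0 supp convV).
have [q qE] : exists q, D = q * ('X - a%:P) by apply/factor_theorem/rootP.
have Dgt x : ~~ (a <= x <= b) -> 0 < D.[x] by rewrite -Dle ltNge.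
have qb : q.[b] = 0.
  (* in the degenerate case [a = b] the zero is double, since [D > 0] on both sides *)
  have [E|nab] := eqVneq a b; last first.
    have := Db; rewrite qE hornerM hornerXsubC => /eqP; rewrite mulf_eq0 subr_eq0.
    by rewrite [b == a]eq_sym (negPf nab) orbF => /eqP.
  apply/eqP; rewrite eq_le; apply/andP; split.
    rewrite -oppr_ge0 -hornerN; apply: (@poly_ge0_lim _ _ _ (-1)) => e /andP[e0 _].
    have : 0 < D.[b + -1 * e] by apply: Dgt; rewrite E; apply/negP => /andP[]; lra.
    rewrite qE hornerM hornerXsubC E hornerN; set t := q.[_].
    have -> : b + -1 * e - b = - e by ring.
    by rewrite mulrN -mulNr pmulr_lgt0// => /ltW.
  apply: (@poly_ge0_lim _ _ _ 1) => e /andP[e0 _].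
  have : 0 < D.[b + 1 * e] by apply: Dgt; rewrite E; apply/negP => /andP[]; lra.
  rewrite qE hornerM hornerXsubC E; set t := q.[_].
  have -> : b + 1 * e - b = e by ring.
  by rewrite pmulr_lgt0// => /ltW.
have [S SE] : exists S, q = S * ('X - b%:P) by apply/factor_theorem/rootP.
have DS : D = ('X - a%:P) * ('X - b%:P) * S by rewrite qE SE; ring.
have S0 : S != 0 by apply/eqP => E; move: D0; rewrite DS E mulr0 eqxx.
have DSx x : D.[x] = (x - a) * (x - b) * S.[x] by rewrite DS !hornerM !hornerXsubC.
have Sout x : ~~ (a <= x <= b) -> 0 <= S.[x].
  move=> xab; have := Dgt _ xab; rewrite DSx pmulr_rgt0; first by move/ltW.
  move: xab; rewrite negb_and -!ltNge => /orP[xa|xb].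
    by rewrite nmulr_rgt0; lra.
  by rewrite pmulr_rgt0; lra.
have Sge x : 0 <= S.[x].
  have [xab|] := boolP (a <= x <= b); last exact: Sout.
  have [->|xa] := eqVneq x a.
    apply: (@poly_ge0_lim _ _ _ (-1)) => e /andP[e0 _]; apply: Sout.
    by apply/negP => /andP[]; lra.
  have [->|xb] := eqVneq x b.
    apply: (@poly_ge0_lim _ _ _ 1) => e /andP[e0 _]; apply: Sout.
    by apply/negP => /andP[]; lra.
  have := xab; rewrite -Dle DSx; case/andP: xab => x1 x2.
  rewrite nmulr_rle0// nmulr_llt0 ?subr_lt0 ?subr_gt0 lt_neqAle ?xb//.
  by rewrite eq_sym xa.
have lS : 0 < lead_coef S.
  by move: lD0; rewrite DS !lead_coefM !lead_coefXsubC !mul1r.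
have [w w0|h hE lh] := poly_square S0 Sge lS.
  have := even_mup_discr D0 w0; rewrite DS /cpoly !rmorphM /= mupMr// rootM negb_or.
  have nr c : ~~ root (map_poly (real_complex R) ('X - c%:P)) w.
    rewrite rmorphB /= map_polyX map_polyC root_XsubC.
    by apply: contraNneq w0 => ->.
  by rewrite !nr.
exists a, b, h; split=> //; first by rewrite DS hE.
have h0 : h != 0 by rewrite -lead_coef_eq0 gt_eqF.
have mX : ('X - a%:P) * ('X - b%:P) \is monic by rewrite monicMl ?monicXsubC.
have := sD; rewrite DS hE [_ * h ^+ 2]mulrC size_Mmonic// ?expf_neq0// s2.
have -> : size (('X - a%:P) * ('X - b%:P)) = 3%N.
  by rewrite size_Mmonic ?monicXsubC ?polyXsubC_eq0// !size_XsubC.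
rewrite -(@prednK (size (h ^+ 2))) ?size_poly_gt0 ?expf_neq0// size_exp.
have : (0 < size h)%N by rewrite size_poly_gt0.
by move: (size h) (size V) => k l; clear; lia.
Qed.

End Factorization.

(** * The arcsine law *)

Section ArcsineMean.
Context {R : realType}.
Local Notation mu := (@lebesgue_measure R).
Local Notation I := (`[(- (pi / 2) : R), (pi / 2 : R)]%classic).

(** Mean over the uniform angle [t] in [[- pi / 2, pi / 2]]; the law of [sin t] is the
    arcsine law, so the endpoint singularities of its density disappear. *)
Definition tmean (f : R -> R) : R := pi^-1 * \int[mu]_(t in I) f t.

Lemma tint_integrable (f : R -> R) : continuous f -> mu.-integrable I (EFin \o f).
Proof.
move=> cf; apply: continuous_compact_integrable; first exact: segment_compact.
exact: continuous_subspaceT.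
Qed.

Lemma tmeanD (f g : R -> R) : continuous f -> continuous g ->
  tmean (fun t => f t + g t) = tmean f + tmean g.
Proof.
by move=> cf cg; rewrite /tmean RintegralD ?mulrDr//; exact: tint_integrable.
Qed.

Lemma tmeanZ (a : R) (f : R -> R) : continuous f -> tmean (fun t => a * f t) = a * tmean f.
Proof.
move=> cf; rewrite /tmean RintegralZl//; first exact: mulrCA.
exact: tint_integrable.
Qed.

Lemma tmeanB (f g : R -> R) : continuous f -> continuous g ->
  tmean (fun t => f t - g t) = tmean f - tmean g.
Proof.
by move=> cf cg; rewrite /tmean RintegralB ?mulrBr//; exact: tint_integrable.
Qed.

Lemma tmean_le (f g : R -> R) : continuous f -> continuous g ->
  (forall t, f t <= g t) -> tmean f <= tmean g.
Proof.
move=> cf cg fg; rewrite /tmean ler_wpM2l ?invr_ge0 ?pi_ge0//.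
by apply: le_Rintegral => //; exact: tint_integrable.
Qed.

Lemma tmean_cst a : tmean (fun=> a) = a.
Proof.
rewrite /tmean Rintegral_cst//= lebesgue_measure_itv /= lte_fin.
have p0 := @pi_gt0 R; rewrite (_ : - (pi / 2) < pi / 2); last by lra.
rewrite -EFinD /= opprK -splitr mulrC -mulrA divff ?mulr1//.
by rewrite gt_eqF.
Qed.

Lemma tmean_derive (F f : R -> R) : (forall t, is_derive t (1:R) F (f t)) ->
  continuous f -> tmean f = pi^-1 * (F (pi / 2) - F (- (pi / 2))).
Proof.
move=> dF cf; congr (_ * _); rewrite /Rintegral.
have cF : continuous F.
  by move=> t; apply: differentiable_continuous; apply/derivable1_diffP; have [] := dF t.
have p0 := @pi_gt0 R.
rewrite (@continuous_FTC2 _ f F)//; first by lra.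
- exact: continuous_subspaceT.
- split; first by move=> t _; have [] := dF t.
  + by apply: cvg_at_right_filter; exact: cF.
  + by apply: cvg_at_left_filter; exact: cF.
- by move=> t _; rewrite derive1E; exact: (@derive_val _ _ _ _ _ _ _ (dF t)).
Qed.

Lemma tmean_gt0 (f : R -> R) t0 : continuous f -> (forall t, 0 <= f t) ->
  - (pi / 2) < t0 < pi / 2 -> 0 < f t0 -> 0 < tmean f.
Proof.
move=> cf f0 /andP[t1 t2] ft0.
have h0 : 0 < f t0 / 2 by rewrite divr_gt0.
have /nbhs_ballP[d /= d0 hd] : nbhs t0 [set t | f t0 / 2 < f t].
  have /cvgrPdist_lt/(_ _ h0) := cf t0; apply: filterS => t /=.
  by rewrite ltr_norml => /andP[_]; lra.
pose e := Num.min (d / 2) (Num.min (t0 + pi / 2) (pi / 2 - t0)).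
have e0 : 0 < e by rewrite /e !lt_min divr_gt0//=; apply/andP; split; lra.
have ed : e < d by rewrite /e gt_min; apply/orP; left; lra.
have e1 : e <= t0 + pi / 2 by rewrite /e !ge_min lexx orbT.
have e2 : e <= pi / 2 - t0 by rewrite /e !ge_min lexx !orbT.
rewrite /tmean mulr_gt0// ?invr_gt0 ?pi_gt0//.
pose J : set R := `[t0 - e, t0 + e]%classic.
have JI : J `<=` I.
  move=> t; rewrite /J /= !in_itv /= => /andP[a1 a2]; apply/andP; split; lra.
have iJ (g : R -> R) : continuous g -> mu.-integrable J (EFin \o g).
  by move=> cg; apply: continuous_compact_integrable; [exact: segment_compact|exact: continuous_subspaceT].
have h1 : \int[mu]_(t in J) (f t0 / 2) <= \int[mu]_(t in I) f t.
  apply: (@le_trans _ _ (\int[mu]_(t in J) f t)).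
    have ic := iJ _ (@cst_continuous R R (f t0 / 2)).
    have icf := iJ f cf; have mJ : measurable J by exact: measurable_itv.
    apply: le_Rintegral => //.
    move=> t; rewrite /J /= in_itv /= => /andP[x1 x2]; apply: ltW; apply: hd.
    by rewrite /ball /= ltr_norml; apply/andP; split; lra.
  rewrite /Rintegral fine_le//.
  - by apply: integrable_fin_num; [exact: measurable_itv|exact: (iJ f cf)].
  - by apply: integrable_fin_num; [exact: measurable_itv|exact: tint_integrable].
  - apply: ge0_subset_integral => //; first exact: measurable_itv.
      by apply/measurable_EFinP; apply: measurable_funTS; exact: continuous_measurable_fun.
    by move=> t _; rewrite lee_fin.
apply: lt_le_trans h1; rewrite Rintegral_cst; last exact: measurable_itv.
rewrite /J /= lebesgue_measure_itv /= lte_fin.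
rewrite ifT; last by lra.
by rewrite -EFinD /= mulr_gt0//; lra.
Qed.

End ArcsineMean.

Section ArcsineLaw.
Context {R : realType}.
Local Notation mu := (@lebesgue_measure R).
Local Notation I := (`[(- (pi / 2) : R), (pi / 2 : R)]%classic).
Variables a b : R.
Hypothesis ab : a < b.
Let c := (a + b) / 2.
Let r := (b - a) / 2.
Let Phi t := c + r * sin t.

Let r0 : 0 < r. Proof. by rewrite /r divr_gt0// subr_gt0. Qed.

(** Integration against [(pi * sqrt ((b - u) (u - a))) ^ -1 du], see
    [arcsine_integral]. *)
Definition arcmean (q : {poly R}) : R := tmean (fun t => q.[Phi t]).

Let cPhi : continuous Phi.
Proof.
move=> t; apply: cvgD; first exact: cvg_cst.
by apply: cvgM; [exact: cvg_cst|exact: continuous_sin].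
Qed.

Let cq (q : {poly R}) : continuous (fun t => q.[Phi t]).
Proof. by move=> t; apply: continuous_comp; [exact: cPhi|exact: continuous_horner]. Qed.

Lemma arcD p q : arcmean (p + q) = arcmean p + arcmean q.
Proof. by rewrite /arcmean -tmeanD//; congr tmean; apply/funext => t; rewrite hornerD. Qed.

Lemma arcZ k p : arcmean (k *: p) = k * arcmean p.
Proof. by rewrite /arcmean -tmeanZ//; congr tmean; apply/funext => t; rewrite hornerZ. Qed.

Lemma arc1 : arcmean 1 = 1.
Proof. by rewrite -[RHS](@tmean_cst R); congr tmean; apply/funext => t; rewrite hornerC. Qed.

Let dPhi t : is_derive t (1:R) Phi (r * cos t).
Proof.
by rewrite /Phi; apply: is_derive_eq; rewrite /= -![_ *: _]/(_ * _); ring.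
Qed.

Lemma sin_box t : a <= Phi t <= b.
Proof.
have h1 := sin_le1 t; have h2 := sin_geN1 t; have := r0.
rewrite /Phi /c /r => rr; apply/andP; split; nra.
Qed.

Lemma box_sqr t : (b - Phi t) * (Phi t - a) = (r * cos t) ^+ 2.
Proof.
by have := cos2Dsin2 t; rewrite /Phi /c /r => h; rewrite exprMn cos2sin2; field.
Qed.

(** The derivative of [Phi t ^+ k * (r * cos t)] integrates to [0]; by [box_sqr] it is
    a polynomial in [Phi t]. *)
Lemma arc_recursion k : k.+1%:R * arcmean 'X^(k.+1) - (2 * k + 1)%:R * (c * arcmean 'X^k) +
  k%:R * (a * b * arcmean 'X^(k.-1)) = 0.
Proof.
pose F t := Phi t ^+ k * (r * cos t).
pose f t := k%:R * Phi t ^+ k.-1 * (r * cos t) ^+ 2 - Phi t ^+ k * (r * sin t).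
have dF t : is_derive t (1:R) F (f t).
  have h1 : is_derive t (1:R) (fun t => Phi t ^+ k) (k%:R * Phi t ^+ k.-1 * (r * cos t)).
    have := is_deriveX k (dPhi t); rewrite -[_ *: _]/(_ * _).
    by rewrite -mulr_natl (_ : (fun u => _) = Phi ^+ k)//; apply/funext => u; rewrite exprfctE.
  have h2 : is_derive t (1:R) (fun t => r * cos t) (- (r * sin t)).
    by apply: is_derive_eq; rewrite /= -![_ *: _]/(_ * _); ring.
  have E : Phi t ^+ k *: - (r * sin t) + (r * cos t) *: (k%:R * Phi t ^+ k.-1 * (r * cos t)) = f t.
    by rewrite -![_ *: _]/(_ * _) /f; ring.
  by rewrite -E; exact: (is_deriveM h1 h2).
have fE t : f t = (- k.+1%:R * ('X^(k.+1)).[Phi t] + (2 * k + 1)%:R * c * ('X^k).[Phi t])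
    - k%:R * (a * b) * ('X^(k.-1)).[Phi t].
  rewrite /f -box_sqr !hornerXn; have -> : r * sin t = Phi t - c by rewrite /Phi; ring.
  rewrite /c; case: k {F f dF} => [|k] /=; first by rewrite expr0 expr1; field.
  by rewrite !exprS; field.
have cZ z (q : {poly R}) : continuous (fun t => z * q.[Phi t]).
  by move=> t; apply: cvgM; [exact: cvg_cst|exact: cq].
have cZ2 z (q : {poly R}) z' (q' : {poly R}) : continuous (fun t => z * q.[Phi t] + z' * q'.[Phi t]).
  by move=> t; apply: cvgD; exact: cZ.
have h : tmean f = 0.
  rewrite (@tmean_derive _ F f dF); last first.
    by rewrite (funext fE) => t; apply: cvgB; [exact: cZ2|exact: cZ].
  by rewrite /F cosN cos_pihalf !mulr0 subrr mulr0.
move: h; rewrite (funext fE) tmeanB ?tmeanD ?tmeanZ//.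
rewrite -!/(arcmean _); lra.
Qed.

Lemma arc_gt0 (q : {poly R}) : q != 0 -> (forall x, a <= x <= b -> 0 <= q.[x]) -> 0 < arcmean q.
Proof.
move=> q0 qge.
have [s /andP[s1 s2] qs] : exists2 s : R, -1 < s < 1 & q.[c + r * s] != 0.
  pose rs := [seq c + r * (i.+2%:R^-1) | i <- iota 0 (size q)].
  have urs : uniq rs.
    rewrite map_inj_uniq ?iota_uniq// => i j /addrI/(mulfI (lt0r_neq0 r0))/invr_inj.
    by move=> /eqP; rewrite eqr_nat => /eqP [].
  have /allPn[x /mapP[i _ ->] nx] : ~~ all (root q) rs.
    apply/negP => h; have := max_poly_roots q0 h urs.
    by rewrite size_map size_iota ltnn.
  exists (i.+2%:R^-1); last by [].
  rewrite (lt_trans (ltrN10 _)) ?invr_gt0 ?ltr0n//=.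
  by rewrite invf_lt1 ?ltr0n// ltr1n.
apply: (@tmean_gt0 _ _ (asin s)).
- exact: cq.
- by move=> t; exact/qge/sin_box.
- by rewrite asin_gtNpi2 ?asin_ltpi2 ?s1 ?s2// ltW.
- have ss : s \in `[(-1), 1] by rewrite in_itv /= !ltW.
  by rewrite lt_def /= /Phi (asinK ss) qs qge// -{1 2}(asinK ss); exact: sin_box.
Qed.

Let A u := (b - u) * (u - a).

Let A_gt0 u : a < u < b -> 0 < A u.
Proof. by move=> /andP[h1 h2]; rewrite mulr_gt0// subr_gt0. Qed.

Let cw (g : R -> R) x y : continuous g -> a < x -> y < b ->
  {within `[x, y]%classic, continuous (fun u => g u / Num.sqrt (A u))}.
Proof.
move=> cg ax yb; apply: continuous_in_subspaceT => u /set_mem /=; rewrite in_itv /= => /andP[xu uy].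
have Au : 0 < A u by apply: A_gt0; rewrite (lt_le_trans ax)// (le_lt_trans uy).
apply: cvgM; first exact: cg.
apply: cvgV; first by rewrite gt_eqF// sqrtr_gt0.
apply: continuous_comp; last exact: sqrt_continuous.
by apply: cvgM; apply: cvgB; exact: cvg_cst || exact: cvg_id.
Qed.

Let T n : R := pi / 2 - n.+1%:R^-1.

Let T_bound n : 0 <= T n < pi / 2.
Proof.
have h : n.+1%:R^-1 <= 1 :> R by rewrite invf_le1// ler1n.
have h2 : 0 < n.+1%:R^-1 :> R by rewrite invr_gt0.
have := @pihalf_ge1 R; rewrite /T; move: (n.+1%:R^-1) h h2 => y h h2 h3.
by apply/andP; split; lra.
Qed.

Let Phi_lt x y : - (pi / 2) <= x <= pi / 2 -> - (pi / 2) <= y <= pi / 2 -> (Phi x < Phi y) = (x < y).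
Proof. by move=> hx hy; rewrite /Phi ltrD2l (ltr_pM2l r0) ltr_sin. Qed.

Let Phi_le x y : - (pi / 2) <= x <= pi / 2 -> - (pi / 2) <= y <= pi / 2 -> (Phi x <= Phi y) = (x <= y).
Proof. by move=> hx hy; rewrite !leNgt Phi_lt. Qed.

Let PhiN : Phi (- (pi / 2)) = a.
Proof. by rewrite /Phi sinN sin_pihalf /c /r; field. Qed.
Let PhiP : Phi (pi / 2) = b.
Proof. by rewrite /Phi sin_pihalf /c /r; field. Qed.

(** The weight is singular at both ends, so the substitution is made on an
    exhausting sequence of compact intervals. *)
Lemma arcsine_substitution (g : R -> R) : continuous g ->
  (forall x, a <= x <= b -> 0 <= g x) ->
  (\int[mu]_(u in `]a, b[) (g u / Num.sqrt ((b - u) * (u - a)))%:E =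
   \int[mu]_(t in I) (g (Phi t))%:E)%E.
Proof.
move=> cg g0.
have p0 := @pi_gt0 R.
have Tin n : - (pi / 2) < - T n /\ T n < pi / 2.
  by have /andP[h1 h2] := T_bound n; split; lra.
have Tout n : (- (pi / 2) <= - T n <= pi / 2) /\ (- (pi / 2) <= T n <= pi / 2).
  by have /andP[h1 h2] := T_bound n; split; apply/andP; split; lra.
have aT n : a < Phi (- T n) /\ Phi (T n) < b.
  have [h1 h2] := Tin n; have [h3 h4] := Tout n.
  by rewrite -{1}PhiN -PhiP !Phi_lt//; apply/andP; split; lra.
have Tle n m : (n <= m)%N -> T n <= T m.
  by move=> nm; rewrite /T lerD2l lerN2 lef_pV2 ?posrE// ler_nat.
pose G u := g u / Num.sqrt (A u).
pose J n : set R := `[- T n, T n]%classic.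
pose K n : set R := `[Phi (- T n), Phi (T n)]%classic.
have ndJ : nondecreasing_seq J.
  move=> n m nm; apply/subsetPset => t; rewrite /J /= !in_itv /= => /andP[h1 h2].
  by have := Tle _ _ nm => h; apply/andP; split; lra.
have ndK : nondecreasing_seq K.
  move=> n m nm; apply/subsetPset => t; rewrite /K /= !in_itv /= => /andP[h1 h2].
  have [x1 x2] := Tout n; have [x3 x4] := Tout m; have h := Tle _ _ nm.
  rewrite (le_trans _ h1) ?(le_trans h2)// Phi_le//; lra.
have UJ : \bigcup_n J n = `]- (pi / 2), pi / 2[%classic.
  apply/seteqP; split=> [t [n _]|t]; rewrite /J /= !in_itv /=.
    by move=> /andP[h1 h2]; have [h3 h4] := Tin n; apply/andP; split; lra.
  move=> /andP[h1 h2].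
  pose e := Num.min (pi / 2 - t) (t + pi / 2).
  have e0 : 0 < e by rewrite /e lt_min; apply/andP; split; lra.
  have [n hn] : exists n : nat, n.+1%:R^-1 < e.
    exists (Num.truncn e^-1); rewrite -[ltRHS]invrK ltf_pV2 ?posrE ?invr_gt0//.
    exact: truncnS_gt.
  exists n => //; rewrite /J /= in_itv /= /T.
  move: hn; rewrite /e lt_min; move: (n.+1%:R^-1) => y /andP[? ?]; apply/andP; split; lra.
have UK : \bigcup_n K n = `]a, b[%classic.
  apply/seteqP; split=> [u [n _]|u]; rewrite /K /= !in_itv /=.
    by move=> /andP[h1 h2]; have [h3 h4] := aT n; rewrite (lt_le_trans h3)// (le_lt_trans h2).
  move=> /andP[h1 h2]; pose s := (u - c) / r.
  have s12 : -1 < s < 1.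
    by rewrite /s ltr_pdivlMr// ltr_pdivrMr// /c /r; apply/andP; split; lra.
  have /andP[s1 s2] := s12.
  have t12 : (\bigcup_n J n) (asin s).
    by rewrite UJ /= in_itv /= asin_gtNpi2 ?asin_ltpi2 ?s1 ?s2 ?ltW.
  case: t12 => n _; rewrite /J /= in_itv /= => /andP[t1 t2]; exists n => //.
  have -> : u = Phi (asin s).
    rewrite /Phi asinK; last by rewrite in_itv /= !ltW.
    by rewrite /s mulrC divfK ?gt_eqF// addrC subrK.
  have [x1 x2] := Tout n.
  have x3 : - (pi / 2) <= asin s <= pi / 2.
    by case/andP: x1 => *; case/andP: x2 => *; apply/andP; split; lra.
  by rewrite /K /= in_itv /= !Phi_le// t1.
have E n : (\int[mu]_(u in K n) (G u)%:E = \int[mu]_(t in J n) (g (Phi t))%:E)%E.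
  have [a1 a2] := aT n; have [x1 x2] := Tout n; have [y1 y2] := Tin n.
  have dE : derive1 Phi = fun t => r * cos t.
    by apply/funext => t; rewrite derive1E; exact: (@derive_val _ _ _ _ _ _ _ (dPhi t)).
  have cc : continuous (fun t : R => r * cos t).
    by move=> t; apply: cvgM; [exact: cvg_cst|exact: continuous_cos].
  rewrite /K (@integration_by_substitution_increasing _ Phi G)//.
  - apply: eq_integral => t /set_mem; rewrite /J /= in_itv /= => /andP[t1 t2].
    have ct : 0 < cos t by apply: cos_gt0_pihalf; apply/andP; split; lra.
    have rc : 0 < r * cos t by rewrite mulr_gt0.
    rewrite dE /G; congr EFin; rewrite fctE /= /A box_sqr sqrtr_sqr gtr0_norm// divfK//.
    by rewrite gt_eqF.
  - by have /andP[h1 _] := T_bound n; lra.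
  - move=> x y; rewrite !in_itv /= => /andP[h1 h2] /andP[h3 h4] xy.
    by rewrite Phi_lt//; apply/andP; split; lra.
  - by rewrite dE => t _; exact: cc.
  - by rewrite dE; apply/cvg_ex; exists (r * cos (- T n)); apply: cvg_at_right_filter; exact: cc.
  - by rewrite dE; apply/cvg_ex; exists (r * cos (T n)); apply: cvg_at_left_filter; exact: cc.
  - split; first by move=> t _; have [] := dPhi t.
    + by apply: cvg_at_right_filter; exact: cPhi.
    + by apply: cvg_at_left_filter; exact: cPhi.
  - exact: cw.
have lK : (\int[mu]_(u in K n) (G u)%:E)%E @[n --> \oo] --> (\int[mu]_(u in `]a, b[) (G u)%:E)%E.
  rewrite -UK; apply: ge0_nondecreasing_set_cvg_integral => //.
  - by move=> n; exact: measurable_itv.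
  - move=> n; apply/measurable_EFinP; have [a1 a2] := aT n.
    by apply: subspace_continuous_measurable_fun; [exact: measurable_itv|exact: cw].
  - move=> n u; rewrite /K /= in_itv /= => /andP[h1 h2]; rewrite lee_fin.
    have [a1 a2] := aT n; rewrite divr_ge0 ?sqrtr_ge0// g0//.
    by rewrite (le_trans (ltW a1))//= (le_trans h2)// ltW.
have cgP : continuous (g \o Phi).
  by move=> t; apply: continuous_comp; [exact: cPhi|exact: cg].
have mgP (D : set R) : measurable D -> measurable_fun D (fun t => (g (Phi t))%:E).
  move=> mD; apply/measurable_EFinP; apply: measurable_funTS.
  exact: (continuous_measurable_fun cgP).
have lJ : (\int[mu]_(u in J n) (g (Phi u))%:E)%E @[n --> \oo] -->
    (\int[mu]_(u in `](- (pi / 2))%R, (pi / 2)%R[) (g (Phi u))%:E)%E.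
  rewrite -UJ; apply: ge0_nondecreasing_set_cvg_integral => //.
  - by move=> n; exact: measurable_itv.
  - by move=> n; apply: mgP; exact: measurable_itv.
  - by move=> n u _; rewrite lee_fin g0// sin_box.
rewrite (integral_itv_bndoo true false); last exact: mgP.
rewrite (funext E) in lK.
exact: (cvg_unique _ lK lJ).
Qed.

Lemma arcsine_integrable (g : R -> R) : continuous g ->
  mu.-integrable `]a, b[%classic (EFin \o (fun u => g u / Num.sqrt ((b - u) * (u - a)))).
Proof.
move=> cg; have mA : measurable_fun (setT : set R) A.
  apply: continuous_measurable_fun => u.
  by apply: cvgM; apply: cvgB; exact: cvg_cst || exact: cvg_id.
have mw (h : R -> R) : continuous h -> measurable_fun `]a, b[%classic (fun u => h u / Num.sqrt (A u)).
  move=> ch; apply: open_continuous_measurable_fun => // u /set_mem; rewrite /= in_itv /= => aub.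
  have Au := A_gt0 aub.
  apply: cvgM; first exact: ch.
  apply: cvgV; first by rewrite gt_eqF// sqrtr_gt0.
  apply: continuous_comp; last exact: sqrt_continuous.
  by apply: cvgM; apply: cvgB; exact: cvg_cst || exact: cvg_id.
apply/integrableP; split; first by apply/measurable_EFinP; exact: mw.
have cng : continuous (fun u => `|g u|).
  by move=> u; apply: continuous_comp; [exact: cg|exact: norm_continuous].
have -> : (\int[mu]_(u in `]a, b[) `|(g u / Num.sqrt ((b - u) * (u - a)))%R%:E| =
   \int[mu]_(t in I) (`|g (Phi t)|)%:E)%E.
  rewrite -(arcsine_substitution cng) => [|x _]; last exact: normr_ge0.
  apply: eq_integral => u _; rewrite /= normrM normfV.
  by rewrite [X in _ / X]ger0_norm// sqrtr_ge0.
have cc : continuous (fun t => `|g (Phi t)|).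
  by move=> t; apply: cvg_norm; apply: continuous_comp; [exact: cPhi|exact: cg].
rewrite ltey_eq; apply/orP; left.
by apply: integrable_fin_num => //; exact: (tint_integrable cc).
Qed.

Lemma arcsine_integral (g : R -> R) : continuous g ->
  \int[mu]_(u in `]a, b[) (g u / Num.sqrt ((b - u) * (u - a))) = pi * tmean (fun t => g (Phi t)).
Proof.
move=> cg; pose m := Num.max `|a| `|b|; have [K hK] := continuous_bounded_itv m cg.
have hab x : a <= x <= b -> `|g x| <= K.
  move=> /andP[h1 h2]; apply: hK; rewrite /m le_max.
  have [x0|x0] := leP 0 x; last by rewrite ltr0_norm// (_ : - x <= `|a|)// ler_normr lerN2 h1 orbT.
  by rewrite ger0_norm// [x <= `|b|]ler_normr h2 !orbT.
have main (h : R -> R) : continuous h -> (forall x, a <= x <= b -> 0 <= h x) ->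
  \int[mu]_(u in `]a, b[) (h u / Num.sqrt ((b - u) * (u - a))) = pi * tmean (fun t => h (Phi t)).
  move=> ch h0; rewrite /tmean mulrA divff ?gt_eqF ?pi_gt0// mul1r /Rintegral.
  by rewrite (arcsine_substitution ch h0).
have K0 : 0 <= K by apply: le_trans (hab a _); rewrite // lexx ltW.
have cK : continuous (fun _ : R => K) by move=> ?; exact: cvg_cst.
have cgK : continuous (fun u => g u + K) by move=> u; apply: cvgD; [exact: cg|exact: cvg_cst].
have cgP : continuous (fun t => g (Phi t)).
  by move=> t; apply: continuous_comp; [exact: cPhi|exact: cg].
have -> : (fun u => g u / Num.sqrt ((b - u) * (u - a))) =
   (fun u => (g u + K) / Num.sqrt ((b - u) * (u - a)) - K / Num.sqrt ((b - u) * (u - a))).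
  by apply/funext => u; rewrite -mulrBl addrK.
rewrite RintegralB//; [|exact: (arcsine_integrable cgK)|exact: (arcsine_integrable cK)].
rewrite (main _ cgK); last by move=> x /hab; rewrite ler_norml => /andP[]; lra.
rewrite (main _ cK)// tmeanD//.
by ring.
Qed.

End ArcsineLaw.

(** * Expansion at infinity *)

Section TruncatedSeries.
Context {R : realType}.
Implicit Types p q S : {poly R}.

Lemma dvdXnP N p : reflect (forall k, (k < N)%N -> p`_k = 0) ('X^N %| p).
Proof.
apply: (iffP idP) => [/dvdpP[q ->] k kN|h]; first by rewrite coefMXn kN.
rewrite -[p](poly_take_drop N) (_ : take_poly N p = 0) ?add0r ?dvdp_mulIr//.
by apply/polyP => i; rewrite coef_take_poly coef0; case: ifP => // /h.
Qed.

Lemma dvdXn_deriv N p : p`_0 = 0 -> 'X^(N.-1) %| p^`() -> 'X^N %| p.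
Proof.
move=> p0 /dvdXnP h; apply/dvdXnP => -[//|k] kN.
have := h k; rewrite coef_deriv => /(_ _)/eqP; rewrite mulrn_eq0 /=.
by case: N kN {h} => // N kN; move=> /(_ kN)/eqP.
Qed.

Lemma eq_poly_nonzero p q : (forall s : R, s != 0 -> p.[s] = q.[s]) -> p = q.
Proof.
move=> h; apply/eqP; rewrite -subr_eq0; apply/negPn/negP => nz.
pose rs : seq R := [seq i.+1%:R | i <- iota 0 (size (p - q))].
have urs : uniq rs.
  by rewrite map_inj_uniq ?iota_uniq// => i j /eqP; rewrite eqr_nat => /eqP [].
have rrs : all (root (p - q)) rs.
  apply/allP => _ /mapP[i _ ->]; have i0 : i.+1%:R != 0 :> R by rewrite pnatr_eq0.
  by rewrite /root hornerD hornerN h// subrr.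
by have := max_poly_roots nz rrs urs; rewrite size_map size_iota ltnn.
Qed.

(** The reversed polynomial [s ^+ n * p.[s^-1]]: expansions at infinity become
    expansions at [0], carried out modulo powers of the variable. *)
Definition revp n p : {poly R} := \poly_(i < n.+1) p`_(n - i).

Lemma revpE n p (s : R) : (size p <= n.+1)%N -> s != 0 -> (revp n p).[s] = s ^+ n * p.[s^-1].
Proof.
move=> pn s0; rewrite horner_poly (horner_coef_wide _ pn) mulr_sumr.
rewrite (reindex_inj rev_ord_inj) /=; apply: eq_bigr => i _.
have il : (i <= n)%N by rewrite -ltnS.
rewrite subSS subKn// mulrCA; congr (_ * _).
have -> : s ^+ n = s ^+ (n - i) * s ^+ i by rewrite -exprD subnK.
by rewrite exprVn mulfK// expf_neq0.
Qed.

Lemma coef_revp_mul n p S j :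
  (revp n p * S)`_j = \sum_(i < n.+1 | (n <= i + j)%N) p`_i * S`_(i + j - n).
Proof.
rewrite /revp poly_def mulr_suml coef_sum (reindex_inj rev_ord_inj) /= [RHS]big_mkcond /=.
apply: eq_bigr => i _; have il : (i <= n)%N by rewrite -ltnS.
rewrite subSS subKn// -scalerAl coefZ coefXnM.
have -> : (j < n - i)%N = ~~ (n <= i + j)%N by rewrite -ltnNge; lia.
case: leqP => [h|_] /=; last by rewrite mulr0.
by congr (_ * S`_ _); lia.
Qed.

Lemma coef0_revp n p : (revp n p)`_0 = p`_n.
Proof. by rewrite coef_poly subn0. Qed.

Variables (a b : R) (L : nat -> R).
Hypothesis L0 : L 0 = 1.
Hypothesis Lrec : forall k, k.+1%:R * L k.+1 - (2 * k + 1)%:R * ((a + b) / 2 * L k) +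
  k%:R * (a * b * L k.-1) = 0.
Local Notation rA := ((1 - a *: 'X) * (1 - b *: 'X)).

(** With [J] the generating function and [A = rA], the recursion says that
    [A J' = ((a + b) / 2 - a b s) J], so [J ^ 2 A] has zero derivative: [J] is the
    inverse square root of [A]. *)
Lemma gen_fun_sqr N : 'X^N %| (\poly_(i < N) L i) ^+ 2 * rA - 1.
Proof.
case: N => [|N]; first by rewrite expr0 dvd1p.
set J := \poly_(i < _) _.
have JE k : (k < N.+1)%N -> J`_k = L k by move=> kN; rewrite coef_poly kN.
apply: dvdXn_deriv => /=.
  rewrite -horner_coef0 !hornerE /= horner_coef0 JE// L0; ring.
set c := (a + b) / 2.
have -> : (J ^+ 2 * rA - 1)^`() = 2 *: J * (J^`() * (1 - (2 * c) *: 'X + (a * b) *: 'X^2) -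
    (c%:P - (a * b) *: 'X) * J).
  have E : rA = 1 - (2 * c) *: 'X + (a * b) *: 'X^2.
    by apply: eq_poly_nonzero => s _; rewrite !hornerE /= /c; field.
  rewrite E derivB derivC subr0 derivM expr2 derivM derivD derivB derivC !derivZ derivX derivXn /=.
  apply: eq_poly_nonzero => s _; rewrite !hornerE /= /c; ring.
rewrite dvdp_mull//; apply/dvdXnP => k kN.
have -> : J^`() * (1 - (2 * c) *: 'X + (a * b) *: 'X^2) - (c%:P - (a * b) *: 'X) * J =
    J^`() - (2 * c) *: (J^`() * 'X) + (a * b) *: (J^`() * 'X^2) - c *: J + (a * b) *: (J * 'X).
  by apply: eq_poly_nonzero => s _; rewrite !hornerE /=; ring.
rewrite !(coefB, coefD, coefN, coefZ) !coefMX coefMXn !coef_deriv.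
have rec := Lrec k; rewrite -/c in rec.
case: k kN rec => [|[|k]] kN rec; rewrite /= ?coef_deriv ?subn2 /= !JE; do ?[by lia];
  by rewrite -[RHS]rec; ring.
Qed.

End TruncatedSeries.

Section Expansion.
Context {R : realType}.
Variables (V : {poly R}) (Lam : (R -> R) -> R).
Hypothesis HL : loop_state V Lam.
Local Notation D := (discr_poly V Lam).
Local Notation m_ j := (Lam (fun x => x ^+ j)).
Variables (a b : R) (h : {poly R}) (L : nat -> R) (n : nat).
Hypothesis DE : D = ('X - a%:P) * ('X - b%:P) * h ^+ 2.
Hypotheses (sV' : size V^`() = n.+2) (sh : (size h <= n.+1)%N).
Hypotheses (lV' : 0 < lead_coef V^`()) (lh : 0 <= h`_n).
Hypothesis L0 : L 0 = 1.
Hypothesis Lrec : forall k, k.+1%:R * L k.+1 - (2 * k + 1)%:R * ((a + b) / 2 * L k) +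
  k%:R * (a * b * L k.-1) = 0.
Local Notation rA := ((1 - a *: 'X) * (1 - b *: 'X)).
Local Notation rV := (revp n.+1 V^`()).
Local Notation rh := (revp n h).
Local Notation Q := (quot_poly V Lam).

Let sQ : (size Q <= n.+1)%N.
Proof.
apply/leq_sizeP => j hj; apply: quot_poly_coef0.
by move: sV' hj; rewrite size_deriv_real => ->.
Qed.

(** [DE] read at infinity. *)
Lemma revp_discr : rV ^+ 2 - 4 * ('X^(n.+2) * revp n Q) = rA * rh ^+ 2.
Proof.
apply: eq_poly_nonzero => s s0.
have e1 : ('X^(n.+2) * revp n Q).[s] = s ^+ n.+2 * (s ^+ n * Q.[s^-1]).
  by rewrite hornerM hornerXn revpE.
rewrite hornerD hornerN !expr2 [in LHS]hornerM [(4 * _).[s]]hornerM e1 !hornerM !revpE ?sV'//.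
have e4 : (4 : {poly R}).[s] = 4 by rewrite -(polyC_natr _ 4) hornerC.
rewrite e4 !(hornerD, hornerN, hornerZ, hornerX, hornerC).
have := congr1 (fun p : {poly R} => p.[s^-1]) DE.
rewrite /discr_poly hornerD hornerN hornerZ !hornerM !hornerXsubC => E.
have -> : s ^+ n.+1 * V^`().[s^-1] * (s ^+ n.+1 * V^`().[s^-1]) =
  (s ^+ n.+1) ^+ 2 * (4 * Q.[s^-1] + (s^-1 - a) * (s^-1 - b) * (h.[s^-1] * h.[s^-1])) by rewrite -E; ring.
by rewrite !exprS; move: (s ^+ n) => t; field.
Qed.

Lemma coef_quot_poly q : Q`_q = \sum_(i < n.+2 | (q < i)%N) V^`()`_i * m_ (i.-1 - q).
Proof.
rewrite /quot_poly coef_sum sV' [RHS]big_mkcond /=; apply: eq_bigr => i _.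
rewrite coef_sum; case: ltnP => [qi|iq].
  rewrite (bigD1 (Ordinal qi))//= coefZ coefXn eqxx mulr1 big1 ?addr0// => l lq.
  rewrite coefZ coefXn; case: eqP => [E|_]; last by rewrite mulr0.
  by case/eqP: lq; apply: val_inj.
rewrite big1// => l _; rewrite coefZ coefXn; case: eqP => [E|_]; last by rewrite mulr0.
by have := ltn_ord l; rewrite -E ltnNge iq.
Qed.

(** The coefficients of this series, read at infinity from [stieltjes_loop], are the
    loop equations themselves. *)
Lemma loop_series N : 'X^N %| 'X^(n.+2) * (\poly_(i < N) m_ i) ^+ 2 -
  rV * (\poly_(i < N) m_ i) + revp n Q.
Proof.
set m := \poly_(i < N) _; apply/dvdXnP => j jN.
have mE k : (k < N)%N -> m`_k = m_ k by move=> kN; rewrite coef_poly kN.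
rewrite coefD coefB coef_revp_mul coefXnM coef_poly.
have E : \sum_(i < n.+2 | (n.+1 <= i + j)%N) V^`()`_i * m`_(i + j - n.+1) =
    \sum_(i < n.+2 | (n.+1 <= i + j)%N) V^`()`_i * m_ (i + j - n.+1).
  by apply: eq_bigr => i _; rewrite mE//; have := ltn_ord i; lia.
rewrite E; have [jn|nj] := ltnP j n.+1.
  rewrite (leq_trans jn)// coef_quot_poly sub0r addrC; apply/eqP; rewrite subr_eq0; apply/eqP.
  apply: eq_big => i; first by move: (nat_of_ord i) => k; apply/idP/idP; lia.
  by move=> hi; have -> : (i.-1 - (n - j) = i + j - n.+1)%N by lia.
rewrite addr0 (eq_bigl predT); last by move=> i; rewrite (leq_trans nj)// leq_addl.
have -> : \sum_(i < n.+2) V^`()`_i * m_ (i + j - n.+1) = Lam (horner (V^`() * 'X^(j - n.+1))).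
  rewrite (_ : horner _ = fun x => \sum_(i < n.+2) V^`()`_i * x ^+ (i + j - n.+1)).
    rewrite (state_sum HL); last by move=> i; apply: poly_growthZ; exact: poly_growth_power.
    by apply: eq_bigr => i _; rewrite (stateZ HL)//; exact: poly_growth_power.
  apply/funext => x; rewrite hornerM hornerXn (horner_coef V^`()) sV' mulr_suml.
  by apply: eq_bigr => i _; rewrite -mulrA -exprD addnBA.
rewrite (state_loop HL); have [->|jn] := eqVneq j n.+1.
  by rewrite ltnSn subnn big_ord0 subr0.
rewrite ltnNge (_ : (n.+1 < j)%N); last by lia.
rewrite expr2 coefM.
have -> : ((j - n.+2).+1 = j - n.+1)%N by lia.
apply/eqP; rewrite subr_eq0; apply/eqP; apply: eq_bigr => l _.
have hl := ltn_ord l.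
have -> : ((j - n.+1).-1 - l = j - n.+2 - l)%N by lia.
by rewrite !mE//; lia.
Qed.

(** Both [J u] and [rh] are square roots of [rh ^ 2], since [u ^ 2 = A rh ^ 2] and
    [J ^ 2 A = 1]; they are equal rather than opposite because their constant terms
    are both nonnegative and that of [J u] is not [0]. *)
Lemma series_root N : let J := \poly_(i < N) L i in
  let u := rV - 2 * ('X^(n.+2) * \poly_(i < N) m_ i) in
  'X^N %| J * u - rh /\ 'X^N %| u - J * rA * rh.
Proof.
case: N => [|N]; first by move=> J u; rewrite expr0 !dvd1p.
set N1 := N.+1; set m := \poly_(i < _) m_ i => J u.
have /dvdpP[g1 E1] : 'X^N1 %| J ^+ 2 * rA - 1 by exact: gen_fun_sqr.
have /dvdpP[g2 E2] := loop_series N1; rewrite -/m in E2.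
have u2 : u ^+ 2 = rA * rh ^+ 2 + 4 * 'X^(n.+2) * (g2 * 'X^N1).
  by rewrite -revp_discr -E2 /u; ring.
have J0 : J`_0 = 1 by rewrite coef_poly.
have s1 : 'X^N1 %| J * u - rh.
  have : 'X^N1 %| (J * u - rh) * (J * u + rh).
    have -> : (J * u - rh) * (J * u + rh) = (g1 * rh ^+ 2 + J ^+ 2 * (4 * 'X^(n.+2) * g2)) * 'X^N1.
      have -> : (J * u - rh) * (J * u + rh) = J ^+ 2 * u ^+ 2 - rh ^+ 2 by ring.
      have -> : J ^+ 2 * u ^+ 2 - rh ^+ 2 =
          (J ^+ 2 * rA - 1) * rh ^+ 2 + J ^+ 2 * (4 * 'X^(n.+2) * (g2 * 'X^N1)) by rewrite u2; ring.
      by rewrite E1; ring.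
    exact: dvdp_mulIr.
  rewrite Gauss_dvdpl//; rewrite coprimep_expl// coprimep_sym.
  rewrite -['X]subr0 coprimep_XsubC rootE horner_coef0 coefD coef0M J0 mul1r.
  rewrite /u coefB mulr_natl coefMn coefXnM /= mul0rn subr0 !coef0_revp.
  rewrite gt_eqF// ltr_wpDr//.
  by move: lV'; rewrite lead_coefE sV'.
split => //.
have -> : u - J * rA * rh = J * rA * (J * u - rh) - u * (J ^+ 2 * rA - 1) by ring.
by rewrite E1 dvdp_sub// ?dvdp_mull ?dvdp_mulIr// mulrA dvdp_mulIr.
Qed.

Lemma series_coef j : \sum_(i < n.+2 | (n.+1 <= i + j)%N) V^`()`_i * L (i + j - n.+1) -
   (if (j < n.+2)%N then 0 else 2 * \sum_(l < (j - n.+1)%N) L l * m_ (j - n.+2 - l)) =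
   if (j < n.+1)%N then h`_(n - j) else 0.
Proof.
have [+ _] := series_root j.+1; set J := \poly_(i < j.+1) L i; set m := \poly_(i < j.+1) m_ i.
move=> /dvdXnP /(_ j (ltnSn j)) /eqP; rewrite coefB subr_eq0 coef_poly => /eqP <-.
have JE k : (k <= j)%N -> J`_k = L k by move=> kN; rewrite coef_poly ltnS kN.
have mE k : (k <= j)%N -> m`_k = m_ k by move=> kN; rewrite coef_poly ltnS kN.
rewrite mulrBr coefB [J * rV]mulrC coef_revp_mul; congr (_ - _).
  by apply: eq_bigr => i hi; rewrite JE//; have := ltn_ord i; lia.
rewrite [in RHS]mulr_natl mulrnAr coefMn mulrCA coefXnM; case: ltnP => [_|nj]; first by rewrite mul0rn.
rewrite coefM -[RHS]mulr_natl; congr (_ * _); have -> : ((j - n.+2).+1 = j - n.+1)%N by lia.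
apply: eq_bigr => l _; have := ltn_ord l => hl.
by rewrite JE ?mE//; lia.
Qed.

(** The coefficients of [J u = rh] below the order at which the moments enter. *)
Lemma density_coef k : (k <= n)%N ->
  h`_k = \sum_(i < n.+2 | (k < i)%N) V^`()`_i * L (i.-1 - k).
Proof.
move=> kn; have := series_coef (n - k).
have -> : (n - k < n.+2)%N by lia.
have -> : (n - k < n.+1)%N by lia.
rewrite subr0 subKn// => <-.
apply: eq_big => i; first by move: (nat_of_ord i) => l; apply/idP/idP; lia.
by move=> hi; have -> : (i + (n - k) - n.+1 = i.-1 - k)%N by lia.
Qed.

(** The first coefficient of [J u = rh] beyond the degree of [rh]. *)
Lemma support_eq0 : \sum_(i < n.+2) V^`()`_i * L i = 0.
Proof.
have E := series_coef n.+1; rewrite ltnSn ltnn subr0 in E; rewrite -[RHS]E.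
apply: eq_big => i; first by rewrite leq_addl.
by move=> _; rewrite addnK.
Qed.

(** The next coefficient, where the moment [m_0 = 1] enters with a factor [2]. *)
Lemma support_eq1 : \sum_(i < n.+2) V^`()`_i * L i.+1 = 2.
Proof.
have := series_coef n.+2; rewrite ltnn ltnNge leqnSn /= subSnn big_ord1 subnn subn0 L0.
rewrite (state_power0 HL) !mulr1 => /eqP; rewrite subr_eq0 => /eqP E.
rewrite -[RHS]E; apply: eq_big => i; first by rewrite (leq_trans (leqnSn _))// leq_addl.
by move=> _; rewrite -addSnnS addnK.
Qed.

(** The coefficients of [u = J A rh] from the order at which the moments enter. *)
Lemma moment_density k : 2 * m_ k =
  - \sum_(i < n.+3) (('X - a%:P) * ('X - b%:P) * h)`_i * L (i + k).
Proof.
have [_] := series_root (n.+2 + k).+1; set J := \poly_(i < _) L i; set m := \poly_(i < _) m_ i.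
move=> /dvdXnP /(_ (n.+2 + k)%N (ltnSn _)) /eqP; rewrite coefB subr_eq0.
rewrite coefB mulr_natl coefMn coefXnM coef_poly ltnNge leq_addr /= addKn.
rewrite sub0r coef_poly (_ : (k < _)%N); last by lia.
rewrite -mulrA [J * _]mulrC.
have -> : rA * rh = revp n.+2 (('X - a%:P) * ('X - b%:P) * h).
  apply: eq_poly_nonzero => s s0; rewrite hornerM !revpE//; last first.
    have sA : (size (('X - a%:P) * ('X - b%:P) : {poly R})%R <= 3)%N.
      by rewrite (leq_trans (size_polyMleq _ _))// !size_XsubC.
    rewrite (leq_trans (size_polyMleq _ _))// -subn1.
    by have := sh; move: sA; lia.
  by rewrite !hornerM !hornerXsubC !hornerD !hornerN !hornerZ hornerX hornerC !exprS; field.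
rewrite coef_revp_mul => /eqP E; apply/eqP; rewrite -eqr_oppLR -mulNr mulNr mulr_natl E; apply/eqP.
apply: eq_big => i; first by apply: (leq_trans (leq_addr k _)); exact: leq_addl.
move=> _; rewrite coef_poly; have := ltn_ord i => hi.
have -> : (i + (n.+2 + k) - n.+2 = i + k)%N by lia.
by rewrite ifT//; lia.
Qed.

End Expansion.

(** * The limiting density *)

Section Density.
Context {R : realType}.
Variables (V : {poly R}) (n : nat).
Hypotheses (sV : size V = n.+3) (lV : 0 < lead_coef V)
  (convV : forall x, 0 <= V^`()^`().[x]).

Lemma poly_nondecreasing (p : {poly R}) x y : (forall z, 0 <= p^`().[z]) ->
  x <= y -> p.[x] <= p.[y].
Proof.
move=> p0 xy.
have cp : {within `[x, y]%classic, continuous (horner p : R -> R)}.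
  by apply: continuous_subspaceT; exact: continuous_horner.
have [z _ E] := MVT_segment xy (fun z _ => is_derive_poly p z) cp.
by rewrite -subr_ge0 E mulr_ge0// subr_ge0.
Qed.

Definition arcstate (a b : R) (f : R -> R) : R :=
  tmean (fun t => f ((a + b) / 2 + (b - a) / 2 * sin t)).

Lemma arcstate_power a b j : arcstate a b (fun x => x ^+ j) = arcmean a b 'X^j.
Proof. by rewrite /arcmean; congr tmean; apply/funext => t; rewrite hornerXn. Qed.

(** The mean of the difference quotient of [V'] against the arcsine law. *)
Definition density_poly (a b : R) : {poly R} := quot_poly V (arcstate a b).

Lemma arc_sum a b (I : Type) (r : seq I) (F : I -> {poly R}) :
  arcmean a b (\sum_(i <- r) F i) = \sum_(i <- r) arcmean a b (F i).
Proof.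
elim: r => [|i r IH]; last by rewrite !big_cons arcD IH.
by rewrite !big_nil -[X in arcmean a b X](scale0r 1) arcZ mul0r.
Qed.

Lemma arc_mulXn a b k (q : {poly R}) N : (size q <= N)%N ->
  arcmean a b (q * 'X^k) = \sum_(i < N) q`_i * arcmean a b 'X^(i + k).
Proof.
move=> qN; have -> : q = \sum_(i < N) q`_i *: 'X^i by rewrite -poly_def coefK_wide || (apply/polyP => i; rewrite -poly_def coef_poly; case: ltnP => // /(leq_trans qN) h; rewrite nth_default).
rewrite mulr_suml arc_sum; apply: eq_bigr => i _.
by rewrite -scalerAl -exprD arcZ -poly_def coef_poly ltn_ord.
Qed.

Let sV' : size V^`() = n.+2. Proof. by rewrite size_deriv_real sV. Qed.

Definition diff_quot (x : R) : {poly R} :=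
  \sum_(i < size V^`()) \sum_(l < i) (V^`()`_i * x ^+ l) *: 'X^(i.-1 - l).

Lemma diff_quotE x u : (diff_quot x).[u] =
  \sum_(i < size V^`()) \sum_(l < i) V^`()`_i * x ^+ l * u ^+ (i.-1 - l).
Proof.
rewrite horner_sum; apply: eq_bigr => i _; rewrite horner_sum; apply: eq_bigr => l _.
by rewrite hornerZ hornerXn.
Qed.

Lemma diff_quotP x u : (x - u) * (diff_quot x).[u] = V^`().[x] - V^`().[u].
Proof. by rewrite diff_quotE poly_diff_quot. Qed.

Lemma diff_quot_ge0 x u : 0 <= (diff_quot x).[u].
Proof.
have [<-|xu] := eqVneq x u; first by rewrite diff_quotE poly_diff_quot_diag.
have [h|h] := ltP x u.
  have := poly_nondecreasing convV (ltW h); rewrite -subr_le0 -diff_quotP.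
  by rewrite nmulr_rle0// subr_lt0.
have h' : u < x by rewrite lt_neqAle eq_sym xu.
have := poly_nondecreasing convV h; rewrite -subr_ge0 -diff_quotP.
by rewrite pmulr_rge0// subr_gt0.
Qed.

Lemma horner_density_poly a b x : (density_poly a b).[x] = arcmean a b (diff_quot x).
Proof.
rewrite /density_poly /quot_poly horner_sum /diff_quot arc_sum; apply: eq_bigr => i _.
rewrite horner_sum arc_sum; apply: eq_bigr => l _.
by rewrite hornerZ hornerXn arcZ arcstate_power mulrAC.
Qed.

(** The difference quotient and [diff_quot] differ at most at the point [u = x]. *)
Lemma density_factorE a b x : a < b ->
  density_factor V a b x = (density_poly a b).[x] / (2 * pi).
Proof.
move=> ab; rewrite horner_density_poly /density_factor.
have p0 := @pi_gt0 R.
have -> : \int[lebesgue_measure]_(u in `]a, b[)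
    ((V^`().[x] - V^`().[u]) / (x - u) / Num.sqrt ((b - u) * (u - a))) =
  \int[lebesgue_measure]_(u in `]a, b[)
    ((diff_quot x).[u] / Num.sqrt ((b - u) * (u - a))).
  have E (u : R) : u != x -> (V^`().[x] - V^`().[u]) / (x - u) = (diff_quot x).[u].
    by move=> ux; rewrite -diff_quotP mulrAC divff ?mul1r// subr_eq0 eq_sym.
  have mD : measurable (`]a, b[%classic `\ x : set R) by exact: measurableD.
  have mg : measurable_fun (`]a, b[%classic `\ x : set R)
      (fun u => ((diff_quot x).[u] / Num.sqrt ((b - u) * (u - a)))%:E).
    have cdq : continuous (horner (diff_quot x) : R -> R) by exact: continuous_horner.
    have := arcsine_integrable ab cdq.
    move=> /(measurable_int _)/(measurable_funS _ _); apply => //.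
  rewrite /Rintegral -(@integral_setD1 _ _ x)//; last first.
    apply: eq_measurable_fun mg => u /set_mem [_ /eqP ux].
    by rewrite E.
  rewrite -(@integral_setD1 _ (fun u => ((diff_quot x).[u] / Num.sqrt ((b - u) * (u - a)))%:E) x)//.
  by congr fine; apply: eq_integral => u /set_mem [_ /eqP ux]; rewrite E.
have pn0 : pi != 0 :> R by rewrite gt_eqF.
have cdq : continuous (horner (diff_quot x) : R -> R) by exact: continuous_horner.
rewrite (arcsine_integral ab cdq) -/(arcmean a b (diff_quot x)); move: pn0; move: (pi : R) => z z0; field; exact: z0.
Qed.

Let lV' : 0 < lead_coef V^`().
Proof. by apply: lead_coef_deriv_gt0 => //; rewrite sV. Qed.

Let V'top : 0 < V^`()`_n.+1.
Proof. by have := lV'; rewrite lead_coefE sV'. Qed.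

Lemma density_poly_gt0 a b x : a < b -> 0 < (density_poly a b).[x].
Proof.
move=> ab; rewrite horner_density_poly; apply: arc_gt0 => // [|u _]; last exact: diff_quot_ge0.
apply/eqP => h0; have : 0 < (diff_quot x)`_n.
  rewrite /diff_quot coef_sum sV' (bigD1 ord_max)//= [X in _ + X]big1 ?addr0 => [|i ni].
    rewrite coef_sum (bigD1 ord0)//= big1 ?addr0 => [|l nl].
      by rewrite subn0 coefZ coefXn eqxx !mulr1 V'top.
    rewrite coefZ coefXn; case: eqP => [E|_]; last by rewrite mulr0.
    by case/eqP: nl; apply: val_inj => /=; have := ltn_ord l; lia.
  rewrite coef_sum big1// => l _; rewrite coefZ coefXn; case: eqP => [E|_]; last by rewrite mulr0.
  case/eqP: ni; apply: val_inj => /=; have := ltn_ord i; have := ltn_ord l; lia.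
by rewrite h0 coef0 ltxx.
Qed.

Lemma size_density_poly a b : size (density_poly a b) = n.+1.
Proof.
apply/eqP; rewrite eqn_leq; apply/andP; split.
  by apply/leq_sizeP => j hj; apply: quot_poly_coef0; rewrite sV.
rewrite leqNgt; apply/negP => h.
have : (density_poly a b)`_n = 0 by rewrite nth_default.
rewrite (coef_quot_poly _ sV') (bigD1 ord_max)//= big1 ?addr0 => [|i /andP[h1 h2]].
  rewrite subnn arcstate_power expr0 arc1 mulr1 => E; have := V'top; by rewrite E ltxx.
by case/eqP: h2; apply: val_inj => /=; have := ltn_ord i; lia.
Qed.

(** Matching the expansion of the square root of the discriminant at infinity.  The
    multiplier [L] of the expansion is the arcsine law of [[a, b]]. *)
Lemma exists_support Lam (HL : loop_state V Lam) (b0 : R) (b0_gt0 : 0 < b0)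
  (supp : forall f (e : R), poly_growth f -> (forall x, `|x| <= b0 -> `|f x| <= e) -> `|Lam f| <= e) :
  odd (size V) ->
  exists a b : R, [/\ a < b, arcmean a b V^`() = 0, arcmean a b ('X * V^`()) = 2 &
    forall k, 2 * Lam (fun x => x ^+ k) =
      arcmean a b ('X^k * ((b%:P - 'X) * ('X - a%:P) * density_poly a b))].
Proof.
move=> oV; have s1 : (1 < size V)%N by rewrite sV.
have [a [b [h [ab DE sh lh]]]] := discr_factor HL b0_gt0 supp oV s1 lV convV.
have sh' : size h = n.+1 by rewrite sh sV.
have sh1 : (size h <= n.+1)%N by rewrite sh'.
have hn : 0 <= h`_n by move: lh; rewrite lead_coefE sh' => /ltW.
have V't := lV'.
have [E|nab] := eqVneq a b.
  (* if [a = b], the arcsine law is the point mass at [a], whose moments satisfy the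
     same recursion; then the first equation multiplied by [a] contradicts the second *)
  exfalso; subst b.
  have Lrec k : k.+1%:R * a ^+ k.+1 - (2 * k + 1)%:R * ((a + a) / 2 * a ^+ k) +
      k%:R * (a * a * a ^+ k.-1) = 0.
    case: k => [|k] /=; first by rewrite expr0 expr1; field.
    by rewrite !exprS; field.
  have e0 := support_eq0 HL DE sV' sh1 V't hn (expr0 a) Lrec.
  have e1 := support_eq1 HL DE sV' sh1 V't hn (expr0 a) Lrec.
  have : \sum_(i < n.+2) V^`()`_i * a ^+ i.+1 = a * \sum_(i < n.+2) V^`()`_i * a ^+ i.
    by rewrite mulr_sumr; apply: eq_bigr => i _; rewrite exprS mulrCA.
  by rewrite e0 e1 mulr0 => /eqP; rewrite pnatr_eq0.
have ltab : a < b by rewrite lt_neqAle nab.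
pose L k := arcmean a b 'X^k.
have L0 : L 0 = 1 by rewrite /L expr0 arc1.
have Lrec := arc_recursion a b.
have e0 := support_eq0 HL DE sV' sh1 V't hn L0 Lrec.
have e1 := support_eq1 HL DE sV' sh1 V't hn L0 Lrec.
have hE : h = density_poly a b.
  apply/polyP => k; have [kn|kn] := leqP k n.
    rewrite (density_coef HL DE sV' sh1 V't hn L0 Lrec kn) (coef_quot_poly _ sV').
    by apply: eq_bigr => i _; rewrite arcstate_power.
  by rewrite !nth_default ?size_density_poly ?sh'.
exists a, b; split=> //.
- rewrite -[V^`()]mulr1 -(expr0 'X) (arc_mulXn a b 0 (N := n.+2)) ?sV'//.
  by rewrite -[RHS]e0; apply: eq_bigr => i _; rewrite addn0.
- rewrite mulrC -(expr1 'X) (arc_mulXn a b 1 (N := n.+2)) ?sV'//.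
  by rewrite -[RHS]e1; apply: eq_bigr => i _; rewrite addn1.
- move=> k; rewrite (moment_density HL DE sV' sh1 V't hn L0 Lrec k) -hE.
  have -> : 'X^k * ((b%:P - 'X) * ('X - a%:P) * h) =
     (-1) *: (('X - a%:P) * ('X - b%:P) * h * 'X^k) by rewrite scaleN1r; ring.
  rewrite arcZ (arc_mulXn a b k (N := n.+3)) ?mulN1r//.
  have sA : (size (('X - a%:P) * ('X - b%:P) : {poly R})%R <= 3)%N.
    by rewrite (leq_trans (size_polyMleq _ _))// !size_XsubC.
  rewrite (leq_trans (size_polyMleq _ _))// -subn1.
  by move: sA; rewrite sh'; move: (size _) => z; clear; lia.
Qed.

(** A period would make [q - q.[0]] vanish at all its multiples. *)
Lemma poly_not_periodic (q : {poly R}) (d : R) : d != 0 -> (1 < size q)%N ->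
  exists u, q.[u + d] != q.[u].
Proof.
move=> d0 sq; apply: contrapT => h.
have E k : q.[k%:R * d] = q.[0].
  elim: k => [|k IH]; first by rewrite mul0r.
  rewrite -IH -natr1 mulrDl mul1r; apply/eqP/negPn/negP => ne.
  by apply: h; exists (k%:R * d).
have qq : q - q.[0]%:P != 0.
  by apply/eqP => /eqP; rewrite subr_eq0 => /eqP E'; move: sq; rewrite E' size_polyC; case: eqP.
pose rs : seq R := [seq k%:R * d | k <- iota 0 (size (q - q.[0]%:P))].
have urs : uniq rs.
  rewrite map_inj_uniq ?iota_uniq// => i j /(mulIf d0) /eqP.
  by rewrite eqr_nat => /eqP.
have rrs : all (root (q - q.[0]%:P)) rs.
  by apply/allP => _ /mapP[i _ ->]; rewrite /root hornerD hornerN hornerC E subrr.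
by have := max_poly_roots qq rrs urs; rewrite size_map size_iota ltnn.
Qed.

(** Two solutions give two arcsine variables [X] and [X'] driven by the same angle.
    By monotonicity the mean of [(V'(X) - V'(X')) (X - X')] is nonnegative, while the
    equations evaluate it to [- 2 (r - r') ^ 2 / (r r')]; so the radii agree and the
    mean is [0].  If the centers differed, [X - X'] would be constant and the integrand
    a nonzero nonnegative polynomial in [X']. *)
Lemma support_unique a b a' b' : a < b -> a' < b' ->
  arcmean a b V^`() = 0 -> arcmean a b ('X * V^`()) = 2 ->
  arcmean a' b' V^`() = 0 -> arcmean a' b' ('X * V^`()) = 2 -> a' = a /\ b' = b.
Proof.
move=> ab ab' e0 e1 e0' e1'.
pose c := (a + b) / 2; pose r := (b - a) / 2.
pose c' := (a' + b') / 2; pose r' := (b' - a') / 2.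
have r0 : 0 < r by rewrite divr_gt0// subr_gt0.
have r0' : 0 < r' by rewrite divr_gt0// subr_gt0.
pose X t := c + r * sin t; pose X' t := c' + r' * sin t.
have cX (k s : R) (q : {poly R}) : continuous (fun t => q.[k + s * sin t]).
  move=> t; apply: (@continuous_comp _ _ _ (fun t => k + s * sin t)); last exact: continuous_horner.
  by apply: cvgD; [exact: cvg_cst|apply: cvgM; [exact: cvg_cst|exact: continuous_sin]].
have cZ (z k s : R) (q : {poly R}) : continuous (fun t => z * q.[k + s * sin t]).
  by move=> t; apply: cvgM; [exact: cvg_cst|exact: cX].
have mix (k1 s1 k2 s2 : R) : s1 != 0 -> tmean (fun t => V^`().[k1 + s1 * sin t]) = 0 ->
    tmean (fun t => ('X * V^`()).[k1 + s1 * sin t]) = 2 ->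
    tmean (fun t => V^`().[k1 + s1 * sin t] * (k2 + s2 * sin t)) = 2 * (s2 / s1).
  move=> s10 h0 h1.
  rewrite (_ : (fun t => _) = fun t => (k2 - s2 / s1 * k1) * V^`().[k1 + s1 * sin t] +
      s2 / s1 * ('X * V^`()).[k1 + s1 * sin t]); last first.
    by apply/funext => t; rewrite hornerM hornerX; field.
  by rewrite tmeanD ?tmeanZ// h0 h1; ring.
have cM (k1 s1 k2 s2 : R) : continuous (fun t => V^`().[k1 + s1 * sin t] * (k2 + s2 * sin t)).
  move=> t; apply: cvgM; first exact: cX.
  by apply: cvgD; [exact: cvg_cst|apply: cvgM; [exact: cvg_cst|exact: continuous_sin]].
pose F t := (V^`().[X t] - V^`().[X' t]) * (X t - X' t).
have FE : F = fun t => (V^`().[X t] * X t - V^`().[X t] * X' t) -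
    (V^`().[X' t] * X t - V^`().[X' t] * X' t) by apply/funext => t; rewrite /F; ring.
have cB (k1 s1 k2 s2 k3 s3 : R) : continuous (fun t => V^`().[k1 + s1 * sin t] * (k2 + s2 * sin t) -
    V^`().[k1 + s1 * sin t] * (k3 + s3 * sin t)) by move=> t; apply: cvgB; exact: cM.
have TF : tmean F = 4 - 2 * (r' / r) - 2 * (r / r').
  rewrite FE tmeanB; [|exact: cB|exact: cB].
  rewrite !tmeanB; [|exact: cM|exact: cM|exact: cM|exact: cM].
  have n0 : r != 0 by rewrite gt_eqF.
  have n0' : r' != 0 by rewrite gt_eqF.
  rewrite (mix _ _ _ _ n0 e0 e1) (mix _ _ _ _ n0 e0 e1) (mix _ _ _ _ n0' e0' e1') (mix _ _ _ _ n0' e0' e1').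
  by field; rewrite n0 n0'.
have F0 t : 0 <= F t.
  rewrite /F; have [h|h] := leP (X t) (X' t).
    by rewrite mulr_le0// subr_le0// poly_nondecreasing.
  by rewrite mulr_ge0// subr_ge0 ?poly_nondecreasing// ltW.
have cF : continuous F by rewrite FE => t; apply: cvgB; exact: cB.
have rr : r = r'.
  have : 0 <= tmean F by rewrite -(tmean_cst 0); apply: tmean_le => // t; exact: cvg_cst.
  have k0 : 0 < 2 / (r * r') by rewrite divr_gt0// mulr_gt0.
  rewrite TF (_ : _ - _ = - ((r - r') ^+ 2 * (2 / (r * r')))); last by field; rewrite !gt_eqF.
  rewrite oppr_ge0 (pmulr_lle0 _ k0) => h.
  by apply/eqP; rewrite -subr_eq0 -sqrf_eq0 eq_le h sqr_ge0.
have cc : c = c'.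
  apply/eqP/negPn/negP => ncc; pose d := c - c'.
  have d0 : d != 0 by rewrite subr_eq0.
  pose q : {poly R} := d *: (V^`() \Po ('X + d%:P) - V^`()).
  have qE u : q.[u] = d * (V^`().[u + d] - V^`().[u]).
    by rewrite /q hornerZ hornerD hornerN horner_comp hornerD hornerX hornerC.
  have qF : (fun t => q.[X' t]) = F.
    apply/funext => t; rewrite qE /F.
    have -> : X' t + d = X t by rewrite /X /X' /d rr; ring.
    by rewrite (_ : X t - X' t = d) 1?mulrC// /X /X' /d rr; ring.
  have sz : (1 < size V^`())%N by rewrite sV'.
  have [u hu] := poly_not_periodic d0 sz.
  have q0 : q != 0.
    apply/eqP => q0; move: hu; have := qE u; rewrite q0 horner0 => /esym/eqP.
    by rewrite mulf_eq0 (negPf d0) subr_eq0 /= => ->.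
  have : 0 < arcmean a' b' q.
    apply: arc_gt0 => // x _; rewrite qE; have [h|h] := leP 0 d.
      by rewrite mulr_ge0// subr_ge0 poly_nondecreasing// lerDl.
    by rewrite mulr_le0 ?(ltW h)// subr_le0 poly_nondecreasing// gerDl ltW.
  rewrite /arcmean -/c' -/r' (_ : (fun t => _) = F); last exact: qF.
  by rewrite TF rr divff ?gt_eqF// (_ : _ - _ = 0) ?ltxx//; ring.
move: rr cc; rewrite /r /r' /c /c' => h1 h2; split; lra.
Qed.

End Density.

(** * The limit law *)

Section DensityMeasure.
Context {R : realType}.
Local Notation mu := (@lebesgue_measure R).
Local Notation RM := (measurableTypeR R).
Variable rho : R -> R.
Hypotheses (rho0 : forall x, 0 <= rho x)
  (irho : mu.-integrable setT (EFin \o rho)).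

Let mrho : measurable_fun setT (EFin \o rho) := measurable_int _ irho.

Definition density_measure (A : set RM) : \bar R := (\int[mu]_(x in A) (rho x)%:E)%E.

Let density_measure0 : density_measure set0 = 0%E.
Proof. by rewrite /density_measure integral_set0. Qed.

Let density_measure_ge0 A : (0 <= density_measure A)%E.
Proof. by apply: integral_ge0 => x _; rewrite lee_fin. Qed.

Let density_measure_sigma_additive : semi_sigma_additive density_measure.
Proof.
move=> F mF tF mUF; rewrite /density_measure; apply: cvg_toP.
  apply: ereal_nondecreasing_is_cvgn => m n mn.
  by apply: lee_sum_nneg_natr => // k _ _; apply: integral_ge0 => x _; rewrite lee_fin.
rewrite ge0_integral_bigcup//=; first exact: measurable_funTS.
by move=> x _; rewrite lee_fin.
Qed.

HB.instance Definition _ := isMeasure.Build _ _ _ density_measure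
  density_measure0 density_measure_ge0 density_measure_sigma_additive.

Let density_measure_fin : fin_num_fun density_measure.
Proof.
move=> A mA; rewrite ge0_fin_numE//.
apply: (@le_lt_trans _ _ (\int[mu]_x (rho x)%:E)%E).
  by apply: ge0_subset_integral => //= x _; rewrite lee_fin.
have /integrableP[_] := irho.
by under eq_integral => x _ do rewrite /= ger0_norm//.
Qed.

HB.instance Definition _ := Measure_isFinite.Build _ _ _ density_measure density_measure_fin.

(** Domination is what the change of variables through the Radon-Nikodym derivative
    asks for. *)
Lemma density_measure_dom : density_measure `<< mu.
Proof.
apply/null_content_dominatesP => A mA A0; rewrite /density_measure.
by apply: null_set_integral => //; exact: measurable_funTS.
Qed.

Lemma exists_density_measure : exists N : {measure set RM -> \bar R},
  (forall A, N A = \int[mu]_(x in A) (rho x)%:E)%E /\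
  forall f : R -> R, continuous f -> bounded_fun f ->
    \int[N]_x f x = \int[mu]_x (f x * rho x).
Proof.
exists density_measure; split=> // f cf bf.
rewrite /Rintegral; congr fine.
have mf : measurable_fun setT f by exact: continuous_measurable_fun.
have iff : density_measure.-integrable setT (EFin \o f).
  apply: measurable_bounded_integrable => //.
  by rewrite -ge0_fin_numE//; exact: density_measure_fin.
rewrite -(Radon_Nikodym_change_of_variables density_measure_dom)//.
apply: ae_eq_integral => //.
- apply: emeasurable_funM => //; [exact/measurable_EFinP|apply: (measurable_int mu)].
  by apply: Radon_Nikodym_integrable; exact: density_measure_dom.
- apply/measurable_EFinP; apply: measurable_funM => //; exact/measurable_EFinP.
- rewrite (_ : (fun x => (f x * rho x)%:E) = (fun x => ((f x)%:E * (rho x)%:E)%E)).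
    apply: ae_eqe_mul2l; rewrite Radon_NikodymE; first exact: density_measure_dom.
    move=> dom; case: cid => /= h [h1 h2 h3].
    by apply: integral_ae_eq => // E _ mE; rewrite -h3.
  by apply/funext => x; rewrite EFinM.
Qed.

End DensityMeasure.

Section LimitLaw.
Context {R : realType}.
Local Notation mu := (@lebesgue_measure R).
Local Notation RM := (measurableTypeR R).
Variables (V : {poly R}) (n : nat).
Hypotheses (sV : size V = n.+3) (lV : 0 < lead_coef V)
  (convV : forall x, 0 <= V^`()^`().[x]).
Variables a b : R.
Hypothesis ab : a < b.
Let Phi t := (a + b) / 2 + (b - a) / 2 * sin t.
Let w : {poly R} := (b%:P - 'X) * ('X - a%:P) * density_poly V a b.

(** The limit law in the angular variable: the square root of the density and the
    Jacobian multiply to [(b - u) (u - a)]. *)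
Definition limit_mean (f : R -> R) : R :=
  tmean (fun t => f ((a + b) / 2 + (b - a) / 2 * sin t) *
    (((b%:P - 'X) * ('X - a%:P) * density_poly V a b).[(a + b) / 2 + (b - a) / 2 * sin t] / 2)).

Let wE u : w.[u] = (b - u) * (u - a) * (density_poly V a b).[u].
Proof. by rewrite /w !hornerE. Qed.

Let cPhi : continuous Phi.
Proof.
move=> t; apply: cvgD; first exact: cvg_cst.
by apply: cvgM; [exact: cvg_cst|exact: continuous_sin].
Qed.

Let cw : continuous (fun t => w.[Phi t] / 2).
Proof.
move=> t; apply: cvgM; last exact: cvg_cst.
by apply: continuous_comp; [exact: cPhi|exact: continuous_horner].
Qed.

Let cfw (f : R -> R) : continuous f -> continuous (fun t => f (Phi t) * (w.[Phi t] / 2)).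
Proof.
move=> cf t; apply: cvgM; last exact: cw.
by apply: continuous_comp; [exact: cPhi|exact: cf].
Qed.

Let w_ge0 t : 0 <= w.[Phi t] / 2.
Proof.
have /andP[h1 h2] := sin_box ab t.
rewrite divr_ge0// wE mulr_ge0 ?mulr_ge0 ?subr_ge0// ltW//.
exact: (density_poly_gt0 sV lV convV).
Qed.

Let limit_densityE : limit_density V a b =
  (fun u => w.[u] / (2 * pi) / Num.sqrt ((b - u) * (u - a))) \_ `]a, b[%classic.
Proof.
apply/funext => u; rewrite /limit_density patchE; case: ifPn => [/andP[au ub]|nab].
  case: ifPn => [/set_mem|]; rewrite ?/(_ `]a, b[) /= ?in_itv /=.
    move=> aub; rewrite (density_factorE V u ab) wE.
    have A0 : 0 < (b - u) * (u - a) by case/andP: aub => *; rewrite mulr_gt0// subr_gt0.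
    have sA : Num.sqrt ((b - u) * (u - a)) != 0 by rewrite gt_eqF// sqrtr_gt0.
    have pn0 : pi != 0 :> R by rewrite gt_eqF ?pi_gt0.
    rewrite -{2}(sqr_sqrtr (ltW A0)); move: (Num.sqrt _) sA (pi : R) pn0 => s s0 p p0.
    by field; rewrite s0.
  move=> /negP h; have [E|nu] := eqVneq u a; first by rewrite E subrr mulr0 sqrtr0 mulr0.
  have [E|nb] := eqVneq u b; first by rewrite E subrr mul0r sqrtr0 mulr0.
  exfalso; apply: h; apply: mem_set; rewrite /= in_itv /=.
  by rewrite !lt_neqAle au ub nb eq_sym nu.
rewrite ifF//; apply/negP => /set_mem; rewrite /= in_itv /= => /andP[h1 h2].
by move: nab; rewrite !ltW.
Qed.

Lemma exists_limit_law : exists N : {measure set RM -> \bar R},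
  (forall A : set RM, measurable A -> N A = \int[mu]_(x in A) (limit_density V a b x)%:E)%E /\
  forall f : R -> R, continuous f -> bounded_fun f -> \int[N]_x f x = limit_mean f.
Proof.
have p0 := @pi_gt0 R.
have cg (f : R -> R) : continuous f -> continuous (fun u => f u * (w.[u] / (2 * pi))).
  by move=> cf u; apply: cvgM; [exact: cf|apply: cvgM; [exact: continuous_horner|exact: cvg_cst]].
have c1 : continuous (fun u => w.[u] / (2 * pi)).
  by move=> u; apply: cvgM; [exact: continuous_horner|exact: cvg_cst].
have rho0 x : 0 <= limit_density V a b x.
  rewrite limit_densityE patchE; case: ifPn => // /set_mem; rewrite /= in_itv /= => /andP[h1 h2].
  rewrite divr_ge0 ?sqrtr_ge0// divr_ge0 ?mulr_ge0 ?(ltW p0)// wE.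
  rewrite !mulr_ge0 ?subr_ge0 ?(ltW h1) ?(ltW h2)// ltW//.
  exact: (density_poly_gt0 sV lV convV).
have irho : mu.-integrable setT (EFin \o limit_density V a b).
  rewrite limit_densityE -restrict_EFin -integrable_mkcond//.
  exact: (arcsine_integrable ab c1).
have [N [NE Nf]] := exists_density_measure rho0 irho.
exists N; split=> [A _|f cf bf]; first exact: NE.
rewrite Nf// limit_densityE.
have -> : \int[mu]_x (f x * ((fun u => w.[u] / (2 * pi) / Num.sqrt ((b - u) * (u - a))) \_ `]a, b[%classic) x) =
   \int[mu]_(x in `]a, b[) (f x * (w.[x] / (2 * pi)) / Num.sqrt ((b - x) * (x - a))).
  rewrite [RHS]Rintegral_mkcond; congr Rintegral; apply/funext => x.
  by rewrite !patchE; case: ifP; rewrite ?mulr0// mulrA.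
rewrite (arcsine_integral ab (cg f cf)) -tmeanZ; last first.
  by move=> t; apply: (@continuous_comp _ _ _ Phi (fun u => f u * (w.[u] / (2 * pi)))); [exact: cPhi|exact: cg].
rewrite /limit_mean; congr tmean; apply/funext => t.
have pn0 : pi != 0 :> R by rewrite gt_eqF.
by rewrite -/w; move: (pi : R) pn0 => p pn; field.
Qed.

(** Both sides agree on polynomials by [mE], are bounded by the sup on a compact
    interval, and polynomials are dense there. *)
Lemma state_limit_mean Lam (HL : loop_state V Lam) (b0 : R)
  (supp : forall f (e : R), poly_growth f -> (forall x, `|x| <= b0 -> `|f x| <= e) -> `|Lam f| <= e)
  (mE : forall k, 2 * Lam (fun x => x ^+ k) = arcmean a b ('X^k * w)) f :
  continuous f -> poly_growth f -> Lam f = limit_mean f.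
Proof.
move=> cf pf.
have polyE (q : {poly R}) : Lam (horner q) = limit_mean (horner q).
  have -> : limit_mean (horner q) = 2^-1 * arcmean a b (q * w).
    rewrite /arcmean -tmeanZ; last first.
      by move=> t; apply: (@continuous_comp _ _ _ Phi (horner (q * w))); [exact: cPhi|exact: continuous_horner].
    by congr tmean; apply/funext => t; rewrite [(q * w).[_]]hornerM mulrA [RHS]mulrC.
  have -> : q * w = \sum_(i < size q) q`_i *: ('X^i * w).
    by rewrite -{1}[q]coefK poly_def mulr_suml; apply: eq_bigr => i _; rewrite scalerAl.
  rewrite arc_sum (state_poly HL) mulr_sumr; apply: eq_bigr => i _.
  by rewrite arcZ -mE mulrCA mulKf ?pnatr_eq0.
have one : limit_mean (fun=> 1) = 1.
  have -> : (fun=> 1) = horner (1 : {poly R}) by apply/funext => x; rewrite hornerC.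
  by rewrite -polyE -[RHS](state1 HL); congr Lam; apply/funext => x; rewrite hornerC.
pose B := Num.max b0 (Num.max `|a| `|b|).
have PhiB t : `|Phi t| <= B.
  have /andP[h1 h2] := sin_box ab t; rewrite /B !le_max; apply/orP; right.
  rewrite -/(Phi t) in h1 h2.
  have [x0|x0] := leP 0 (Phi t).
    by rewrite ger0_norm// [_ <= `|b|]ler_normr h2 orbT.
  by rewrite ltr0_norm// [_ <= `|a|]ler_normr lerN2 h1 orbT.
apply/eqP; rewrite -subr_eq0 -normr_le0; apply/ler_addgt0Pl => e e0; rewrite addr0.
have e2 : 0 < e / 2 by rewrite divr_gt0.
have [q hq] := weierstrass B cf e2.
have h1 : `|Lam f - Lam (horner q)| <= e / 2.
  rewrite -(stateB HL)//; last exact: poly_growth_poly.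
  apply: supp => [|x xb]; first by apply: poly_growthB => //; exact: poly_growth_poly.
  by apply: hq; rewrite /B le_max xb.
have h2 : `|limit_mean (horner q) - limit_mean f| <= e / 2.
  have cq : continuous (horner q : R -> R) by exact: continuous_horner.
  have E : limit_mean (horner q) - limit_mean f = tmean (fun t => (q.[Phi t] - f (Phi t)) * (w.[Phi t] / 2)).
    rewrite /limit_mean -tmeanB; [|exact: cfw|exact: cfw].
    by congr tmean; apply/funext => t; rewrite -mulrBl.
  have ce : continuous (fun t => e / 2 * (w.[Phi t] / 2)) by move=> t; apply: cvgM; [exact: cvg_cst|exact: cw].
  have ce' : continuous (fun t => - (e / 2) * (w.[Phi t] / 2)) by move=> t; apply: cvgM; [exact: cvg_cst|exact: cw].
  have one' : tmean (fun t => w.[Phi t] / 2) = 1.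
    by rewrite -[RHS]one /limit_mean; congr tmean; apply/funext => t; rewrite mul1r.
  have cd : continuous (fun t => (q.[Phi t] - f (Phi t)) * (w.[Phi t] / 2)).
    apply: (cfw (f := fun u => q.[u] - f u)) => u.
    by apply: cvgB; [exact: cq|exact: cf].
  have tk k : k = tmean (fun t => k * (w.[Phi t] / 2)) by rewrite tmeanZ// one' mulr1.
  rewrite E ler_norml; apply/andP; split.
    rewrite [leLHS]tk; apply: tmean_le => // t; apply: ler_wpM2r; first exact: w_ge0.
    by have := hq _ (PhiB t); rewrite ler_norml => /andP[]; lra.
  rewrite [leRHS]tk; apply: tmean_le => // t; apply: ler_wpM2r; first exact: w_ge0.
  by have := hq _ (PhiB t); rewrite ler_norml => /andP[]; lra.
rewrite (_ : Lam f - _ = (Lam f - Lam (horner q)) + (limit_mean (horner q) - limit_mean f)); last first.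
  by rewrite polyE; ring.
by rewrite (le_trans (ler_normD _ _))// [e]splitr lerD.
Qed.

End LimitLaw.

(** * Convergence of the empirical spectral measures *)

Section Empirical.
Context {R : realType}.
Local Notation RM := (measurableTypeR R).

Lemma Rintegral_empirical_measure n (A : 'M[R[i]]_n.+1) (f : R -> R) :
  A \is hermsymmx -> measurable_fun setT f ->
  \int[empirical_measure A]_x f x = mean (eigenvalues A) f.
Proof.
move=> hA mf; have sA := size_eigenvalues hA.
have mpos : measurable_fun setT (EFin \o f)^\+%E.
  by apply: measurable_funepos; exact/measurable_EFinP.
have mneg : measurable_fun setT (EFin \o f)^\-%E.
  by apply: measurable_funeneg; exact/measurable_EFinP.
have main (g : R -> R) (h : R -> \bar R) : (forall x, h x = (g x)%:E) -> (forall x, 0 <= g x) ->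
    measurable_fun setT h ->
    (\int[empirical_measure A]_x h x = (mean (eigenvalues A) g)%:E)%E.
  move=> hg g0 mh.
  have h0 x : setT x -> (0 <= h x)%E by move=> _; rewrite hg lee_fin.
  rewrite /empirical_measure ge0_integral_mscale// ge0_integral_measure_sum//.
  under eq_bigr do rewrite integral_dirac// diracT mul1e hg.
  rewrite sumEFin -EFinM; congr EFin.
  rewrite /mean sA mulrC /=; congr (_ / _).
  by rewrite [RHS](big_nth 0) sA big_mkord.
rewrite /Rintegral integralE.
rewrite (main (fun x => Num.max (f x) 0) _ _ _ mpos); last 2 first.
- by move=> x; rewrite EFin_max funeposE.
- by move=> x; rewrite le_max lexx orbT.
rewrite (main (fun x => Num.max (- f x) 0) _ _ _ mneg); last 2 first.
- by move=> x; rewrite EFin_max EFinN funenegE.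
- by move=> x; rewrite le_max lexx orbT.
rewrite -EFinB /= -meanB; apply: eq_mean => x.
by case: (leP (f x) 0) => h; case: (leP (- f x) 0) => h'; lra.
Qed.

End Empirical.

Section Convergence.
Context {R : realType} d (Omega : measurableType d) (P : probability Omega R).
Variables (V : {poly R}) (n : nat) (c C : R).
Hypotheses (sV : size V = n.+3) (oV : odd (size V)) (lV : 0 < lead_coef V)
  (convV : forall x, 0 <= V^`()^`().[x]).
Hypotheses (c0 : 0 < c) (C0 : 0 <= C)
  (VC : forall y, c * y ^+ 2 - C <= V.[y])
  (dVC : forall y, c * y ^+ 2 - C <= V^`().[y] * y).
Variables (M : forall n : nat, Omega -> 'M[R[i]]_n.+1).
Hypothesis hM : forall n : nat, random_matrix_of P V (M n).

(** Polynomial means are polynomials in the coordinates; a general mean is a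
    pointwise limit of these, since each spectrum is bounded. *)
Lemma measurable_mean_eigenvalues m (f : R -> R) : continuous f ->
  measurable_fun setT (fun w => mean (eigenvalues (M m w)) f).
Proof.
move=> cf.
have e0 (j : nat) : 0 < j.+1%:R^-1 :> R by rewrite invr_gt0.
have /choice[q hq] : forall j : nat, exists q : {poly R},
    forall x, `|x| <= j%:R -> `|f x - q.[x]| <= j.+1%:R^-1.
  by move=> j; exact: weierstrass.
apply: (@measurable_fun_cvg _ _ _ _ (fun j w => mean (eigenvalues (M m w)) (fun x => (q j).[x]))).
  move=> j; have [_ mX _] := hM m.
  have -> : (fun w => mean (eigenvalues (M m w)) (fun x => (q j).[x])) =
      (fun x => \sum_(i < size (q j)) (q j)`_i * mom (spectrum x) i) \o (fun w => hermitian_coords (M m w)).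
    by apply/funext => w; rewrite mean_poly /= (eigenvalues_coords (hM m) w).
  apply: measurableT_comp => //; apply: measurable_polyfun.
  by apply: polyfun_sum => i _; apply: polyfunZ; exact: polyfun_mom.
move=> w _; set s := eigenvalues _.
have s0 : (0 < size s)%N by rewrite size_eigenvalues//; have [] := hM m.
pose b : R := \sum_(x <- s) `|x|.
have sb x : x \in s -> `|x| <= b.
  by move=> xs; rewrite /b (big_rem x)//= lerDl sumr_ge0.
apply/cvgrPdist_le => e e_gt0; near=> j.
have bj : b <= j%:R by near: j; exact: nbhs_infty_ger.
have ej : j.+1%:R^-1 <= e.
  by apply: ltW; near: j; exact: near_infty_natSinv_lt (PosNum e_gt0).
rewrite -meanB /mean normrM [`|_^-1|]ger0_norm ?invr_ge0// ler_pdivrMr ?ltr0n//.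
apply: le_trans (ler_norm_sum _ _ _) _.
apply: (@le_trans _ _ (\sum_(x <- s) e)).
  rewrite big_seq [leRHS]big_seq; apply: ler_sum => x xs.
  by rewrite (le_trans _ ej)// hq// (le_trans (sb x xs)).
by rewrite big_const_seq count_predT iter_addr_0 mulr_natr.
Unshelve. all: by end_near. Qed.

(** Spectra that are good for more and more loop equations have a limit state,
    which is the limit law. *)
Lemma exists_spectra_state (s : nat -> seq R) (K : nat -> R) :
  (forall j, (0 < size (s j))%N) ->
  (forall j l, (l <= j)%N -> mom (s j) (2 * l) <= K l) ->
  (forall j m, (m <= j)%N -> `|resid V m (s j)| <= j.+1%:R^-1) ->
  exists (a b : R) (U : set_system nat), [/\ a < b, arcmean a b V^`() = 0,
    arcmean a b ('X * V^`()) = 2, ProperFilter U & \oo `<=` U /\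
    forall f, continuous f -> bounded_fun f -> mean (s j) f @[j --> U] --> limit_mean V a b f].
Proof.
move=> s0 sK sr; have [U [Lam [UU sU HL hL]]] := exists_loop_state s0 sK sr.
have [b0 b0_gt0 supp] := state_support HL c0 C0 dVC.
have [a [b [ab e0 e1 mE]]] := exists_support sV lV convV HL b0_gt0 supp oV.
exists a, b, U; split=> //; first exact: ultra_proper.
split=> // f cf bf.
have pf : poly_growth f.
  have [B [_ hB]] := bf; apply: (@poly_growth_bounded _ f (B + 1)) => x.
  by apply: hB => //; rewrite ltrDl.
by rewrite -(state_limit_mean sV lV convV ab HL supp mE cf pf); exact: hL.
Qed.

(** The event of [good_event] has probability less than one, so that at each
    precision some deterministic spectrum is good. *)
Lemma good_spectrum (tau : R) : 0 < tau < 1 -> exists K : nat -> R, forall L delta, 0 < delta ->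
  (\forall m \near \oo, exists B : set Omega, [/\ measurable B, (P B <= tau%:E)%E &
    forall w, ~ B w -> let s := eigenvalues (M m w) in [/\ (0 < size s)%N,
     (forall l, (l <= L)%N -> mom s (2 * l) <= K l) &
     (forall m, (m <= L)%N -> `|resid V m s| <= delta)]]) /\
  exists s : seq R, [/\ (0 < size s)%N, (forall l, (l <= L)%N -> mom s (2 * l) <= K l) &
     (forall m, (m <= L)%N -> `|resid V m s| <= delta)].
Proof.
move=> /andP[tau0 tau1]; have [K hK] := good_event c0 C0 VC dVC hM tau0.
exists K => L delta d0; have h := hK L delta d0.
have h' : \forall m \near \oo, exists B : set Omega, [/\ measurable B, (P B <= tau%:E)%E &
    forall w, ~ B w -> let s := eigenvalues (M m w) in [/\ (0 < size s)%N,
     (forall l, (l <= L)%N -> mom s (2 * l) <= K l) &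
     (forall m, (m <= L)%N -> `|resid V m s| <= delta)]].
  apply: filterS h => m [B [mB PB hB]]; exists B; split=> // w nB.
  have [h1 h2] := hB w nB; split=> //.
  by rewrite size_eigenvalues//; have [] := hM m.
split=> //; have [m [B [mB PB hB]]] := filter_ex h'.
have [w nB] : exists w, ~ B w.
  apply: contrapT => nw; have BT : B = setT.
    by apply/seteqP; split=> // w _; apply: contrapT => nB; apply: nw; exists w.
  by move: PB; rewrite BT probability_setT lee_fin leNgt tau1.
by exists (eigenvalues (M m w)); exact: hB.
Qed.

Lemma exists_limit_support : exists a b : R,
  [/\ a < b, arcmean a b V^`() = 0 & arcmean a b ('X * V^`()) = 2].
Proof.
have t01 : 0 < (2^-1 : R) < 1 by rewrite invr_gt0 ltr0n invf_lt1// ltr1n.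
have [K hK] := good_spectrum t01.
have /choice[s hs] : forall j : nat, exists s : seq R, [/\ (0 < size s)%N,
   (forall l, (l <= j)%N -> mom s (2 * l) <= K l) &
   (forall m, (m <= j)%N -> `|resid V m s| <= j.+1%:R^-1)].
  by move=> j; have [] := hK j j.+1%:R^-1; rewrite ?invr_gt0.
have [|||a [b [U [ab e0 e1 _ _]]]] := @exists_spectra_state s K.
- by move=> j; have [] := hs j.
- by move=> j; have [] := hs j.
- by move=> j; have [] := hs j.
by exists a, b.
Qed.

(** Good spectra of high enough precision have means within [eps] of the limit:
    otherwise bad ones would have, through [exists_spectra_state], a limit that is the
    limit law of another interval, which [support_unique] excludes. *)
Lemma mean_eigenvalues_cvg a b : a < b -> arcmean a b V^`() = 0 ->
  arcmean a b ('X * V^`()) = 2 -> forall f, continuous f -> bounded_fun f ->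
  cvg_in_probability P (fun m w => mean (eigenvalues (M m w)) f) (limit_mean V a b f).
Proof.
move=> ab e0 e1 f cf bf; split; first by move=> m; exact: measurable_mean_eigenvalues.
move=> eps eps0.
pose A m := [set w | eps <= `|mean (eigenvalues (M m w)) f - limit_mean V a b f|].
have mA m : measurable (A m).
  have mf : measurable_fun setT (fun w => `|mean (eigenvalues (M m w)) f - limit_mean V a b f|).
    apply: measurableT_comp => //; apply: measurable_funB => //.
    exact: measurable_mean_eigenvalues.
  have := mf measurableT `[eps, +oo[%classic (measurable_itv _).
  rewrite setTI; congr measurable; apply/seteqP; split => w /=;
    by rewrite in_itv /= andbT.
have key tau : 0 < tau < 1 -> \forall m \near \oo, (P (A m) <= tau%:E)%E.
  move=> t01; have [K hK] := good_spectrum t01.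
  have [j hj] : exists j : nat, forall s : seq R, (0 < size s)%N ->
     (forall l, (l <= j)%N -> mom s (2 * l) <= K l) ->
     (forall m, (m <= j)%N -> `|resid V m s| <= j.+1%:R^-1) ->
     `|mean s f - limit_mean V a b f| < eps.
    apply: contrapT => nj.
    have /choice[s hs] : forall j : nat, exists s : seq R, [/\ (0 < size s)%N,
       (forall l, (l <= j)%N -> mom s (2 * l) <= K l),
       (forall m, (m <= j)%N -> `|resid V m s| <= j.+1%:R^-1) &
       eps <= `|mean s f - limit_mean V a b f|].
      move=> j; apply: contrapT => ns; apply: nj; exists j => s s0 sK sr.
      by rewrite ltNge; apply/negP => h; apply: ns; exists s.
    have [|||a' [b' [U [ab' e0' e1' PU [sU hU]]]]] := @exists_spectra_state s K.
    - by move=> j; have [] := hs j.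
    - by move=> j; have [] := hs j.
    - by move=> j; have [] := hs j.
    have [Ea Eb] := support_unique sV convV ab ab' e0 e1 e0' e1'; subst a' b'.
    have /cvgrPdist_lt/(_ _ eps0) hn := hU f cf bf.
    have [j] := filter_ex hn; rewrite distrC.
    by have [_ _ _] := hs j; rewrite leNgt => /negP.
  have [h _] := hK j j.+1%:R^-1 (ltac:(by rewrite invr_gt0)).
  apply: filterS h => m [B [mB PB hB]]; apply: le_trans PB.
  apply: le_measure; rewrite ?inE// => w Aw; apply: contrapT => nB.
  by have [h1 h2 h3] := hB w nB; have := hj _ h1 h2 h3; rewrite ltNge Aw.
have fin m : P (A m) \is a fin_num by exact: fin_num_measure.
rewrite (_ : (fun m => _) = (fun m => (fine (P (A m)))%:E)); last first.
  by apply/funext => m; rewrite fineK.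
apply: cvg_EFin; first exact: nearW.
apply/cvgrPdist_le => tau tau0.
have t01 : 0 < Num.min tau 2^-1 < 1.
  by rewrite lt_min tau0 invr_gt0 ltr0n /= gt_min invf_lt1 ?ltr1n ?orbT.
apply: filterS (key _ t01) => m; rewrite /= sub0r normrN ger0_norm ?fine_ge0//.
by rewrite -{1}(fineK (fin m)) lee_fin le_min => /andP[].
Qed.

End Convergence.

(** * Convex potentials and the support equations *)

Section ConvexPolynomials.
Context {R : realType}.

(** The second difference [V(x + h) + V(x - h) - 2 V(x)] is [h ^ 2] times a polynomial
    in [h] whose value at [0] is the second derivative. *)
Lemma convex_deriv2_ge0 (V : {poly R}) (x : R) :
  convex_function (setT : set R) (fun x => V.[x]) -> 0 <= V^`()^`().[x].
Proof.
move=> cV; pose T := V \Po ('X + x%:P).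
have TE h : T.[h] = V.[h + x] by rewrite horner_comp !hornerE.
have [c0 [c1 [c2 [S TS]]]] : exists c0 c1 c2 (S : {poly R}),
    T = ((S * 'X + c2%:P) * 'X + c1%:P) * 'X + c0%:P.
  have dec (q : {poly R}) : exists c (S : {poly R}), q = S * 'X + c%:P.
    by elim/poly_ind: q => [|q c _]; [exists 0, 0; rewrite mul0r addr0|exists c, q].
  have [c0 [S0 E0]] := dec T; have [c1 [S1 E1]] := dec S0.
  have [c2 [S2 E2]] := dec S1.
  by exists c0, c1, c2, S2; rewrite E0 E1 E2.
have V2 : V^`()^`().[x] = 2 * c2.
  have -> : V^`()^`().[x] = T^`()^`().[0].
    have dq : ('X + x%:P)^`() = 1 :> {poly R} by rewrite derivD derivX derivC addr0.
    by rewrite /T !deriv_comp dq mulr1 deriv_comp dq mulr1 horner_comp !hornerE.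
  rewrite TS !(derivD, derivM, derivX, derivC) !hornerE /=.
  by rewrite !addr0 mulr_natl mulr2n.
rewrite V2; pose G := (2 * c2)%:P + 'X * (S - (S \Po (- 'X))).
have -> : 2 * c2 = G.[0] by rewrite /G !hornerE.
apply: (@poly_ge0_lim _ G 0 1) => h /andP[h0 _]; rewrite add0r mul1r.
have mid : 0 <= T.[h] + T.[- h] - 2 * T.[0].
  have t01 : (0 <= (2^-1 : R) <= 1) by rewrite invr_ge0 ler0n invf_le1// ler1n.
  pose t : {i01 R} := Itv01 (proj1 (andP t01)) (proj2 (andP t01)).
  have := cV t (h + x) (- h + x) (in_setT _) (in_setT _).
  rewrite [X in V.[X] <= _](_ : _ = x); last by rewrite [LHS]convRE /= /unstable.onem; field.
  rewrite convRE /= /unstable.onem !TE add0r; lra.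
have GE : T.[h] + T.[- h] - 2 * T.[0] = h ^+ 2 * G.[h].
  by rewrite TS /G !(hornerE, horner_comp) /=; ring.
by move: mid; rewrite GE pmulr_rge0// exprn_gt0.
Qed.

(** With a negative leading coefficient, [- V] is coercive and [V] is bounded above. *)
Lemma lead_coef_cvg_pinfty (V : {poly R}) : odd (size V) ->
  V.[x] @[x --> +oo] --> +oo -> 0 < lead_coef V /\ (1 < size V)%N.
Proof.
move=> oV /cvgryPge hV.
have below K : ~ (forall x, V.[x] <= K).
  move=> h; have /filter_ex[x] := hV (K + 1).
  by have := h x; lra.
have s1 : (1 < size V)%N.
  rewrite ltnNge; apply/negP => /size1_polyC E.
  by apply: (below V`_0) => x; rewrite {1}E hornerC.
split=> //; rewrite ltNge; apply/negP => l0.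
have l1 : 0 < lead_coef (- V).
  rewrite lead_coefN oppr_gt0 lt_neqAle l0 andbT lead_coef_eq0 -size_poly_gt0.
  by rewrite (ltn_trans _ s1).
have [||c [C [c0 _ h]]] := poly_quadratic_lower _ _ l1; rewrite ?size_polyN//.
apply: (below C) => x; have := h x; rewrite hornerN.
have : 0 <= c * x ^+ 2 by rewrite mulr_ge0 ?sqr_ge0 ?(ltW c0).
by lra.
Qed.

End ConvexPolynomials.

Section SupportEquations.
Context {R : realType}.
Variables (V : {poly R}) (a b : R).
Hypothesis ab : a < b.

Lemma support_equationsP : support_equations V a b <->
  arcmean a b V^`() = 0 /\ arcmean a b ('X * V^`()) = 2.
Proof.
have p0 := @pi_gt0 R; have pn0 : pi != 0 :> R by rewrite gt_eqF.
have E (q : nat) : \int[lebesgue_measure]_(u in `]a, b[)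
      (u ^+ q * V^`().[u] / Num.sqrt ((b - u) * (u - a))) = pi * arcmean a b ('X^q * V^`()).
  rewrite (arcsine_integral ab (g := fun u => u ^+ q * V^`().[u])).
    by congr (_ * tmean _); apply/funext => t; rewrite hornerM hornerXn.
  have -> : (fun u : R => u ^+ q * V^`().[u]) = horner ('X^q * V^`()).
    by apply/funext => u; rewrite hornerM hornerXn.
  exact: continuous_horner.
split=> [h|[h0 h1] [|[|q]]//= _].
- split.
    apply: (mulfI pn0); have := h 0%N isT; rewrite E expr0 mul1r => ->.
    by rewrite mulr0 mulr0.
  apply: (mulfI pn0); have := h 1%N isT; rewrite E expr1 => ->.
  by rewrite mulr1 mulrC.
- by rewrite E expr0 mul1r h0 !mulr0.
- by rewrite E expr1 h1 mulr1 mulrC.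
Qed.

End SupportEquations.

Theorem theorem3p1 (R : realType) (d : measure_display)
    (Omega : measurableType d) (P : probability Omega R)
    (V : {poly R}) (p : nat)
    (hdeg : size V = (2 * p).+1)
    (hconvex : convex_function (setT : set R) (fun x => V.[x]))
    (hgrowl : V.[x] @[x --> -oo] --> +oo)
    (hgrowr : V.[x] @[x --> +oo] --> +oo)
    (M : forall n : nat, Omega -> 'M[R[i]]_n.+1)
    (hM : forall n : nat, random_matrix_of P V (M n)) :
  exists a b : R,
    [/\ a < b,
        support_equations V a b,
        forall a' b' : R, a' < b' -> support_equations V a' b' ->
          a' = a /\ b' = b,
        exists Q : {poly R},
          [/\ size Q = (2 * p - 2).+1,
              forall x : R, Q.[x] = density_factor V a b x
            & forall x : R, a < x < b -> 0 < Q.[x]]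
      & exists N : {measure set (measurableTypeR R) -> \bar R},
          (forall A : set (measurableTypeR R), measurable A ->
             N A = (\int[lebesgue_measure]_(x in A)
                      (limit_density V a b x)%:E)%E) /\
          weak_cvg_in_probability P (fun n w => empirical_measure (M n w)) N].
Proof.
have oV : odd (size V) by rewrite hdeg /= oddM.
have [lV s1] := lead_coef_cvg_pinfty oV hgrowr.
have sV : size V = (2 * p - 2).+3 by rewrite hdeg in s1 *; lia.
have convV x : 0 <= V^`()^`().[x] by exact: convex_deriv2_ge0.
have [c [C [c0 C0 VC dVC]]] : exists c C : R, [/\ 0 < c, 0 <= C,
    forall y, c * y ^+ 2 - C <= V.[y] & forall y, c * y ^+ 2 - C <= V^`().[y] * y].
  have [c1 [C1 [c10 C10 h1]]] := poly_quadratic_lower oV s1 lV.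
  have sdV := size_deriv_real V; have ldV := lead_coef_deriv_gt0 s1 lV.
  have dV0 : V^`() != 0 by rewrite -lead_coef_eq0 gt_eqF.
  have sX : size (V^`() * 'X) = size V by rewrite size_mulX// sdV; lia.
  have lX : 0 < lead_coef (V^`() * 'X) by rewrite lead_coefM lead_coefX mulr1.
  have [||c2 [C2 [c20 C20 h2]]] := poly_quadratic_lower _ _ lX; rewrite ?sX//.
  exists (Num.min c1 c2), (Num.max C1 C2); split.
  - by rewrite lt_min c10.
  - by rewrite le_max C10.
  - move=> y; apply: le_trans (h1 y); apply: lerB; last by rewrite le_max lexx.
    by apply: ler_wpM2r; rewrite ?sqr_ge0// ge_min lexx.
  - move=> y; have := h2 y; rewrite hornerMX; apply: le_trans; apply: lerB.
      by apply: ler_wpM2r; rewrite ?sqr_ge0// ge_min lexx orbT.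
    by rewrite le_max lexx orbT.
have [a [b [ab e0 e1]]] := exists_limit_support sV oV lV convV c0 C0 VC dVC hM.
exists a, b; split=> //.
- by apply/support_equationsP.
- move=> a' b' ab' /(support_equationsP _ ab')[e0' e1'].
  exact: (support_unique sV convV ab ab').
- have p0 := @pi_gt0 R.
  have k0 : 0 < (2 * pi : R)^-1 by rewrite invr_gt0 mulr_gt0.
  exists ((2 * pi)^-1 *: density_poly V a b); split.
  + by rewrite size_scale ?gt_eqF// (size_density_poly sV lV).
  + by move=> x; rewrite hornerZ (density_factorE V x ab) mulrC.
  + by move=> x _; rewrite hornerZ mulr_gt0// (density_poly_gt0 sV lV convV).
- have [N [NE Nf]] := exists_limit_law sV lV convV ab.
  exists N; split=> // phi cphi bphi; rewrite Nf//.
  have -> : (fun n w => \int[empirical_measure (M n w)]_x phi x) =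
      (fun n w => mean (eigenvalues (M n w)) phi).
    apply/funext => n; apply/funext => w; apply: Rintegral_empirical_measure.
      by have [] := hM n.
    exact: continuous_measurable_fun.
  exact: (mean_eigenvalues_cvg sV oV lV convV c0 C0 VC dVC hM ab e0 e1).
Qed.
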